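(* Let $r,s$ be coprime positive integers, let $m\ge 1$, $\mathbf a=(a_1,\dots,a_m)$, $\mathbf b=(b_1,\dots,b_m)\in\mathbb Z_{\ge 0}^m$, $\mathbf n=(n_1,\dots,n_m)\in\mathbb Z^m$, and put $|\mathbf n|=n_1+\dots+n_m$. Then the quantum polylogarithms satisfy the distribution relations $$r^{|\mathbf n|-m}\,\mathcal F^{\frac{r}{s}\hbar}_{\mathbf a,\mathbf b,\mathbf n}(r\omega_1,\dots,r\omega_m)=\sum_{\alpha}\sum_{\beta}\mathcal F^{\hbar}_{\mathbf a,\mathbf b,\mathbf n}(\zeta_1,\dots,\zeta_m),\qquad \zeta_k=\omega_k+\frac{2\pi i}{r}\sum_{j=1}^{a_k}\alpha_{k,j}+\frac{2\pi i\hbar}{s}\sum_{j=1}^{b_k}\beta_{k,j}.$$ Here the sums run over all families $\alpha=(\alpha_{k,j})_{1\le k\le m,\,1\le j\le a_k}$ and $\beta=(\beta_{k,j})_{1\le k\le m,\,1\le j\le b_k}$, where each $\alpha_{k,j}$ runs from $\tfrac{1-r}{2}$ to $\tfrac{r-1}{2}$ in steps of $1$ and each $\beta_{k,j}$ runs from $\tfrac{1-s}{2}$ to $\tfrac{s-1}{2}$ in steps of $1$ (so the sum is over half-integers if the summation limits are half-integers).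
   Context: Put $\mathfrak{sh}(x)=e^{x}-e^{-x}$. For non-negative integers $a,b$ the kernel function is $K^\hbar_{a,b}(p;\omega)=\dfrac{e^{-ip\omega}}{\mathfrak{sh}^a(\pi p)\,\mathfrak{sh}^b(\pi\hbar p)}$, where $\hbar$ is a complex parameter. For $\mathbf a,\mathbf b\in\mathbb Z_{\ge0}^m$ and $\mathbf n\in\mathbb Z^m$ the depth $m$ quantum polylogarithm is $$\mathcal F^\hbar_{\mathbf a,\mathbf b,\mathbf n}(\omega_1,\dots,\omega_m)=i^{|\mathbf n|-m}\int_{(\mathbb R+i0)^m}\bigwedge_{k=1}^m K^\hbar_{a_k,b_k}(p_k;\omega_k)\,\frac{dp_k}{(p_1+\dots+p_k)^{n_k}}.$$ The contour $\mathbb R+i0$ is the limit of the contour $\mathbb R+i\varepsilon$, $\varepsilon>0$, as $\varepsilon\to0$. The integral converges if $|\mathrm{Im}\,\omega_k|<\pi(a_k+b_k|\mathrm{Re}\,\hbar|)$ for all $k$, and $\mathcal F^\hbar_{\mathbf a,\mathbf b,\mathbf n}$ is extended to a multivalued analytic function of $(\omega_1,\dots,\omega_m)\in\mathbb C^m$ by means of the difference relations it satisfies under the shifts of $\omega_k$ by $\pm i\pi$ and $\pm i\pi\hbar$ (the difference of the values at $\omega_k+i\pi$ and $\omega_k-i\pi$ lowers $a_k$ by one; the difference of the values at $\omega_k+i\pi\hbar$ and $\omega_k-i\pi\hbar$ lowers $b_k$ by one).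
   Formalization: The printed relation fails for r>1, |n|≠m (e.g. m=1, a=1, b=0, n=2, r=2, s=1, a dilogarithm); the factor r^{|n|-m} is moved to the other side: F^{(r/s)ħ}(rω) = r^{|n|-m} ΣΣ F^ħ(ζ). *)

(* Defs.v *)
From HB Require Import structures.
From mathcomp Require Import all_boot all_order all_algebra.
From mathcomp Require Import complex.
From mathcomp Require Import all_classical all_reals all_analysis.
Set Implicit Arguments.
Unset Strict Implicit.
Unset Printing Implicit Defensive.
Import Order.TTheory GRing.Theory Num.Theory.
Import numFieldNormedType.Exports.
Local Open Scope classical_set_scope.
Local Open Scope ring_scope.
Local Open Scope complex_scope.

(* The regular module R[i]^o is convertible to R[i]; it is the version that
   carries the topology, hence also the product topology on 'rV[CC R]_m. *)
Notation CC R := (R[i]^o).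

Section Integral.
Variable R : realType.

Definition cexp (z : CC R) : CC R :=
  (expR (complex.Re z) * cos (complex.Im z)) +i*
  (expR (complex.Re z) * sin (complex.Im z)).

Definition sh (z : CC R) : CC R := cexp z - cexp (- z).

Definition cintegral (f : R -> CC R) : CC R :=
  (\int[lebesgue_measure]_x complex.Re (f x)) +i*
  (\int[lebesgue_measure]_x complex.Im (f x)).

(* Lebesgue integral over R^m, written as an iterated integral; the integrands
   below are continuous and, on the domain qpl_dom, absolutely integrable. *)
Fixpoint mintegral (m : nat) : ('rV[R]_m -> CC R) -> CC R :=
  match m with
  | 0 => fun f => f 0
  | m'.+1 => fun f =>
      cintegral (fun x => mintegral (fun v : 'rV[R]_m' =>
                                       f (row_mx (x%:M : 'rV_1) v)))
  end.

(* Integral over the contour (R + i0)^m. *)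
Definition contour_integral (m : nat) (f : 'rV[CC R]_m -> CC R) : CC R :=
  lim (mintegral (fun x : 'rV[R]_m => f (map_mx (fun t => (t +i* e : CC R)) x))
         @[e --> (0 : R)^'+]).

End Integral.

Section QuantumPolylogarithm.
Variables (R : realType) (hbar : CC R) (m : nat).
Implicit Types (a b : 'I_m -> nat) (n : 'I_m -> int).

Definition qpl_kernel (a b : nat) (p omega : CC R) : CC R :=
  cexp (- ('i * p * omega)) /
  (sh (pi%:C * p) ^+ a * sh (pi%:C * hbar * p) ^+ b).

Definition qpl_integrand a b n (omega p : 'rV[CC R]_m) : CC R :=
  \prod_(k < m) (qpl_kernel (a k) (b k) (p 0 k) (omega 0 k)
                 / (\sum_(j < m | (j <= k)%N) p 0 j) ^ n k).

(* The value given by the integral; meaningful on qpl_dom. *)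
Definition qpl a b n (omega : 'rV[CC R]_m) : CC R :=
  'i ^ (\sum_(k < m) n k - m%:Z) * contour_integral (qpl_integrand a b n omega).

Definition qpl_width a b (k : 'I_m) : R :=
  pi * ((a k)%:R + (b k)%:R * `|complex.Re hbar|).

Definition qpl_dom a b (omega : 'rV[CC R]_m) : Prop :=
  forall k, `|complex.Im (omega 0 k)| < qpl_width a b k.

End QuantumPolylogarithm.

Section Continuation.
Variables (R : realType) (m : nat).

(* f is the sum of an absolutely convergent power series on the polydisc of
   radius rho around c: the bound on the coefficients A gives the absolute
   convergence, and the series is summed by homogeneous parts.
   Note that 0 < rho in R[i] entails that rho is real. *)
Definition analytic_at (f : 'rV[CC R]_m -> CC R) (c : 'rV[CC R]_m) : Prop :=
  exists (A : ('I_m -> nat) -> CC R) (rho M : R[i]),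
    [/\ 0 < rho,
        forall nu : 'I_m -> nat, `|A nu| * rho ^+ (\sum_(k < m) nu k) <= M
      & forall h : 'rV[CC R]_m, (forall k, `|h 0 k| < rho) ->
        series (fun d : nat =>
          \sum_(nu : {ffun 'I_m -> 'I_d.+1} | (\sum_(k < m) nu k == d)%N)
             A (fun k => nu k) * \prod_(k < m) h 0 k ^+ nu k)
        @ \oo --> f (c + h)].

(* v is obtained at delta 1 by analytic continuation along the path delta on
   [0, 1] of the function f given on the open set D, where delta 0 lies in the
   closure of D: the germ at delta 0 that is continued agrees with f on D. *)
Definition continues_to (D : 'rV[CC R]_m -> Prop) (f : 'rV[CC R]_m -> CC R)
    (delta : R -> 'rV[CC R]_m) (v : CC R) : Prop :=
  exists g : R -> 'rV[CC R]_m -> CC R,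
    [/\ forall t : R, 0 <= t <= 1 -> analytic_at (g t) (delta t),
        forall t : R, 0 <= t <= 1 -> \forall u \near t, 0 <= u <= 1 ->
          \forall z \near delta u, g u z = g t z,
        \forall z \near delta 0, D z -> g 0 z = f z
      & v = g 1 (delta 1)].

End Continuation.

Section Branch.
Variables (R : realType) (hbar : CC R) (m : nat).
Variables (a b : 'I_m -> nat) (n : 'I_m -> int).

(* The integral converges nowhere when qpl_degenerate is nonempty. The function
   is then defined through the difference relations: raising a_k by one for
   the degenerate k makes the domain nonempty, and the function is the iterated
   difference of the raised one at the points omega_k + i pi, omega_k - i pi.
   For omega in qpl_base these points lie in the closure of the raised domain. *)
Definition qpl_degenerate : {set 'I_m} := [set k | qpl_width hbar a b k == 0].

Definition qpl_raised (k : 'I_m) : nat := (a k + (k \in qpl_degenerate))%N.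

Definition qpl_base (omega : 'rV[CC R]_m) : Prop :=
  forall k, if k \in qpl_degenerate then complex.Im (omega 0 k) = 0
            else `|complex.Im (omega 0 k)| < qpl_width hbar a b k.

(* E is the set of the k for which the point omega_k - i pi is taken. *)
Definition qpl_shift (E : {set 'I_m}) : 'rV[CC R]_m :=
  \row_k (if k \in qpl_degenerate then (-1) ^+ (k \in E) * (pi%:C * 'i) else 0).

(* v is the value at gamma 1 of the branch, along the path gamma, of the
   multivalued analytic function extending qpl hbar a b n. If no index is
   degenerate, only E = set0 occurs, with zero shift, and this is the analytic
   continuation along gamma of the integral. *)
Definition qpl_branch (gamma : R -> 'rV[CC R]_m) (v : CC R) : Prop :=
  [/\ {within `[0, 1], continuous gamma}, qpl_base (gamma 0)
    & exists w : {set 'I_m} -> CC R,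
        (forall E : {set 'I_m}, E \subset qpl_degenerate ->
           continues_to (qpl_dom hbar qpl_raised b) (qpl hbar qpl_raised b n)
                        (fun t => gamma t + qpl_shift E) (w E)) /\
        v = \sum_(E : {set 'I_m} | E \subset qpl_degenerate)
              (-1) ^+ #|E| * w E].

End Branch.

(* In the distribution relation the power r^(|n|-m) multiplies the sum, because
   p = q / r turns dp / p^n into r^(n-1) dq / q^n. For example qpl is the
   function Li_2 (- e^omega) for m = 1, a = 1, b = 0, n = 2, and
   Li_2 (x^2) = 2 (Li_2 x + Li_2 (- x)). *)
Section Distribution.
Variables (R : realType) (m : nat).

(* The element number i, starting from 0, of (1-r)/2, (1-r)/2 + 1, ...,
   (r-1)/2. *)
Definition centered (r : nat) (i : 'I_r) : CC R := (1 - r%:R) / 2 + i%:R.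

(* The families (x_{k,j}) with 0 <= j < c k and r possible values. *)
Definition qpl_family (c : 'I_m -> nat) (r : nat) : finType :=
  {ffun {k : 'I_m & 'I_(c k)} -> 'I_r}.

Definition family_sum (c : 'I_m -> nat) (r : nat)
    (x : qpl_family c r) (k : 'I_m) : CC R :=
  \sum_(j < c k) centered (x (existT _ k j)).

Definition zeta (hbar : CC R) (r s : nat) (a b : 'I_m -> nat)
    (alpha : qpl_family a r) (beta : qpl_family b s)
    (omega : 'rV[CC R]_m) : 'rV[CC R]_m :=
  \row_k (omega 0 k
          + 2 * pi%:C * 'i / r%:R * family_sum alpha k
          + 2 * pi%:C * 'i * hbar / s%:R * family_sum beta k).

End Distribution.

(* Main.v *)
Require Import Defs.
From HB Require Import structures.
From mathcomp Require Import all_boot all_order all_algebra.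
From mathcomp Require Import complex ring lra zify.
From mathcomp Require Import all_classical all_reals all_analysis measurable_realfun.
Import Order.TTheory GRing.Theory Num.Theory.
Import numFieldNormedType.Exports.
Local Open Scope classical_set_scope.
Local Open Scope ring_scope.
Local Open Scope complex_scope.
Set Implicit Arguments.
Unset Strict Implicit.
Unset Printing Implicit Defensive.
Import ComplexField.Normc.

(** Where the integrals converge, the relation is a computation with the
    kernel. Telescoping gives sh (N x) = sh x * sum_i exp (2 x c_i), where c_i
    runs over the centred values (1-N)/2, ..., (N-1)/2. Substitute p = q / r in
    the integral with parameter (r/s) hbar. The factors of the denominator
    become sh (pi q / r) and sh (pi hbar q / s), and the identity turns their
    inverses into 1 / sh (pi q) and 1 / sh (pi hbar q) times sums of
    exponentials. Expanding the powers a_k and b_k of these sums and the product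
    over k produces the sum over alpha and beta, and the exponentials shift
    omega to zeta ([integrand_distribution]). The two sides live on the contours
    R + i e / r and R + i e. This is harmless because the integral over R + i e
    does not depend on e, for small e > 0 ([qplI_indep]), so that the limit
    defining the contour integral is its value at any small e ([qplE]). The
    result is [qpl_distribution].

    For branches, the difference of the two sides at time t is a finite
    combination of the continued germs, read through affine maps as a germ at
    gamma t. If such a germ vanishes at t = 0 it vanishes for all t, by the
    identity theorem and the connectedness of [0, 1] ([germ_vanish]). If no index
    is degenerate, vanishing at t = 0 is the relation between integrals. At a
    degenerate index k the germs start at the boundary points omega_k + i pi and
    omega_k - i pi of the domain of the raised integral. Such an integral need
    not converge at these points, and since the domains lie on different sides of
    them, there is no open set of omega where all integrals converge.

    The remedy is to multiply the integrand by powers (i / p_k)^(nu_k), with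
    nu_k large at the degenerate k. These regularised integrals converge
    absolutely on the closed domain and are continuous there
    ([qplI_continuous]). Differentiation in omega_k lowers nu_k by one
    ([qplI_derivative]), hence an iterated finite difference of the regularised
    integral with small step d, divided by d^|nu|, comes close to the boundary
    value of the germ ([boundary_value]). Both the distribution relation and the
    difference relation in omega_k hold exactly for regularised integrals, also
    at boundary points ([qplI_distribution], [qplI_difference]). Taking finite
    differences of these relations and letting d tend to 0 shows that the
    combination of germs vanishes at all points gamma 0 + x with x small and
    real; real displacements do not change the position with respect to the
    domains. A power series that vanishes at all small real points is zero
    ([identity_real]). The argument applies to every finite linear relation
    between regularised integrals, and it is carried out in this generality in
    [branch_relation].

    Two analytic facts are obtained by real methods. Contour independence comes
    from subdivision: on a step of length h of the contour, the change of the
    integral is O(h^2), because the integrand has a complex derivative with a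
    uniform relative error ([rel2]) and its integral is invariant under real
    translations. The identity theorem reduces to one real variable: dividing a
    power series by its zeros s_1, ..., s_N in an interval bounds the constant
    term by M (5/7)^N for every N ([coef0_bound]). *)

(** * Integrals over the line and over R^m *)

Section Affine.
Variable R : realType.
Local Notation mu := (@lebesgue_measure R).

(** The common majorant 1 / (1 + x^2): it is integrable over R and every
    estimate of an integrand below is by a multiple of a product of weights. *)
Definition weight (x : R) : R := (oneDsqr x)^-1.

Lemma weight_gt0 x : 0 < weight x.
Proof. by rewrite invr_gt0 (lt_le_trans ltr01 (oneDsqr_ge1 x)). Qed.

Lemma weight_ge0 x : 0 <= weight x.
Proof. exact/ltW/weight_gt0. Qed.

Lemma weight_measurable : measurable_fun setT weight.
Proof. by apply: continuous_measurable_fun; exact: continuous_oneDsqrV. Qed.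

(** The image of the Lebesgue measure under an affine map, rescaled, agrees with
    the Lebesgue measure on half-open intervals, hence everywhere. *)
Lemma ge0_integral_affine (c d : R) (f : R -> \bar R) : 0 < c ->
  measurable_fun setT f -> (forall x, 0 <= f x)%E ->
  (\int[mu]_x f (c * x + d)%R = (c^-1)%:E * \int[mu]_x f x)%E.
Proof.
move=> c0 mf f0.
pose phi : R -> measurableTypeR R := fun x => c * x + d.
have mphi : measurable_fun setT phi.
  apply: measurable_funD => //; exact: measurable_funM.
have ci0 : (0 <= c)%R by exact: ltW.
pose nu0 := mscale (NngNum ci0) (pushforward mu phi).
pose nu := nu0 mphi.
have nuE A : measurable A -> mu A = nu A.
  apply: lebesgue_measure_unique => _ [[a b]] _ <-.
  change (mu `]a, b]%classic = (c%:E * mu (phi @^-1` `]a, b]%classic))%E).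
  rewrite (_ : phi @^-1` `]a, b]%classic = `](a - d) / c, (b - d) / c]%classic); last first.
    apply/seteqP; split => x /=; rewrite !in_itv/= /phi;
      by rewrite ltr_pdivrMr// ler_pdivlMr// ltrBlDr lerBrDr (mulrC x).
  rewrite !lebesgue_measure_itv/= !lte_fin ltr_pM2r ?invr_gt0// ltrD2r.
  case: ifPn => ab; last by rewrite mule0.
  rewrite -!EFinB -EFinM -mulrBl mulrC divfK ?gt_eqF//.
  by rewrite opprB addrA subrK.
have /= -> : (\int[mu]_x f x = \int[nu]_x f x)%E.
  by apply: eq_measure_integral => A mA _; exact: nuE.
rewrite /nu /nu0 ge0_integral_mscale//= ge0_integral_pushforward//=.
rewrite preimage_setT muleA -EFinM mulVf ?gt_eqF// mul1e.
by [].
Qed.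

Lemma Rintegral_affine (c d : R) (f : R -> R) : 0 < c ->
  mu.-integrable setT (EFin \o f) ->
  \int[mu]_x f (c * x + d)%R = c^-1 * \int[mu]_x f x.
Proof.
move=> c0 intf; have mf := measurable_int _ intf.
rewrite /Rintegral.
have -> : (\int[mu]_x (f (c * x + d))%:E = (c^-1)%:E * \int[mu]_x (f x)%:E)%E.
  rewrite integralE [X in _ = (_ * X)%E]integralE.
  have hp := ge0_integral_affine d c0 (measurable_funepos mf) (fun x => funepos_ge0 _ x).
  have hn := ge0_integral_affine d c0 (measurable_funeneg mf) (fun x => funeneg_ge0 _ x).
  rewrite muleBr//; last first. exact: (integrable_add_def measurableT intf).
  by rewrite -hp -hn; congr (_ - _)%E; apply: eq_integral => x _; rewrite ?(funeposE, funenegE).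
rewrite fineM//. exact: (integrable_fin_num measurableT intf).
Qed.

Lemma integrable_affine (c d : R) (f : R -> R) : 0 < c ->
  mu.-integrable setT (EFin \o f) ->
  mu.-integrable setT (EFin \o (fun x => f (c * x + d))).
Proof.
move=> c0 /integrableP[mf foo].
have mphi : measurable_fun setT (fun x : R => c * x + d).
  by apply: measurable_funD => //; exact: measurable_funM.
apply/integrableP; split; first exact: (measurableT_comp mf mphi).
have := @ge0_integral_affine c d (abse \o (EFin \o f)) c0.
rewrite /comp => -> //.
- by rewrite lte_mul_pinfty// ?lee_fin ?invr_ge0 ?ltW.
- by apply: measurableT_comp.
Qed.

Lemma weight_integrable : mu.-integrable setT (EFin \o weight).
Proof.
apply/integrableP; split; first by apply: measurableT_comp => //; exact: weight_measurable.
under eq_integral do rewrite /= ger0_norm ?weight_ge0//.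
rewrite ge0_symfun_integralT.
- rewrite -set_itvcy [X in (_ * X)%E](integral0y_oneDsqr R) -EFinM ltry//.
- exact: weight_ge0.
- exact: continuous_oneDsqrV.
- by move=> x; rewrite /weight /oneDsqr /= sqrrN.
Qed.

End Affine.

Section Norm.
Variable R : realType.
Implicit Types (x y z : CC R).

Local Notation nc := (@normc R).

Lemma nc_ge0 x : 0 <= nc x.
Proof. by case: x => a b /=; exact: sqrtr_ge0. Qed.

Lemma ncN x : nc (- x) = nc x.
Proof. by case: x => a b /=; rewrite !sqrrN. Qed.

Lemma ncD x y : nc (x + y) <= nc x + nc y.
Proof. exact: le_normcD. Qed.

Lemma ncB x y : nc (x - y) <= nc x + nc y.
Proof. by rewrite (le_trans (ncD _ _))// ncN. Qed.

Lemma nc_real (a : R) : nc (a%:C) = `|a|.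
Proof. by rewrite /= expr0n addr0 sqrtr_sqr. Qed.

Lemma nc_i : nc 'i = 1.
Proof. by rewrite /= expr0n add0r expr1n sqrtr1. Qed.

Lemma ncX x n : nc (x ^+ n) = nc x ^+ n.
Proof.
by elim: n => [|n IH]; rewrite ?expr0 ?normc1// !exprS normcM IH.
Qed.

Lemma nc_prod (I : Type) (r : seq I) (P : pred I) (F : I -> CC R) :
  nc (\prod_(i <- r | P i) F i) = \prod_(i <- r | P i) nc (F i).
Proof.
by apply: (big_morph (@normc R) (@normcM R)); exact: normc1.
Qed.

Lemma nc_sum (I : Type) (r : seq I) (P : pred I) (F : I -> CC R) :
  nc (\sum_(i <- r | P i) F i) <= \sum_(i <- r | P i) nc (F i).
Proof.
elim/big_ind2 : _ => //; first by rewrite normc0.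
by move=> a b c d ab cd; rewrite (le_trans (ncD _ _))// lerD.
Qed.

Lemma normE x : `|x| = (nc x)%:C.
Proof. by []. Qed.

Lemma Re_le_nc x : `|complex.Re x| <= nc x.
Proof.
case: x => a b /=; rewrite -[leLHS]sqrtr_sqr ler_wsqrtr// lerDl sqr_ge0//.
Qed.

Lemma Im_le_nc x : `|complex.Im x| <= nc x.
Proof.
case: x => a b /=; rewrite -[leLHS]sqrtr_sqr ler_wsqrtr// lerDr sqr_ge0//.
Qed.

Lemma nc_le x : nc x <= `|complex.Re x| + `|complex.Im x|.
Proof.
rewrite [in nc x](complexE x) (le_trans (ncD _ _))// lerD// ?nc_real//.
by rewrite normcM nc_i mul1r nc_real.
Qed.

Lemma nc_eps_eq0 x : (forall e, 0 < e -> nc x <= e) -> x = 0.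
Proof.
move=> h; apply: eq0_normc; apply/eqP; rewrite eq_le nc_ge0 andbT.
by apply/ler_addgt0Pr => e e0; rewrite add0r; exact: h.
Qed.

End Norm.
(** The real-valued modulus; the norm of R[i] takes its values in R[i]. *)
Notation nc := (@normc _).

Section CIntegral.
Variable R : realType.
Local Notation mu := (@lebesgue_measure R).

Definition cintegrable (f : R -> CC R) :=
  mu.-integrable setT (EFin \o (fun x => complex.Re (f x))) /\
  mu.-integrable setT (EFin \o (fun x => complex.Im (f x))).

Let ReM a b : (fun z : CC R => complex.Re ((a +i* b) * z)) =
  (fun z => a * complex.Re z - b * complex.Im z).
Proof. by apply/funext => -[]. Qed.

Let ImM a b : (fun z : CC R => complex.Im ((a +i* b) * z)) =
  (fun z => a * complex.Im z + b * complex.Re z).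
Proof. by apply/funext => -[]. Qed.

Lemma cintegrableD f g : cintegrable f -> cintegrable g ->
  cintegrable (fun x => f x + g x).
Proof.
move=> [fr fi] [gr gi]; split.
- under eq_fun do rewrite raddfD; exact: (integrableD measurableT fr gr).
- under eq_fun do rewrite raddfD; exact: (integrableD measurableT fi gi).
Qed.

Lemma cintegrableZ c f : cintegrable f -> cintegrable (fun x => c * f x).
Proof.
case: c => a b [fr fi]; split.
- under eq_fun => x do rewrite [complex.Re _](congr1 (@^~ (f x)) (ReM a b)).
  exact: (integrableB measurableT
    (integrableZl measurableT a fr) (integrableZl measurableT b fi)).
- under eq_fun => x do rewrite [complex.Im _](congr1 (@^~ (f x)) (ImM a b)).
  exact: (integrableD measurableT
    (integrableZl measurableT a fi) (integrableZl measurableT b fr)).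
Qed.

Lemma cintegralD f g : cintegrable f -> cintegrable g ->
  cintegral (fun x => f x + g x) = cintegral f + cintegral g.
Proof.
move=> [fr fi] [gr gi]; rewrite /cintegral /=.
under [X in X +i* _]eq_Rintegral do rewrite raddfD/=.
under [X in _ +i* X]eq_Rintegral do rewrite raddfD/=.
by rewrite !RintegralD.
Qed.

Lemma cintegralZ c f : cintegrable f ->
  cintegral (fun x => c * f x) = c * cintegral f.
Proof.
case: c => a b [fr fi]; rewrite /cintegral.
rewrite (_ : (fun x => complex.Re ((a +i* b) * f x)) =
  (fun x => a * complex.Re (f x) - b * complex.Im (f x))); last first.
  by apply/funext => x; case: (f x).
rewrite (_ : (fun x => complex.Im ((a +i* b) * f x)) =
  (fun x => a * complex.Im (f x) + b * complex.Re (f x))); last first.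
  by apply/funext => x; case: (f x).
rewrite RintegralB//; [|exact: (integrableZl measurableT a fr)|exact: (integrableZl measurableT b fi)].
rewrite RintegralD//; [|exact: (integrableZl measurableT a fi)|exact: (integrableZl measurableT b fr)].
by rewrite !RintegralZl.
Qed.

Lemma cintegrable_affine (c d : R) f : 0 < c -> cintegrable f ->
  cintegrable (fun x => f (c * x + d)).
Proof. by move=> c0 [fr fi]; split; [exact: (integrable_affine d c0 fr)|exact: (integrable_affine d c0 fi)]. Qed.

Lemma cintegral_affine (c d : R) f : 0 < c -> cintegrable f ->
  cintegral (fun x => f (c * x + d)) = (c^-1)%:C * cintegral f.
Proof.
move=> c0 [fr fi]; rewrite /cintegral.
rewrite (Rintegral_affine d c0 fr) (Rintegral_affine d c0 fi).
by apply/eqP; rewrite eq_complex /= !mul0r subr0 addr0 !eqxx.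
Qed.

(** The factor 2 accounts for the separate estimates of the real part and of the
    imaginary part in [cintegral_le]. *)
Definition mass : R := 2 * \int[mu]_x weight x.

Lemma mass_ge0 : 0 <= mass.
Proof.
by rewrite mulr_ge0// Rintegral_ge0// => x _; exact: weight_ge0.
Qed.

Lemma Rintegral_le_weight (C : R) (f : R -> R) :
  mu.-integrable setT (EFin \o f) -> (forall x, `|f x| <= C * weight x) ->
  `|\int[mu]_x f x| <= C * \int[mu]_x weight x.
Proof.
move=> fi fC; rewrite (le_trans (le_normr_Rintegral _ _))//.
rewrite -RintegralZl//; last exact: weight_integrable.
apply: le_Rintegral => //.
  exact: (integrable_abse fi).
exact: (integrableZl measurableT C (weight_integrable R)).
Qed.

Lemma cintegral_le (C : R) f : cintegrable f ->
  (forall x, nc (f x) <= C * weight x) -> nc (cintegral f) <= C * mass.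
Proof.
move=> [fr fi] fC; rewrite (le_trans (nc_le _))//= /mass mulrCA mulr_natl mulr2n.
by apply: lerD; apply: Rintegral_le_weight => // x;
  apply: le_trans (fC x); rewrite (Re_le_nc, Im_le_nc).
Qed.

Lemma continuous_lipschitz (f : R -> R) :
  (forall x, exists C d, 0 < d /\
     forall h, `|h| <= d -> `|f (x + h) - f x| <= C * `|h|) ->
  continuous f.
Proof.
move=> H x; have [C [d [d0 fC]]] := H x.
apply/cvgrPdist_le => e e0; near=> y.
have C1 : 0 < `|C| + 1 by rewrite ltr_wpDl.
have hy : `|y - x| <= Num.min d (e / (`|C| + 1)).
  near: y; apply: cvgr_distC_le; first exact: cvg_id.
  by rewrite lt_min d0 divr_gt0.
move: hy; rewrite le_min => /andP[hd he].
rewrite distrC -[X in f X - _](subrK x) addrC (addrC _ x) [_ + f _]addrC.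
rewrite (le_trans (fC _ hd))// (le_trans (ler_wpM2r _ (ler_norm C)))//.
rewrite (@le_trans _ _ ((`|C| + 1) * `|y - x|))//.
  by rewrite ler_wpM2r// lerDl.
by rewrite mulrC -ler_pdivlMr.
Unshelve. all: by end_near. Qed.

Lemma continuous_EFin_measurable (f : R -> R) : continuous f ->
  measurable_fun [set: measurableTypeR R] (EFin \o f).
Proof.
by move=> cf; apply: measurableT_comp => //; exact: continuous_measurable_fun.
Qed.

(** Local Lipschitz continuity gives measurability, and the majorant gives
    integrability. The constants may depend on the point. *)
Lemma cintegrable_lipschitz (C : R) f :
  (forall x, nc (f x) <= C * weight x) ->
  (forall x, exists C d, 0 < d /\
     forall h, `|h| <= d -> nc (f (x + h) - f x) <= C * `|h|) ->
  cintegrable f.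
Proof.
have intw : mu.-integrable setT (EFin \o (fun x => C * weight x)).
  exact: (integrableZl measurableT C (weight_integrable R)).
move=> fC fL; split.
  apply: (le_integrable measurableT _ _ intw).
    apply: continuous_EFin_measurable.
    apply: continuous_lipschitz => x; have [D [d [d0 H]]] := fL x.
    exists D, d; split => // h /H.
    by apply: le_trans; have := Re_le_nc (f (x + h) - f x); rewrite raddfB; exact.
  move=> x _ /=; rewrite lee_fin (le_trans (Re_le_nc _))//.
  by rewrite (le_trans (fC x))// ler_norm.
apply: (le_integrable measurableT _ _ intw).
  apply: continuous_EFin_measurable.
  apply: continuous_lipschitz => x; have [D [d [d0 H]]] := fL x.
  exists D, d; split => // h /H.
  by apply: le_trans; have := Im_le_nc (f (x + h) - f x); rewrite raddfB; exact.
move=> x _ /=; rewrite lee_fin (le_trans (Im_le_nc _))//.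
by rewrite (le_trans (fC x))// ler_norm.
Qed.

End CIntegral.

Section MIntegral.
Variable R : realType.

Definition consv m (x : R) (v : 'rV[R]_m) : 'rV[R]_m.+1 := row_mx (x%:M : 'rV_1) v.

Lemma consv0 m x (v : 'rV[R]_m) : consv x v 0 ord0 = x.
Proof.
rewrite (_ : ord0 = lshift m (ord0 : 'I_1)); last exact/val_inj.
by rewrite (row_mxEl (x%:M : 'rV_1) v) mxE eqxx.
Qed.

Lemma consvS m x (v : 'rV[R]_m) k : consv x v 0 (lift ord0 k) = v 0 k.
Proof.
rewrite (_ : lift ord0 k = rshift 1 k); last exact/val_inj.
by rewrite (row_mxEr (x%:M : 'rV_1) v).
Qed.

Let affineE m (c : R) (u d : 'rV[R]_m) k : (c *: u + d) 0 k = c * u 0 k + d 0 k.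
Proof. by rewrite !mxE. Qed.

Let deltaE m (u : 'rV[R]_m) h k j :
  (u + h *: delta_mx 0 k) 0 j = u 0 j + h * (j == k)%:R.
Proof. by rewrite !mxE. Qed.

Lemma consv_affine m (c : R) (d : 'rV[R]_m.+1) x (v : 'rV[R]_m) :
  c *: consv x v + d =
  consv (c * x + d 0 ord0) (c *: v + \row_k d 0 (lift ord0 k)).
Proof.
apply/rowP => k; rewrite affineE.
case: (unliftP ord0 k) => [j|] ->; rewrite ?consvS ?consv0 //.
by rewrite affineE !mxE.
Qed.

Lemma prod_consv m (g : R -> R) x (v : 'rV[R]_m) :
  \prod_k g (consv x v 0 k) = g x * \prod_k g (v 0 k).
Proof.
rewrite big_ord_recl consv0; congr (_ * _).
by apply: eq_bigr => k _; rewrite consvS.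
Qed.

Lemma mintegralS m (f : 'rV[R]_m.+1 -> CC R) :
  mintegral f = cintegral (fun x => mintegral (fun v => f (consv x v))).
Proof. by []. Qed.

(** Integrability of all inner integrals at every point, rather than almost
    everywhere: then linearity and changes of variables pass through the iterated
    integral without any appeal to Fubini's theorem. *)
Fixpoint mintegrable m : ('rV[R]_m -> CC R) -> Prop :=
  match m with
  | 0 => fun=> True
  | m'.+1 => fun f =>
      (forall x, mintegrable (fun v : 'rV[R]_m' => f (consv x v))) /\
      cintegrable (fun x => mintegral (fun v => f (consv x v)))
  end.

(** Integrability and value are proved together here and below, because the
    value of an inner integral is needed to integrate it further. *)
Lemma mintegralD m (f g : 'rV[R]_m -> CC R) :
  mintegrable f -> mintegrable g ->
  mintegrable (fun x => f x + g x) /\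
  mintegral (fun x => f x + g x) = mintegral f + mintegral g.
Proof.
elim: m f g => [//|m IH] f g [fv fi] [gv gi].
have E : (fun x => mintegral (fun v => f (consv x v) + g (consv x v))) =
  (fun x => mintegral (fun v => f (consv x v)) +
            mintegral (fun v => g (consv x v))).
  by apply/funext => x; exact: (IH _ _ (fv x) (gv x)).2.
split; last by rewrite !mintegralS E cintegralD.
split; first by move=> x; exact: (IH _ _ (fv x) (gv x)).1.
by rewrite E; exact: cintegrableD.
Qed.

Lemma mintegralZ m (c : CC R) (f : 'rV[R]_m -> CC R) :
  mintegrable f ->
  mintegrable (fun x => c * f x) /\
  mintegral (fun x => c * f x) = c * mintegral f.
Proof.
elim: m f => [//|m IH] f [fv fi].
have E : (fun x => mintegral (fun v => c * f (consv x v))) =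
  (fun x => c * mintegral (fun v => f (consv x v))).
  by apply/funext => x; exact: (IH _ (fv x)).2.
split; last by rewrite !mintegralS E cintegralZ.
split; first by move=> x; exact: (IH _ (fv x)).1.
by rewrite E; exact: cintegrableZ.
Qed.

Lemma mintegralB m (f g : 'rV[R]_m -> CC R) :
  mintegrable f -> mintegrable g ->
  mintegrable (fun x => f x - g x) /\
  mintegral (fun x => f x - g x) = mintegral f - mintegral g.
Proof.
move=> fi gi; have [hi h] := mintegralZ (-1) gi.
have := mintegralD fi hi; rewrite h mulN1r.
by under eq_fun do rewrite mulN1r.
Qed.

Lemma mintegral0 m : mintegrable (fun _ : 'rV[R]_m => 0) /\
  mintegral (fun _ : 'rV[R]_m => 0 : CC R) = 0.
Proof.
elim: m => [//|m [IHi IH]].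
have E : cintegrable (fun _ : R => 0 : CC R).
  by split; exact: integrable0.
split; first by split=> //; rewrite IH.
by rewrite mintegralS IH -{1}(mulr0 0) cintegralZ// mul0r.
Qed.

Lemma mintegral_sum m (I : Type) (r : seq I) (P : pred I)
    (F : I -> 'rV[R]_m -> CC R) :
  (forall i, P i -> mintegrable (F i)) ->
  mintegrable (fun x => \sum_(i <- r | P i) F i x) /\
  mintegral (fun x => \sum_(i <- r | P i) F i x) =
  \sum_(i <- r | P i) mintegral (F i).
Proof.
move=> H; elim: r => [|i r [IHi IH]].
  by under eq_fun do rewrite big_nil; rewrite big_nil; exact: mintegral0.
rewrite big_cons; under eq_fun do rewrite big_cons.
case: ifPn => // Pi; rewrite -IH; exact: mintegralD (H _ Pi) IHi.
Qed.

Lemma mintegral_affine m (c : R) (d : 'rV[R]_m) (f : 'rV[R]_m -> CC R) :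
  0 < c -> mintegrable f ->
  mintegrable (fun x => f (c *: x + d)) /\
  mintegral (fun x => f (c *: x + d)) = (c^-1)%:C ^+ m * mintegral f.
Proof.
move=> c0; elim: m d f => [|m IH] d f.
  by move=> _; split => //=; rewrite expr0 mul1r; congr f; apply/rowP => -[].
move=> [fv fi].
have E : (fun x => mintegral (fun v => f (c *: consv x v + d))) =
  (fun x => (c^-1)%:C ^+ m *
     mintegral (fun v => f (consv (c * x + d 0 ord0) v))).
  apply/funext => x; under eq_fun do rewrite consv_affine.
  exact: (IH _ _ (fv _)).2.
have Fi := cintegrable_affine (d 0 ord0) c0 fi.
split; last first.
  rewrite !mintegralS E cintegralZ// exprSr -mulrA; congr (_ * _).
  exact: (cintegral_affine (d 0 ord0) c0 fi).
split; last by rewrite E; exact: cintegrableZ.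
move=> x; under eq_fun do rewrite consv_affine.
exact: (IH _ _ (fv _)).1.
Qed.

Definition dominated m (C : R) (f : 'rV[R]_m -> CC R) :=
  forall x, nc (f x) <= C * \prod_k weight (x 0 k).

Lemma mintegral_le m (C : R) (f : 'rV[R]_m -> CC R) :
  mintegrable f -> dominated C f -> nc (mintegral f) <= C * mass R ^+ m.
Proof.
elim: m C f => [|m IH] C f; first by move=> _ /(_ 0); rewrite big_ord0 expr0.
move=> [fv fi] fC; rewrite exprSr mulrA mintegralS cintegral_le// => x.
rewrite mulrAC; apply: (IH _ _ (fv x)) => v.
by rewrite -mulrA -prod_consv; exact: fC.
Qed.

(** The product of weights on the right keeps the bound integrable in the other
    coordinates, so that the inner integrals are again Lipschitz. *)
Definition lipschitz_coord m (C d : 'I_m -> R) (f : 'rV[R]_m -> CC R) :=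
  forall x k h, `|h| <= d k ->
  nc (f (x + h *: delta_mx 0 k) - f x) <=
  C k * `|h| * \prod_j weight (x 0 j).

Lemma mintegrable_lipschitz m (B : R) (C d : 'I_m -> R) (f : 'rV[R]_m -> CC R) :
  (forall k, 0 < d k) -> dominated B f -> lipschitz_coord C d f ->
  mintegrable f.
Proof.
elim: m B C d f => [//|m IH] B C d f d0 fB fL.
have fv x : mintegrable (fun v => f (consv x v)).
  apply: (IH (B * weight x) (fun k => C (lift ord0 k) * weight x)
             (fun k => d (lift ord0 k))) => //.
    by move=> v; rewrite -mulrA -prod_consv; exact: fB.
  move=> v k h hd; rewrite [_ * `|h|]mulrAC -[_ * weight x * _]mulrA -prod_consv.
  rewrite (_ : consv x (v + _) = consv x v + h *: delta_mx 0 (lift ord0 k)).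
    exact: fL.
  apply/rowP => j; rewrite deltaE.
  case: (unliftP ord0 j) => [i|] ->; rewrite ?consvS ?consv0 ?deltaE.
    by rewrite (inj_eq lift_inj).
  by rewrite mulr0 addr0.
split=> //; apply: (@cintegrable_lipschitz _ (B * mass R ^+ m)).
  move=> x; rewrite mulrAC; apply: (mintegral_le (fv x)) => v.
  by rewrite -mulrA -prod_consv; exact: fB.
move=> x; exists (C ord0 * weight x * mass R ^+ m), (d ord0); split => // h hd.
have [Bi <-] := mintegralB (fv (x + h)) (fv x).
rewrite mulrAC; apply: (mintegral_le Bi) => v.
rewrite [_ * `|h|]mulrAC -[_ * weight x * _]mulrA -prod_consv.
rewrite (_ : consv (x + h) v = consv x v + h *: delta_mx 0 ord0).
  exact: fL.
apply/rowP => j; rewrite deltaE.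
case: (unliftP ord0 j) => [i|] ->; rewrite ?consvS ?consv0 //=.
  by rewrite mulr0 addr0.
by rewrite mulr1.
Qed.

End MIntegral.

(** * Bounds for the exponential and for sh *)

Section Trig.
Variable R : realType.
Implicit Types x y : R.

Lemma MVT0 (f df : R -> R) y : (forall x, is_derive x 1 f (df x)) ->
  exists2 c : R, `|c| <= `|y| & f y - f 0 = df c * y.
Proof.
move=> fd.
have cf a b : {within `[a, b], continuous f}.
  apply: continuous_subspaceT => x; apply: differentiable_continuous.
  by apply/derivable1_diffP; exact: ex_derive.
have [y0|y0|->] := ltgtP y 0; last by exists 0; rewrite ?normr0 // subrr mulr0.
- have [c + H] := MVT y0 (fun x _ => fd x) (cf _ _).
  rewrite in_itv/= => /andP[yc c0]; exists c.
    by rewrite !ltr0_norm// lerN2 ltW.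
  by rewrite -opprB H sub0r mulrN opprK.
- have [c + H] := MVT y0 (fun x _ => fd x) (cf _ _).
  rewrite in_itv/= => /andP[yc c0]; exists c.
    by rewrite !gtr0_norm// ltW.
  by rewrite H subr0.
Qed.

Lemma normr_sin_le y : `|sin y| <= `|y|.
Proof.
have [c _] := MVT0 y (@is_derive_sin R).
by rewrite sin0 subr0 => ->; rewrite normrM ler_piMl// cos_max.
Qed.

Lemma normr_cosB1_le y : `|cos y - 1| <= y ^+ 2 / 2.
Proof.
have -> : cos y - 1 = - (sin (y / 2)) ^+ 2 * 2.
  have e : y / 2 *+ 2 = y by rewrite -mulr_natr divfK.
  rewrite -{1}e cos_mulr2n; have := cos2Dsin2 (y / 2).
  set s := sin _; set c := cos _ => h; rewrite -mulr_natr; lra.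
rewrite normrM normrN normr_nat normrX.
have h := normr_sin_le (y / 2).
have : `|sin (y / 2)| ^+ 2 <= (y / 2) ^+ 2.
  by rewrite -[leRHS]real_normK ?num_real// ler_sqr.
rewrite expr_div_n; lra.
Qed.

Lemma normr_sinB_le y : `|sin y - y| <= y ^+ 2.
Proof.
have fd x : is_derive x 1 (fun z : R => sin z - z) (cos x - 1) by exact: is_deriveB.
have [c cy] := MVT0 y fd.
rewrite sin0 !subr0 => ->; rewrite normrM -real_normK ?num_real// expr2.
apply: ler_wpM2r => //; apply: le_trans cy.
have [c2|c2] := leP `|c| 2.
  rewrite (le_trans (normr_cosB1_le c))//.
  rewrite -real_normK ?num_real// expr2; have := normr_ge0 c; nra.
rewrite (le_trans _ (ltW c2))// ler0_norm ?subr_le0 ?cos_le1//.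
by have := cos_geN1 c; lra.
Qed.

Lemma expR_le_inv x : x < 1 -> expR x <= (1 - x)^-1.
Proof.
move=> x1; rewrite -[x]opprK expRN opprK lef_pV2 ?posrE ?expR_gt0 ?subr_gt0//.
exact: expR_ge1Dx.
Qed.

Lemma expRB1D_le x : `|x| <= 2^-1 -> `|expR x - 1 - x| <= 2 * x ^+ 2.
Proof.
rewrite ler_norml => /andP[x1 x2]; have := expR_ge1Dx x; move=> h.
have : expR x <= (1 - x)^-1 by apply: expR_le_inv; lra.
rewrite -div1r ler_pdivlMr; last lra.
move=> h2; rewrite ger0_norm; last lra.
nra.
Qed.

Lemma expRB1_le x : `|x| <= 2^-1 -> `|expR x - 1| <= 2 * `|x|.
Proof.
move=> h; have := expRB1D_le h; rewrite -(real_normK (num_real x)) => h2.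
rewrite (_ : expR x - 1 = (expR x - 1 - x) + x); last by ring.
apply: le_trans (ler_normD _ _) _.
move: h h2 (normr_ge0 x); move: `|x| `|_ - x| => a b; nra.
Qed.

(** In contrast to [expRB1_le] this holds for all x; the factor 1 + expR x is
    absorbed when the inequality is multiplied by an exponential. *)
Lemma normr_expRB1_le x : `|expR x - 1| <= `|x| * (1 + expR x).
Proof.
have e0 := expR_gt0 x; have h := expR_ge1Dx x.
have h2 := expR_ge1Dx (- x); rewrite expRN in h2.
have h3 : (1 - x) * expR x <= 1.
  by rewrite -ler_pdivlMr// div1r.
have h4 : (1 + x) * 1 <= expR x by rewrite mulr1.
have [x0|x0] := leP 0 x.
  rewrite (ger0_norm x0) ger0_norm; last by lra.
  nra.
rewrite (ltr0_norm x0) ler0_norm; first by nra.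
by rewrite subr_le0 -expR0 ler_expR ltW.
Qed.

Lemma sin_lower (t y : R) : 0 < t -> t <= y <= pi - t -> sin t <= sin y.
Proof.
move=> t0 /andP[ty ypi]; have pi0 := pi_gt0 R.
have tpi : t <= pi / 2 by lra.
rewrite -(cosBpihalf t) -(cosBpihalf y) -(cosN (t - pi / 2)) -(cos_norm (y - pi / 2)).
have [yp|yp] := leP (pi / 2) y.
  by rewrite ger0_norm ?subr_ge0// leNgt ltr_cos ?in_itv/= -?leNgt; lra.
by rewrite ltr0_norm ?subr_lt0// leNgt ltr_cos ?in_itv/= -?leNgt; lra.
Qed.

End Trig.

Section CExp.
Variable R : realType.
Implicit Types z w v : CC R.

Lemma cexpD z w : cexp (z + w) = cexp z * cexp w.
Proof.
case: z w => a b [c d]; rewrite /cexp /= expRD cosD sinD.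
by apply/eqP; rewrite eq_complex /=; apply/andP; split; apply/eqP; ring.
Qed.

Lemma cexp0 : cexp (0 : CC R) = 1.
Proof. by rewrite /cexp /= expR0 cos0 sin0 mulr1 mulr0. Qed.

Lemma nc_cexp z : nc (cexp z) = expR (complex.Re z).
Proof.
case: z => a b /=; rewrite !exprMn -mulrDr cos2Dsin2 mulr1 sqrtr_sqr.
by rewrite ger0_norm// expR_ge0.
Qed.

Lemma cexp_sum (I : Type) (r : seq I) (P : pred I) (F : I -> CC R) :
  cexp (\sum_(i <- r | P i) F i) = \prod_(i <- r | P i) cexp (F i).
Proof. by apply: (big_morph (@cexp R) cexpD cexp0). Qed.

Lemma sqr_nc z : nc z ^+ 2 = complex.Re z ^+ 2 + complex.Im z ^+ 2.
Proof. by case: z => a b /=; rewrite sqr_sqrtr// addr_ge0// sqr_ge0. Qed.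

Lemma nc_cexpB1B v : `|complex.Re v| <= 2^-1 ->
  nc (cexp v - 1 - v) <= 6 * nc v ^+ 2.
Proof.
rewrite sqr_nc => xh; apply: le_trans (nc_le _) _.
case: v xh => x y /= xh.
have hx := expRB1_le xh; have hxx := expRB1D_le xh.
have hc := normr_cosB1_le y; have hs := normr_sin_le y.
have hsy := normr_sinB_le y.
have ex : 0 <= expR x <= 2.
  rewrite expR_ge0/=; move: (ler_norm (expR x - 1)); lra.
have -> : expR x * cos y - 1 - x = expR x * (cos y - 1) + (expR x - 1 - x) by ring.
have -> : expR x * sin y - 0 - y = (expR x - 1) * sin y + (sin y - y) by ring.
have h1 : `|expR x * (cos y - 1)| <= 2 * (y ^+ 2 / 2).
  rewrite normrM ger0_norm; last by case/andP: ex.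
  by apply: ler_pM => //; case/andP: ex.
have h2 : `|(expR x - 1) * sin y| <= 2 * `|x| * `|y|.
  by rewrite normrM; apply: ler_pM.
have h3 : 2 * (`|x| * `|y|) <= x ^+ 2 + y ^+ 2.
  rewrite -(real_normK (num_real x)) -(real_normK (num_real y)).
  by have := sqr_ge0 (`|x| - `|y|); nra.
have := ler_normD (expR x * (cos y - 1)) (expR x - 1 - x).
have := ler_normD ((expR x - 1) * sin y) (sin y - y).
have := sqr_ge0 x; have := sqr_ge0 y; lra.
Qed.

Lemma nc_cexpB1 v :
  nc (cexp v - 1) <= 3 * nc v * (1 + expR (complex.Re v)).
Proof.
have hx := Re_le_nc v; have hy := Im_le_nc v.
apply: le_trans (nc_le _) _; move: hx hy; move: (nc v) => N.
case: v => x y /= hx hy.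
have e0 := expR_gt0 x.
have -> : expR x * cos y - 1 = expR x * (cos y - 1) + (expR x - 1) by ring.
have hc : `|cos y - 1| <= `|y|.
  have [c _] := MVT0 y (@is_derive_cos R).
  rewrite cos0 => ->; rewrite normrM normrN ler_piMl//; exact: sin_max.
have h1 : `|expR x * (cos y - 1)| <= expR x * `|y|.
  by rewrite normrM (gtr0_norm e0) ler_pM2l.
have h2 : `|expR x * sin y - 0| <= expR x * `|y|.
  by rewrite subr0 normrM (gtr0_norm e0) ler_pM2l// normr_sin_le.
have h3 := normr_expRB1_le x.
have h4 := ler_normD (expR x * (cos y - 1)) (expR x - 1).
have h5 : `|x| * (1 + expR x) <= N * (1 + expR x) by rewrite ler_wpM2r//; lra.
have h6 : expR x * `|y| <= expR x * N by rewrite ler_pM2l.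
have h7 : 0 <= N by exact: le_trans (normr_ge0 _) hx.
nra.
Qed.

(** An upper bound by values of the function itself: multiplied by a decaying
    factor, the right-hand side is controlled by the bounds for the two terms. *)
Lemma nc_cexpB z w :
  nc (cexp z - cexp w) <= 3 * nc (z - w) * (nc (cexp z) + nc (cexp w)).
Proof.
have -> : cexp z - cexp w = cexp w * (cexp (z - w) - 1).
  by rewrite mulrBr mulr1 -cexpD (addrC w) subrK.
rewrite normcM; apply: le_trans (ler_wpM2l (nc_ge0 _) (nc_cexpB1 _)) _.
rewrite mulrCA ler_wpM2l// ?mulr_ge0 ?nc_ge0//.
by rewrite !nc_cexp mulrDr mulr1 -expRD raddfB (addrC (complex.Re w)) subrK addrC.
Qed.

Lemma nc_shE z : nc (cexp z) - nc (cexp (- z)) <= nc (sh z).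
Proof.
rewrite lerBlDr; apply: le_trans (ncD _ _).
by rewrite subrK.
Qed.

(** Away from the imaginary axis one of the two exponentials in sh dominates the
    other by a constant factor. *)
Lemma sh_lower_Re (t : R) : 0 < t -> exists2 C, 0 < C & forall z,
  t <= `|complex.Re z| -> expR `|complex.Re z| <= C * nc (sh z).
Proof.
move=> t0; have h : 0 < 1 - expR (- (2 * t)).
  by rewrite subr_gt0 -expR0 ltr_expR oppr_lt0 mulr_gt0.
exists (1 - expR (- (2 * t)))^-1; first by rewrite invr_gt0.
move=> z tz; rewrite mulrC ler_pdivlMr// mulrBr mulr1 -expRD.
have H (w : CC R) : 0 <= complex.Re w -> t <= complex.Re w ->
    expR (complex.Re w) - expR (complex.Re w + - (2 * t)) <= nc (sh w).
  move=> w0 tw; apply: le_trans (nc_shE w); rewrite !nc_cexp lerB//.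
  by rewrite ler_expR raddfN /=; lra.
have [z0|z0] := leP 0 (complex.Re z).
  by rewrite ger0_norm//; apply: H => //; rewrite -(ger0_norm z0).
have E : complex.Re (- z) = - complex.Re z by rewrite raddfN.
rewrite ltr0_norm// -E (_ : sh z = - sh (- z)); last by rewrite /sh opprB opprK.
by rewrite ncN; apply: H; rewrite E ?oppr_ge0 -?(ltr0_norm z0)// ltW.
Qed.

(** Between the horizontal lines through the zeros 0 and i pi the two
    exponentials have distinct arguments and cannot cancel: the imaginary part of
    sh z is sin (Im z) (e^(Re z) + e^(- Re z)). *)
Lemma sh_lower_Im (t : R) : 0 < t -> t <= pi / 2 -> exists2 C, 0 < C &
  forall z, t <= `|complex.Im z| <= pi - t -> expR `|complex.Re z| <= C * nc (sh z).
Proof.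
move=> t0 tp; have s0 : 0 < sin t by apply: sin_gt0_pi; have := pi_gt0 R; lra.
exists (sin t)^-1; first by rewrite invr_gt0.
move=> z /(sin_lower t0) hs; rewrite mulrC ler_pdivlMr//.
apply: le_trans (Im_le_nc _).
have -> : complex.Im (sh z) =
    (expR (complex.Re z) + expR (- complex.Re z)) * sin (complex.Im z).
  by case: z {hs} => x y /=; rewrite sinN mulrN opprK mulrDl.
move: hs; move: (complex.Re z) (complex.Im z) => x y hs; rewrite normrM.
have e1 := expR_gt0 x; have e2 := expR_gt0 (- x).
apply: ler_pM => //; rewrite ?expR_ge0 ?(ltW s0)//.
  rewrite gtr0_norm ?addr_gt0//.
  by have [x0|x0] := leP 0 x; [rewrite ger0_norm//|rewrite ltr0_norm//]; lra.
apply: le_trans hs _; have [y0|y0] := leP 0 y.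
  by rewrite (ger0_norm y0) ler_norm.
by rewrite (ltr0_norm y0) sinN -normrN ler_norm.
Qed.

End CExp.

(** * Bound for 1/sh on horizontal lines, and relative differentiability *)

Section ShContour.
Variable R : realType.

(** The zeros of sh (pi h p) lie on the line i R / h through 0. If h is purely
    imaginary this line is the real axis, and Re (pi h p) stays away from 0 when
    Im p does. Otherwise, where |Re (pi h p)| is small, Im (pi h p) is close to
    pi |h|^2 Im p / Re h, so that for small Im p > 0 its absolute value stays away
    from 0 and pi. *)
Lemma sh_contour (h : CC R) : h != 0 -> exists2 e0 : R, 0 < e0 &
  forall e1, 0 < e1 -> exists2 C, 0 < C & forall p : CC R,
    e1 <= complex.Im p <= e0 ->
    expR `|complex.Re (pi%:C * h * p)| <= C * nc (sh (pi%:C * h * p)).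
Proof.
have pi0 := pi_gt0 R; pose a := complex.Re h; pose b := complex.Im h => h0.
have ReE (p : CC R) : complex.Re (pi%:C * h * p) =
    pi * (a * complex.Re p - b * complex.Im p).
  by rewrite /a /b; case: (h) (p) => ? ? [? ?] /=; ring.
have ImE (p : CC R) : complex.Im (pi%:C * h * p) =
    pi * (a * complex.Im p + b * complex.Re p).
  by rewrite /a /b; case: (h) (p) => ? ? [? ?] /=; ring.
have hE : h = a +i* b by rewrite /a /b; case: (h).
rewrite hE in h0.
have [a0|a0] := eqVneq a 0.
  have b0 : 0 < `|b|.
    by rewrite normr_gt0; apply: contraNneq h0 => ->; rewrite a0.
  exists 1 => // e1 e10.
  have t0 : 0 < pi * `|b| * e1 by rewrite !mulr_gt0.
  have [C C0 H] := sh_lower_Re t0; exists C => // p /andP[e1e _].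
  apply: H; rewrite ReE a0 mul0r sub0r normrM normrN normrM (gtr0_norm pi0).
  by rewrite mulrA ler_pM2l ?mulr_gt0// (le_trans e1e)// ler_norm.
have na0 : 0 < `|a| by rewrite normr_gt0.
pose A := pi * (a ^+ 2 + b ^+ 2) / `|a|.
have s0 : 0 < a ^+ 2 + b ^+ 2 by rewrite ltr_wpDr ?sqr_ge0// exprn_even_gt0.
have A0 : 0 < A by rewrite divr_gt0// mulr_gt0.
exists (pi / 2 / A) => [|e1 e10]; first by apply: divr_gt0 => //; apply: divr_gt0.
have [e1l|e1l] := leP e1 (pi / 2 / A); last first.
  exists 1 => // p /andP[h1 h2]; have := le_trans h1 h2.
  by rewrite leNgt e1l.
have Ae1 : A * e1 <= pi / 2 by rewrite mulrC -ler_pdivlMr.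
pose k := `|b| / `|a|.
have k0 : 0 <= k by rewrite divr_ge0.
pose rho := A * e1 / 2 / (k + 1).
have k1 : 0 < k + 1 by lra.
have rho0 : 0 < rho by rewrite !divr_gt0// mulr_gt0.
have krho : k * rho <= A * e1 / 2.
  rewrite mulrA ler_pdivrMr// mulrC ler_wpM2l//; last by lra.
  by rewrite divr_ge0// mulr_ge0// ltW.
have t0 : 0 < A * e1 / 2 by rewrite divr_gt0// mulr_gt0.
have tp : A * e1 / 2 <= pi / 2 by lra.
have [C1 C10 H1] := sh_lower_Re rho0.
have [C2 C20 H2] := sh_lower_Im t0 tp.
exists (C1 + C2) => [|p pe]; first exact: addr_gt0.
set z := _ * p; have nz := nc_ge0 (sh z); rewrite mulrDl.
have [hr|hr] := leP rho `|complex.Re z|.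
  by have := H1 _ hr; have := mulr_ge0 (ltW C20) nz; lra.
(* Im z is b / a * Re z up to the quantity of absolute value A * Im p *)
suff /H2 : A * e1 / 2 <= `|complex.Im z| <= pi - A * e1 / 2.
  by have := mulr_ge0 (ltW C10) nz; lra.
move: pe; set e := complex.Im p => /andP[he1 he].
have E : `|complex.Im z - b / a * complex.Re z| = A * e.
  rewrite /z ImE ReE -/e; set u := complex.Re p.
  rewrite (_ : _ - _ = pi * (a ^+ 2 + b ^+ 2) / a * e); last by field.
  rewrite !normrM normfV (gtr0_norm pi0) (gtr0_norm s0) (@gtr0_norm _ e)//.
  exact: lt_le_trans he1.
have Ee : A * e1 <= A * e <= pi / 2.
  by rewrite ler_pM2l// he1/= mulrC -ler_pdivlMr.
have kr : `|b / a * complex.Re z| <= A * e1 / 2.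
  rewrite !normrM normfV; apply: le_trans krho; apply: ler_wpM2l => //.
  exact: ltW.
have := ler_normB (complex.Im z) (b / a * complex.Re z).
have := ler_normD (complex.Im z - b / a * complex.Re z) (b / a * complex.Re z).
rewrite subrK E; case/andP: Ee; lra.
Qed.

End ShContour.

Section Rel2.
Variables (R : realType) (T : Type) (s : CC R -> T -> T) (P : T -> Prop).
Implicit Types f g phi : T -> CC R.

(** Complex differentiability along the shifts s w, uniformly on P and relative to
    the value of f. In this form the estimate is stable under products and under
    inverses without bounds on f, and multiplied by a majorant of f it gives
    integrable error terms. *)
Definition rel2 f := exists C d : R, [/\ 0 <= C, 0 < d & forall t, P t ->
  exists2 A, nc A <= C & forall w, nc w <= d ->
    exists2 rho, f (s w t) = f t * rho & nc (rho - 1 - A * w) <= C * nc w ^+ 2].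

Lemma rel2_invariant f : (forall w t, f (s w t) = f t) -> rel2 f.
Proof.
move=> fs; exists 0, 1; split => // t _; exists 0; first by rewrite normc0.
by move=> w _; exists 1; rewrite ?mulr1// mul0r !subrr normc0 mul0r.
Qed.

Lemma rel2M f g : rel2 f -> rel2 g -> rel2 (fun t => f t * g t).
Proof.
move=> [C1 [d1 [C10 d10 H1]]] [C2 [d2 [C20 d20 H2]]].
exists (C1 * C2 + C1 * (1 + 2 * C2) + C2 * (1 + C1)), (Num.min 1 (Num.min d1 d2)).
split => [||t Pt]; first by rewrite !addr_ge0 ?mulr_ge0 ?addr_ge0// mulr_ge0.
  by rewrite !lt_min ltr01 d10.
have [A1 hA1 K1] := H1 t Pt; have [A2 hA2 K2] := H2 t Pt.
exists (A1 + A2).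
  apply: le_trans (ncD _ _) _; have := mulr_ge0 C10 C20; nra.
move=> w; rewrite !le_min => /and3P[w1 wd1 wd2].
have [r1 f1 k1] := K1 w wd1; have [r2 f2 k2] := K2 w wd2.
exists (r1 * r2); first by rewrite f1 f2 mulrACA.
move: k1 k2; set R1 := r1 - 1 - _; set R2 := r2 - 1 - _ => k1 k2.
have -> : r1 * r2 - 1 - (A1 + A2) * w =
    A1 * A2 * w ^+ 2 + (R1 * (1 + (A2 * w + R2)) + R2 * (1 + A1 * w)).
  by rewrite /R1 /R2; ring.
have n0 := nc_ge0 w.
have b2 : nc (A2 * w) <= C2 by rewrite normcM -[C2]mulr1; apply: ler_pM; rewrite ?nc_ge0.
have b1 : nc (A1 * w) <= C1 by rewrite normcM -[C1]mulr1; apply: ler_pM; rewrite ?nc_ge0.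
have w2 : nc w ^+ 2 <= 1 by rewrite expr_le1.
have c2 : nc R2 <= C2 by apply: le_trans k2 _; rewrite ler_piMr.
apply: le_trans (ncD _ _) _.
have -> : (C1 * C2 + C1 * (1 + 2 * C2) + C2 * (1 + C1)) * nc w ^+ 2 =
  C1 * C2 * nc w ^+ 2 + (C1 * nc w ^+ 2 * (1 + 2 * C2) +
  C2 * nc w ^+ 2 * (1 + C1)) by ring.
apply: lerD.
  rewrite normcM ncX (normcM A1) ler_wpM2r ?sqr_ge0//.
  by apply: ler_pM; rewrite ?nc_ge0.
apply: le_trans (ncD _ _) _; apply: lerD; rewrite normcM.
  apply: ler_pM; rewrite ?nc_ge0//.
  apply: le_trans (ncD _ _) _; rewrite normc1 lerD2l.
  by apply: le_trans (ncD _ _) _; lra.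
apply: ler_pM; rewrite ?nc_ge0//.
by apply: le_trans (ncD _ _) _; rewrite normc1 lerD2l.
Qed.

Lemma rel2V f : rel2 f -> rel2 (fun t => (f t)^-1).
Proof.
move=> [C [d [C0 d0 H]]].
have C1 : 0 < 4 * (C + 1) by lra.
exists (2 * (2 * C ^+ 2 + C)), (Num.min 1 (Num.min d (4 * (C + 1))^-1)).
split => [||t Pt]; first by have := sqr_ge0 C; nra.
  by rewrite !lt_min ltr01 d0 invr_gt0.
have [A hA K] := H t Pt; exists (- A).
  by rewrite ncN; have := sqr_ge0 C; nra.
move=> w; rewrite !le_min => /and3P[w1 wd wC].
have [r fr k] := K w wd; exists r^-1; first by rewrite fr invfM.
move: k; set Q := r - 1 - _ => k; have n0 := nc_ge0 w.
have w2 : nc w ^+ 2 <= nc w by rewrite expr2 ler_piMl.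
have Aw : nc (A * w) <= C * nc w by rewrite normcM ler_wpM2r.
have cw : C * nc w <= 4^-1.
  move: wC; rewrite -div1r ler_pdivlMr// => wC.
  by have := mulr_ge0 C0 n0; lra.
have Qw : nc Q <= C * nc w by apply: le_trans k _; rewrite ler_wpM2l.
have r2 : 2^-1 <= nc r.
  have : nc (1 : CC R) <= nc r + nc (- (A * w + Q)).
    apply: le_trans (ncD _ _); rewrite (_ : r - _ = 1)//.
    by rewrite /Q; ring.
  rewrite normc1 ncN; have := ncD (A * w) Q; lra.
have r0 : r != 0.
  by apply: contraTneq r2 => ->; rewrite normc0 -ltNge invr_gt0.
have -> : r^-1 - 1 - - A * w = (A ^+ 2 * w ^+ 2 + (A * w * Q - Q)) / r.
  by rewrite /Q; field.
rewrite normcM normcV.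
have -> : 2 * (2 * C ^+ 2 + C) * nc w ^+ 2 =
  (C ^+ 2 * nc w ^+ 2 + (C ^+ 2 * nc w ^+ 2 + C * nc w ^+ 2)) * 2 by ring.
apply: ler_pM; rewrite ?nc_ge0 ?invr_ge0 ?nc_ge0//; last first.
  by rewrite -[leRHS]invrK lef_pV2 ?posrE ?invr_gt0//; lra.
apply: le_trans (ncD _ _) _; apply: lerD.
  rewrite normcM (ncX A) (ncX w) ler_wpM2r ?sqr_ge0// ler_sqr ?nnegrE ?nc_ge0//.
apply: le_trans (ncB _ _) _; apply: lerD => //.
rewrite normcM expr2 -mulrA; apply: ler_pM; rewrite ?nc_ge0//.
apply: le_trans Aw _; rewrite ler_piMr//.
Qed.

Lemma rel2X f n : rel2 f -> rel2 (fun t => f t ^+ n).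
Proof.
move=> rf; elim: n => [|n IH]; first exact: rel2_invariant.
by under eq_fun do rewrite exprS; exact: rel2M.
Qed.

Lemma rel2Xz f (n : int) : rel2 f -> rel2 (fun t => f t ^ n).
Proof. by case: n => n rf; [exact: rel2X|exact: rel2V (rel2X _ rf)]. Qed.

Lemma rel2_prod (I : Type) (r : seq I) (F : I -> T -> CC R) :
  (forall i, rel2 (F i)) -> rel2 (fun t => \prod_(i <- r) F i t).
Proof.
move=> H; elim: r => [|i r IH].
  by under eq_fun do rewrite big_nil; exact: rel2_invariant.
by under eq_fun do rewrite big_cons; exact: rel2M.
Qed.

Variables (phi : T -> CC R) (k : CC R).
Hypothesis phis : forall w t, phi (s w t) = phi t + k * w.

Lemma rel2_linear (e : R) : 0 < e -> (forall t, P t -> e <= nc (phi t)) ->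
  rel2 phi.
Proof.
move=> e0 H; exists (nc k / e), 1; split => [||t Pt]; rewrite ?divr_ge0 ?nc_ge0 ?ltW//.
have p0 : 0 < nc (phi t) by exact: lt_le_trans (H t Pt).
have pn0 : phi t != 0 by apply: contraTneq p0 => ->; rewrite normc0 ltxx.
exists (k / phi t).
  by rewrite normcM normcV ler_wpM2l ?nc_ge0// lef_pV2 ?posrE//; exact: H.
move=> w _; exists (1 + k * w / phi t); first by rewrite phis; field.
rewrite (_ : _ - _ = 0); last by ring.
by rewrite normc0 mulr_ge0 ?sqr_ge0// divr_ge0 ?nc_ge0 ?ltW.
Qed.

Let bound := 6 * nc k ^+ 2.

Let rel2_exp_aux : forall w, nc w <= (2 * (nc k + 1))^-1 ->
  nc (cexp (k * w) - 1 - k * w) <= bound * nc w ^+ 2.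
Proof.
move=> w; have k0 := nc_ge0 k; rewrite -div1r ler_pdivlMr; last by lra.
move=> wk; rewrite -mulrA -exprMn -normcM; apply: nc_cexpB1B.
apply: le_trans (Re_le_nc _) _; rewrite normcM.
by have := nc_ge0 w; lra.
Qed.

Lemma rel2_cexp : rel2 (fun t => cexp (phi t)).
Proof.
have k0 := nc_ge0 k; have b0 : 0 <= bound by rewrite mulr_ge0 ?sqr_ge0.
exists (nc k + bound), (2 * (nc k + 1))^-1; split => [||t Pt].
- exact: addr_ge0.
- by rewrite invr_gt0; lra.
exists k; first by rewrite lerDl.
move=> w wd; exists (cexp (k * w)); first by rewrite phis cexpD.
apply: le_trans (rel2_exp_aux wd) _; rewrite ler_wpM2r ?sqr_ge0//.
by rewrite lerDr.
Qed.

(** The lower bound on sh converts the errors of the two exponentials into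
    relative errors of sh. *)
Lemma rel2_sh (C : R) : (forall t, P t ->
    expR `|complex.Re (phi t)| <= C * nc (sh (phi t))) ->
  rel2 (fun t => sh (phi t)).
Proof.
move=> H; have k0 := nc_ge0 k; have b0 : 0 <= bound by rewrite mulr_ge0 ?sqr_ge0.
pose D := `|C|; have D0 : 0 <= D by exact: normr_ge0.
exists (2 * D * nc k + 2 * D * bound), (2 * (nc k + 1))^-1; split => [||t Pt].
- by rewrite addr_ge0 ?mulr_ge0.
- by rewrite invr_gt0; lra.
have h := H t Pt; set z := phi t in h *.
have s0 : 0 < nc (sh z).
  rewrite lt_neqAle nc_ge0 andbT eq_sym; apply: contraTneq h => ->.
  by rewrite mulr0 -ltNge expR_gt0.
have sn0 : sh z != 0 by apply: contraTneq s0 => ->; rewrite normc0 ltxx.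
have hD (y : CC R) : nc (cexp y) <= expR `|complex.Re z| -> nc (cexp y / sh z) <= D.
  move=> hy; rewrite normcM normcV ler_pdivrMr//.
  apply: le_trans hy (le_trans h _).
  by rewrite ler_wpM2r ?nc_ge0// ler_norm.
have ha : nc (cexp z / sh z) <= D by apply: hD; rewrite nc_cexp ler_expR ler_norm.
have hb : nc (cexp (- z) / sh z) <= D.
  by apply: hD; rewrite nc_cexp ler_expR raddfN -normrN ler_norm.
set al := cexp z / sh z in ha *; set be := cexp (- z) / sh z in hb *.
have ab : al - be = 1 by rewrite -mulrBl divff.
exists ((al + be) * k).
  rewrite normcM; have := ncD al be.
  have := mulr_ge0 (mulr_ge0 (ler0n _ 2) D0) b0; nra.
move=> w wd; exists (al * cexp (k * w) - be * cexp (- (k * w))).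
  by rewrite phis -/z {1}/sh opprD !cexpD /al /be; field.
have -> : al * cexp (k * w) - be * cexp (- (k * w)) - 1 - (al + be) * k * w =
    al * (cexp (k * w) - 1 - k * w) - be * (cexp (- (k * w)) - 1 - - (k * w)).
  by rewrite -[X in _ - X - _]ab; ring.
have e1 := rel2_exp_aux wd.
have e2 : nc (cexp (- (k * w)) - 1 - - (k * w)) <= bound * nc w ^+ 2.
  by rewrite -mulrN -(ncN w); apply: rel2_exp_aux; rewrite ncN.
apply: le_trans (ncB _ _) _.
have E : bound * nc w ^+ 2 * D * 2 <= (2 * D * nc k + 2 * D * bound) * nc w ^+ 2.
  have := mulr_ge0 (mulr_ge0 (mulr_ge0 (ler0n R 2) D0) k0) (sqr_ge0 (nc w)).
  by lra.
apply: le_trans E.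
have f1 : nc (al * (cexp (k * w) - 1 - k * w)) <= D * (bound * nc w ^+ 2).
  by rewrite normcM; apply: ler_pM; rewrite ?nc_ge0.
have f2 : nc (be * (cexp (- (k * w)) - 1 - - (k * w))) <= D * (bound * nc w ^+ 2).
  by rewrite normcM; apply: ler_pM; rewrite ?nc_ge0.
apply: le_trans (lerD f1 f2) _.
by rewrite le_eqVlt; apply/predU1P; left; ring.
Qed.

End Rel2.

(** * Decay of the kernel *)

Section Decay.
Variable R : realType.

Definition onep (u : R) : R := 1 + `|u|.

Lemma onep_ge1 u : 1 <= onep u.
Proof. by rewrite lerDl. Qed.

Lemma onep_gt0 u : 0 < onep u.
Proof. exact: lt_le_trans (onep_ge1 u). Qed.

Lemma onep_ge0 u : 0 <= onep u.
Proof. exact/ltW/onep_gt0. Qed.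

Lemma onep_le_expR (d : R) N : 0 < d ->
  exists2 C, 0 < C & forall u, onep u ^+ N <= C * expR (d * `|u|).
Proof.
elim: N d => [|N IH] d d0.
  exists 1 => // u; rewrite expr0 mul1r -expR0 ler_expR mulr_ge0//.
  exact: ltW.
have d20 : 0 < d / 2 by rewrite divr_gt0.
have [C C0 H] := IH _ d20.
exists ((1 + (d / 2)^-1) * C) => [|u].
  by rewrite mulr_gt0// addr_gt0// invr_gt0.
have -> : d * `|u| = d / 2 * `|u| + d / 2 * `|u| by lra.
rewrite exprS expRD mulrACA.
apply: ler_pM; rewrite ?exprn_ge0 ?onep_ge0//.
apply: (@le_trans _ _ ((1 + (d / 2)^-1) * (1 + d / 2 * `|u|))); last first.
  by apply: ler_wpM2l; [rewrite addr_ge0// invr_ge0 ltW | exact: expR_ge1Dx].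
rewrite mulrDl mul1r mulrDr mulr1 mulKf ?gt_eqF//.
have : 0 <= d / 2 * `|u| by rewrite mulr_ge0// ltW.
have : 0 <= (d / 2)^-1 by rewrite invr_ge0 ltW.
by rewrite /onep; move: (d / 2 * `|u|) (d / 2)^-1 => x y; lra.
Qed.

Lemma onep_weight u : (onep u ^+ 2)^-1 <= weight u.
Proof.
rewrite lef_pV2 ?posrE ?exprn_gt0 ?onep_gt0 ?(lt_le_trans ltr01 (oneDsqr_ge1 u))//.
rewrite /oneDsqr /onep -(real_normK (num_real u)); have := normr_ge0 u; nra.
Qed.

(** A kernel with exponential decay is dominated by the weight whatever the
    polynomial factor. On the boundary of the domain, where d = 0, the two extra
    powers of 1 + |u| in the denominator do this instead. *)
Lemma decay_weight (d : R) (B nu : nat) : 0 < d \/ 0 <= d /\ (B + 2 <= nu)%N ->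
  exists2 C, 0 < C & forall u,
    expR (- (d * `|u|)) * onep u ^+ B / onep u ^+ nu <= C * weight u.
Proof.
case=> [d0|[d0 Bnu]].
  have [C C0 H] := onep_le_expR (B + 2) d0; exists C => // u.
  have o0 := onep_gt0 u; apply: le_trans (ler_wpM2l (ltW C0) (onep_weight u)).
  rewrite ler_pdivlMr ?exprn_gt0//.
  apply: (@le_trans _ _ (expR (- (d * `|u|)) * onep u ^+ B * onep u ^+ 2)).
    rewrite ler_wpM2r ?exprn_ge0 ?onep_ge0// ler_piMr//.
      by rewrite mulr_ge0 ?expR_ge0 ?exprn_ge0 ?onep_ge0.
    by rewrite invf_le1 ?exprn_gt0// exprn_ege1// onep_ge1.
  by rewrite -mulrA -exprD expRN mulrC ler_pdivrMr ?expR_gt0.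
exists 1 => // u; rewrite mul1r; apply: le_trans (onep_weight u).
have o0 := onep_gt0 u.
rewrite ler_pdivrMr ?exprn_gt0// mulrC.
apply: (@le_trans _ _ (onep u ^+ B)).
  rewrite ler_piMr ?exprn_ge0 ?onep_ge0//.
  by rewrite -expR0 ler_expR oppr_le0 mulr_ge0.
rewrite mulrC ler_pdivlMr ?exprn_gt0// -exprD.
by rewrite ler_weXn2l// onep_ge1.
Qed.

End Decay.

Section Kernel.
Variable R : realType.

(** The bounds keep the contours R + i e with e <= e0 away from the poles of the
    kernel, and they give the same decay as for a single exponential. The bound
    for hbar is void at hbar = 0: there sh (pi hbar p) is 0, and the kernel with
    b > 0 is 0 by the convention 0^-1 = 0. *)
Definition admissible (hbar : CC R) (e0 : R) := [/\ 0 < e0, e0 <= 1 &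
  forall e1, 0 < e1 -> exists2 C, 0 < C & forall p : CC R,
    e1 <= complex.Im p <= e0 ->
    expR `|complex.Re (pi%:C * p)| <= C * nc (sh (pi%:C * p)) /\
    (hbar != 0 -> expR `|complex.Re (pi%:C * hbar * p)| <=
                  C * nc (sh (pi%:C * hbar * p)))].

Lemma admissible_exists hbar : exists e0, admissible hbar e0.
Proof.
have [e e0 H] := @sh_contour R 1 (oner_neq0 _).
have [h0|h0] := eqVneq hbar 0.
  exists (Num.min 1 e); split; rewrite ?lt_min ?ltr01 ?ge_min ?lexx// => e1 /H.
  move=> [C C0 K]; exists C => // p /andP[p1]; rewrite le_min => /andP[_ p2].
  by rewrite h0 eqxx; split => //; move: (K p); rewrite p1 p2 mulr1; apply.
have [e' e'0 H'] := sh_contour h0.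
exists (Num.min 1 (Num.min e e')).
split; rewrite ?lt_min ?ltr01 ?ge_min ?lexx ?e0// => e1 e10.
have [C C0 K] := H _ e10; have [C' C'0 K'] := H' _ e10.
exists (C + C'); first exact: addr_gt0.
move=> p /andP[p1]; rewrite !le_min => /and3P[_ p2 p3].
split=> [|_].
  have := K p; rewrite p1 p2 mulr1 => /(_ isT) {}K.
  by apply: le_trans K _; rewrite ler_wpM2r ?nc_ge0// lerDl ltW.
have := K' p; rewrite p1 p3 => /(_ isT) {}K.
by apply: le_trans K _; rewrite ler_wpM2r ?nc_ge0// lerDr ltW.
Qed.

Lemma ReM (p w : CC R) : complex.Re (p * w) =
  complex.Re p * complex.Re w - complex.Im p * complex.Im w.
Proof. by case: p w => ? ? []. Qed.

Lemma Re_realM (t : R) (p : CC R) : complex.Re (t%:C * p) = t * complex.Re p.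
Proof. by rewrite ReM /= mul0r subr0. Qed.

Lemma Im_realM (t : R) (p : CC R) : complex.Im (t%:C * p) = t * complex.Im p.
Proof. by case: p => ? ? /=; rewrite mul0r addr0. Qed.

(** For complex hbar the imaginary part of hbar contributes only the bounded
    factor exp (pi b |Im hbar| Im p), so that the rate of decay is governed by
    Re hbar. *)
Lemma kernel_denominator_bound hbar e0 e1 a b : admissible hbar e0 -> 0 < e1 ->
  exists2 C, 0 < C & forall p : CC R, e1 <= complex.Im p <= e0 ->
  nc (sh (pi%:C * p) ^+ a * sh (pi%:C * hbar * p) ^+ b)^-1 <=
  C * expR (- (pi * (a%:R + b%:R * `|complex.Re hbar|) * `|complex.Re p|)).
Proof.
move=> [e00 e01 H] e10; have [C C0 K] := H _ e10; have pi0 := pi_gt0 R.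
have inv_le (x : CC R) (y : R) : expR y <= C * nc x -> nc x^-1 <= C * expR (- y).
  move=> h; have e := expR_gt0 y.
  have x0 : 0 < nc x.
    by rewrite -(pmulr_rgt0 _ C0); exact: lt_le_trans e h.
  by rewrite normcV expRN -div1r ler_pdivrMr// mulrAC ler_pdivlMr// mul1r.
have A (p : CC R) : e1 <= complex.Im p <= e0 ->
    nc (sh (pi%:C * p))^-1 <= C * expR (- (pi * `|complex.Re p|)).
  move=> /K[h _]; apply: inv_le; move: h.
  by rewrite Re_realM normrM (gtr0_norm pi0).
have A2 (p : CC R) : e1 <= complex.Im p <= e0 ->
    nc ((sh (pi%:C * p) ^+ a)^-1) <=
    C ^+ a * expR (- (pi * a%:R * `|complex.Re p|)).
  move=> pe; rewrite -exprVn ncX.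
  have -> : - (pi * a%:R * `|complex.Re p|) = a%:R * - (pi * `|complex.Re p|).
    by ring.
  rewrite expRM_natl -exprMn.
  by rewrite lerXn2r ?nnegrE ?nc_ge0 ?mulr_ge0 ?expR_ge0 ?(ltW C0)// A.
have [h0|h0] := eqVneq hbar 0.
  exists (C ^+ a); first exact: exprn_gt0.
  have hs : nc ((sh (0 : CC R) ^+ b)^-1) <= 1.
    have -> : sh (0 : CC R) = 0 by rewrite /sh oppr0 subrr.
    rewrite expr0n; case: (b == 0)%N; first by rewrite invr1 normc1.
    by rewrite invr0 normc0.
  move=> p pe; rewrite h0 (raddf0 (@complex.Re R)) normr0 !mulr0 addr0 mul0r.
  rewrite invfM normcM -[X in _ <= X]mulr1.
  exact: (ler_pM (nc_ge0 _) (nc_ge0 _) (A2 p pe) hs).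
exists (C ^+ a * (C * expR (pi * `|complex.Im hbar|)) ^+ b).
  by rewrite mulr_gt0 ?exprn_gt0// mulr_gt0// expR_gt0.
move=> p pe; rewrite invfM normcM mulrDr mulrDl opprD expRD mulrACA.
apply: (ler_pM (nc_ge0 _) (nc_ge0 _) (A2 p pe)).
have -> : - (pi * (b%:R * `|complex.Re hbar|) * `|complex.Re p|) =
  b%:R * - (pi * `|complex.Re hbar| * `|complex.Re p|) by ring.
rewrite -exprVn ncX expRM_natl -exprMn.
rewrite lerXn2r ?nnegrE ?nc_ge0 ?mulr_ge0 ?expR_ge0 ?(ltW C0)//.
apply: le_trans (inv_le _ _ ((K p pe).2 h0)) _.
rewrite -[X in _ <= X]mulrA ler_pM2l// -expRD ler_expR.
have /andP[p1 p2] := pe; have p0 : 0 < complex.Im p by exact: lt_le_trans p1.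
rewrite -[pi%:C * _ * _]mulrA Re_realM normrM (gtr0_norm pi0).
rewrite -[pi * _ * _]mulrA -mulrBr -mulrN ler_pM2l//.
rewrite ReM; have := lerB_dist (complex.Re hbar * complex.Re p) (complex.Im hbar * complex.Im p).
have : `|complex.Im hbar * complex.Im p| <= `|complex.Im hbar|.
  by rewrite normrM ler_piMr// gtr0_norm// (le_trans p2).
rewrite [`|complex.Re hbar * _|]normrM; lra.
Qed.

Lemma nc_cexp_linear (p w : CC R) :
  nc (cexp (- ('i * p * w))) = expR (complex.Re p * complex.Im w +
                                     complex.Im p * complex.Re w).
Proof.
rewrite nc_cexp; congr expR; case: p w => u e [x y] /=; ring.
Qed.

End Kernel.

(** * The regularised integrand *)

Section Integrand.
Variables (R : realType) (hbar : CC R) (m : nat).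
Variables (a b : 'I_m -> nat) (n : 'I_m -> int).
Implicit Types (p omega : 'rV[CC R]_m) (nu : 'I_m -> nat) (Y : 'I_m -> R).

Definition strip (e1 e0 : R) p := forall k, e1 <= complex.Im (p 0 k) <= e0.

(** On the contour i / p_k is bounded and decays like 1 / |p_k|, and since
    d/d omega_k multiplies the integrand by - i p_k it lowers nu_k by one. *)
Definition reg_integrand nu omega p : CC R :=
  qpl_integrand hbar a b n omega p * \prod_k ('i / p 0 k) ^+ nu k.

(** Each factor (p_1 + ... + p_k)^(- n_k) grows at most like the power |n_k| of
    every variable, so this exponent bounds the growth in each variable. *)
Definition growth : nat := \sum_k `|n k|%N.

(** The imaginary parts of omega may reach the boundary of the domain at those k
    where the regularisation leaves, after the growth, a decay of order M + 2; the
    M spare orders pay for factors that grow like |p_k|^M. *)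
Definition decays (M : nat) nu Y := forall k,
  Y k < qpl_width hbar a b k \/
  Y k <= qpl_width hbar a b k /\ (growth + M + 2 <= nu k)%N.

(** All p_j have imaginary part at least e1, so the one of the sum is at least
    e1. *)
Lemma partial_sum_ge e1 e0 p (k : 'I_m) : 0 < e1 -> strip e1 e0 p ->
  e1 <= nc (\sum_(j < m | (j <= k)%N) p 0 j).
Proof.
move=> e10 ps; apply: le_trans (Im_le_nc _); apply: le_trans (ler_norm _).
rewrite raddf_sum (bigD1 k)//= -[leLHS]addr0; apply: lerD.
  by case/andP: (ps k).
by apply: sumr_ge0 => j _; case/andP: (ps j) => h _; apply: le_trans h; exact: ltW.
Qed.

Lemma onep_prod_ge1 (s : seq 'I_m) (P : pred 'I_m) (u : 'I_m -> R) :
  1 <= \prod_(j <- s | P j) onep (u j).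
Proof.
elim/big_rec: _ => // j x _ x1; rewrite -[1]mulr1.
by apply: ler_pM => //; exact: onep_ge1.
Qed.

Lemma partial_sum_bound e1 e0 (k : 'I_m) : 0 < e1 -> e0 <= 1 ->
  exists2 C, 0 < C & forall p, strip e1 e0 p ->
  nc (((\sum_(j < m | (j <= k)%N) p 0 j) ^ n k)^-1) <=
  C * (\prod_j onep (complex.Re (p 0 j))) ^+ `|n k|%N.
Proof.
move=> e10 e01; case: (n k) => N; rewrite ?abszE /=.
  exists (e1^-1 ^+ N) => [|p ps]; first by rewrite exprn_gt0// invr_gt0.
  have h := partial_sum_ge k e10 ps.
  rewrite -exprnP -exprVn ncX -exprMn lerXn2r ?nnegrE ?nc_ge0//.
    rewrite mulr_ge0 ?invr_ge0 ?(ltW e10)//.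
    by apply: le_trans (onep_prod_ge1 _ _ _).
  rewrite normcV -[leLHS]mulr1; apply: ler_pM; rewrite ?invr_ge0 ?nc_ge0//.
    by rewrite lef_pV2 ?posrE//; exact: lt_le_trans h.
  exact: onep_prod_ge1.
exists (m.+1%:R ^+ N.+1) => [|p ps]; first by rewrite exprn_gt0.
rewrite NegzE -exprnN invrK ncX -exprMn lerXn2r ?nnegrE ?nc_ge0//.
  by rewrite mulr_ge0//; apply: le_trans (onep_prod_ge1 _ _ _).
set G := \prod_j _.
have G1 : 1 <= G by exact: onep_prod_ge1.
have pj j : nc (p 0 j) <= G.
  apply: le_trans (nc_le _) _.
  rewrite /G (bigD1 j)//= -[leLHS]mulr1; apply: ler_pM => //.
  - rewrite addrC lerD2r; case/andP: (ps j) => h1 h2.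
    by rewrite gtr0_norm ?(lt_le_trans e10 h1)// (le_trans h2).
  - exact: onep_prod_ge1.
apply: le_trans (nc_sum _ _ _) _.
apply: le_trans (_ : _ <= \sum_(j < m) G) _.
  apply: le_trans (ler_sum _ (fun j _ => pj j)) _.
  rewrite [leRHS](bigID (fun j : 'I_m => (j <= k)%N))/= lerDl sumr_ge0// => *.
  exact: le_trans G1.
rewrite sumr_const card_ord -[G *+ _]mulr_natl ler_wpM2r ?ler_nat//.
exact: le_trans G1.
Qed.

Lemma reg_factor_bound (e1 : R) : 0 < e1 -> exists2 C, 0 < C & forall q : CC R,
  e1 <= complex.Im q -> nc ('i / q) <= C / onep (complex.Re q).
Proof.
move=> e10; exists (1 + e1^-1); first by rewrite addr_gt0// invr_gt0.
move=> q qe; have q0 : 0 < nc q.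
  by apply: lt_le_trans e10 (le_trans qe (le_trans (ler_norm _) (Im_le_nc _))).
rewrite normcM nc_i mul1r normcV ler_pdivlMr ?onep_gt0// mulrC ler_pdivrMr//.
rewrite mulrDl mul1r addrC /onep; apply: lerD; last exact: Re_le_nc.
rewrite mulrC ler_pdivlMr// mul1r.
by apply: le_trans qe (le_trans (ler_norm _) (Im_le_nc _)).
Qed.

Lemma reg_integrand_bound e0 e1 nu (X : R) :
  admissible hbar e0 -> 0 < e1 -> 0 <= X ->
  exists2 C, 0 < C & forall omega p,
  (forall k, `|complex.Re (omega 0 k)| <= X) -> strip e1 e0 p ->
  nc (reg_integrand nu omega p) <= C * \prod_k
    (expR (- ((qpl_width hbar a b k - `|complex.Im (omega 0 k)|) *
              `|complex.Re (p 0 k)|)) *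
     onep (complex.Re (p 0 k)) ^+ growth / onep (complex.Re (p 0 k)) ^+ nu k).
Proof.
move=> adm e10 X0; have [e00 e01 _] := adm.
have [D D0 HD] := reg_factor_bound e10.
have /choice[C1 H1] : forall k : 'I_m, exists C : R, 0 < C /\ forall p, strip e1 e0 p ->
    nc (((\sum_(j < m | (j <= k)%N) p 0 j) ^ n k)^-1) <=
    C * (\prod_j onep (complex.Re (p 0 j))) ^+ `|n k|%N.
  by move=> k; have [C C0 H] := partial_sum_bound k e10 e01; exists C.
have /choice[C2 H2] : forall k : 'I_m, exists C : R, 0 < C /\ forall q : CC R,
    e1 <= complex.Im q <= e0 ->
    nc (sh (pi%:C * q) ^+ a k * sh (pi%:C * hbar * q) ^+ b k)^-1 <=
    C * expR (- (qpl_width hbar a b k * `|complex.Re q|)).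
  move=> k; have [C C0 H] := kernel_denominator_bound (a k) (b k) adm e10.
  by exists C.
exists (\prod_k (expR X * C2 k * C1 k * D ^+ nu k)).
  apply: prodr_gt0 => k _.
  by rewrite !mulr_gt0 ?expR_gt0 ?exprn_gt0//; [case: (H2 k)|case: (H1 k)].
move=> omega p oX ps; set G := \prod_j onep (complex.Re (p 0 j)).
have -> : \prod_k (expR (- ((qpl_width hbar a b k - `|complex.Im (omega 0 k)|) *
              `|complex.Re (p 0 k)|)) *
     onep (complex.Re (p 0 k)) ^+ growth / onep (complex.Re (p 0 k)) ^+ nu k) =
   \prod_k (expR (- ((qpl_width hbar a b k - `|complex.Im (omega 0 k)|) *
              `|complex.Re (p 0 k)|)) * G ^+ `|n k|%N /
              onep (complex.Re (p 0 k)) ^+ nu k).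
  rewrite !big_split /=; congr (_ * _ * _).
  by rewrite -expr_sum prodrXl.
rewrite -big_split /reg_integrand /qpl_integrand -big_split nc_prod /=.
apply: ler_prod => k _; rewrite nc_ge0 /=.
rewrite !normcM ncX nc_cexp_linear.
have /andP[pe1 pe0] := ps k.
have hC2 := (H2 k).2 _ (ps k); have hC1 := (H1 k).2 _ ps; rewrite -/G in hC1.
have hD : nc ('i / p 0 k) ^+ nu k <= D ^+ nu k / onep (complex.Re (p 0 k)) ^+ nu k.
  rewrite -expr_div_n lerXn2r ?nnegrE ?nc_ge0 ?HD//.
  by rewrite divr_ge0 ?onep_ge0 ?(ltW D0).
have hE : expR (complex.Re (p 0 k) * complex.Im (omega 0 k) +
    complex.Im (p 0 k) * complex.Re (omega 0 k)) <=
    expR X * expR (`|complex.Im (omega 0 k)| * `|complex.Re (p 0 k)|).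
  rewrite -expRD ler_expR addrC; apply: lerD.
    apply: le_trans (ler_norm _) _; rewrite normrM gtr0_norm ?(lt_le_trans e10)//.
    apply: le_trans (ler_pM _ _ (le_trans pe0 e01) (oX k)) _ => //.
      exact: le_trans (ltW e10) pe1.
    by rewrite mul1r.
  by rewrite mulrC -normrM ler_norm.
apply: le_trans (ler_pM _ _ (ler_pM _ _ (ler_pM _ _ hE hC2) hC1) hD) _;
  rewrite ?mulr_ge0 ?expR_ge0 ?exprn_ge0 ?nc_ge0//.
rewrite mulrBl opprB expRD le_eqVlt; apply/predU1P; left; ring.
Qed.

End Integrand.

(** * Absolute convergence on the contours *)

Section Contour.
Variables (R : realType) (hbar : CC R) (m : nat).
Variables (a b : 'I_m -> nat) (n : 'I_m -> int).
Implicit Types (p omega : 'rV[CC R]_m) (nu : 'I_m -> nat) (Y : 'I_m -> R).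

Local Notation Phi := (@reg_integrand R hbar m a b n).
Local Notation decay := (@decays R hbar m a b n).

Lemma reg_integrand_dominated e0 e1 nu M Y (X : R) :
  admissible hbar e0 -> 0 < e1 -> 0 <= X -> decay M nu Y ->
  exists2 C, 0 < C & forall omega p,
  (forall k, `|complex.Re (omega 0 k)| <= X) ->
  (forall k, `|complex.Im (omega 0 k)| <= Y k) -> strip e1 e0 p ->
  nc (Phi nu omega p) * \prod_k onep (complex.Re (p 0 k)) ^+ M <=
  C * \prod_k weight (complex.Re (p 0 k)).
Proof.
move=> adm e10 X0 dec.
have [C C0 H] := reg_integrand_bound a b n nu adm e10 X0.
have /choice[D HD] : forall k : 'I_m, exists D : R, 0 < D /\ forall u,
    expR (- ((qpl_width hbar a b k - Y k) * `|u|)) * onep u ^+ (growth n + M)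
    / onep u ^+ nu k <= D * weight u.
  move=> k; have [|D D0 K] := @decay_weight R (qpl_width hbar a b k - Y k)
    (growth n + M) (nu k); last by exists D.
  by rewrite subr_ge0 subr_gt0; exact: dec.
exists (C * \prod_k D k).
  by rewrite mulr_gt0//; apply: prodr_gt0 => k _; case: (HD k).
move=> omega p oX oY ps; rewrite -mulrA -big_split /=.
apply: le_trans (ler_wpM2r _ (H omega p oX ps)) _.
  by apply: prodr_ge0 => k _; rewrite exprn_ge0// onep_ge0.
rewrite -mulrA ler_pM2l// -big_split /=; apply: ler_prod => k _.
set u := complex.Re (p 0 k); have o0 := onep_ge0 u; have o1 := onep_gt0 u.
rewrite !mulr_ge0 ?expR_ge0 ?invr_ge0 ?exprn_ge0//=.
apply: le_trans ((HD k).2 u); rewrite mulrAC; apply: ler_wpM2r.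
  by rewrite invr_ge0 exprn_ge0.
rewrite -mulrA -exprD; apply: ler_wpM2r; first by rewrite exprn_ge0.
by rewrite ler_expR lerN2 ler_wpM2r// lerB.
Qed.

Definition move_coord (l : 'I_m) (w : CC R) p := p + w *: delta_mx 0 l.

Lemma move_coordE l w p k : move_coord l w p 0 k = p 0 k + (k == l)%:R * w.
Proof. by rewrite !mxE mulrC. Qed.

(** Every factor of the integrand is an exponential, a sh or a power of a linear
    form in the coordinate that moves. *)
Lemma rel2_reg_integrand e0 e1 nu omega l :
  admissible hbar e0 -> 0 < e1 ->
  rel2 (move_coord l) (strip e1 e0) (Phi nu omega).
Proof.
move=> [_ _ adm] e10; have [C C0 H] := adm _ e10.
have coordS k w p : p 0 k + (k == l)%:R * w = move_coord l w p 0 k.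
  by rewrite move_coordE.
have rp (k : 'I_m) : rel2 (move_coord l) (strip e1 e0) (fun p => p 0 k).
  apply: (rel2_linear (k := (k == l)%:R) _ e10) => [w p|p ps].
    exact: move_coordE.
  apply: le_trans (Im_le_nc _); apply: le_trans (ler_norm _).
  by case/andP: (ps k).
rewrite /reg_integrand /qpl_integrand /qpl_kernel.
apply: rel2M; apply: rel2_prod => k; last first.
  by apply/rel2X/rel2M; [exact: rel2_invariant | exact: rel2V].
apply: rel2M; last first.
  apply/rel2V/rel2Xz.
  apply: (rel2_linear (k := \sum_(j < m | (j <= k)%N) (j == l)%:R) _ e10).
    move=> w p; rewrite mulr_suml -big_split; apply: eq_bigr => j _.
    exact: move_coordE.
  by move=> p; exact: partial_sum_ge.
apply: rel2M.
  apply: (@rel2_cexp _ _ _ _ _ (- ('i * (k == l)%:R * omega 0 k))) => w p.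
  by rewrite move_coordE; ring.
apply/rel2V/rel2M; apply: rel2X.
  apply: (@rel2_sh _ _ _ _ _ (pi%:C * (k == l)%:R) _ C) => [w p|p ps].
    by rewrite move_coordE; ring.
  by case: (H _ (ps k)).
have [h0|h0] := eqVneq hbar 0.
  by apply: rel2_invariant => w p; rewrite h0 !mulr0 !mul0r.
apply: (@rel2_sh _ _ _ _ _ (pi%:C * hbar * (k == l)%:R) _ C) => [w p|p ps].
  by rewrite move_coordE; ring.
by case: (H _ (ps k)) => _; apply.
Qed.

Definition cont (E x : 'rV[R]_m) : 'rV[CC R]_m := \row_k (x 0 k +i* E 0 k).

Lemma Re_cont E x k : complex.Re (cont E x 0 k) = x 0 k.
Proof. by rewrite mxE. Qed.

Lemma Im_cont E x k : complex.Im (cont E x 0 k) = E 0 k.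
Proof. by rewrite mxE. Qed.

Lemma cont_moveRe E x h k :
  cont E (x + h *: delta_mx 0 k) = move_coord k h%:C (cont E x).
Proof.
apply/rowP => j; rewrite !mxE /=; case: (j == k); apply/eqP;
  by rewrite eq_complex /= ?mulr1 ?mulr0 ?mul0r ?subr0 ?addr0 !eqxx.
Qed.

Lemma cont_moveIm E x h k :
  cont (E + h *: delta_mx 0 k) x = move_coord k ('i * h%:C) (cont E x).
Proof.
apply/rowP => j; rewrite !mxE /=; case: (j == k); apply/eqP;
  by rewrite eq_complex /= ?mulr1 ?mulr0 ?mul0r ?mul1r ?subr0 ?addr0 ?add0r ?subrr ?addr0 !eqxx.
Qed.

Definition imag_between e1 e0 (E : 'rV[R]_m) := forall k, e1 <= E 0 k <= e0.

Lemma strip_cont e1 e0 E x : imag_between e1 e0 E -> strip e1 e0 (cont E x).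
Proof. by move=> h k; rewrite Im_cont. Qed.

Definition omega_decays M nu omega :=
  decay M nu (fun k => `|complex.Im (omega 0 k)|).

Lemma omega_ReX omega : exists2 X, 0 <= X & forall k, `|complex.Re (omega 0 k)| <= X.
Proof.
exists (\sum_k `|complex.Re (omega 0 k)|); first exact: sumr_ge0.
by move=> k; rewrite (bigD1 k)//= lerDl sumr_ge0.
Qed.

Lemma decaysW M nu Y : decay M nu Y -> decay 0 nu Y.
Proof.
move=> h k; case: (h k) => [|[h1 h2]]; first by left.
right; split => //; apply: leq_trans h2; rewrite addn0 leq_add2r leq_addr//.
Qed.

Lemma cont_dominated e0 e1 nu omega : admissible hbar e0 -> 0 < e1 ->
  omega_decays 0 nu omega -> exists2 C, 0 < C & forall E x,
    imag_between e1 e0 E -> nc (Phi nu omega (cont E x)) <= C * \prod_k weight (x 0 k).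
Proof.
move=> adm e10 dec; have [X X0 HX] := omega_ReX omega.
have [C C0 H] := reg_integrand_dominated adm e10 X0 dec.
exists C => // E x EE.
have := H omega (cont E x) HX (fun=> lexx _) (strip_cont x EE).
rewrite [X in _ * X]big1 ?mulr1// => h; apply: le_trans h _.
by rewrite le_eqVlt; apply/predU1P; left; congr (_ * _);
   apply: eq_bigr => k _; rewrite Re_cont.
Qed.

(** Relative differentiability times the majorant gives the Lipschitz bound. *)
Lemma cont_mintegrable e0 e1 nu omega E : admissible hbar e0 -> 0 < e1 ->
  omega_decays 0 nu omega -> imag_between e1 e0 E ->
  mintegrable (fun x => Phi nu omega (cont E x)).
Proof.
move=> adm e10 dec EE; have [D D0 HD] := cont_dominated adm e10 dec.
have /choice[Cd HC] : forall k : 'I_m, exists Cd : R * R, [/\ 0 <= Cd.1, 0 < Cd.2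
    & forall x h, `|h| <= Cd.2 ->
      nc (Phi nu omega (move_coord k h%:C (cont E x)) - Phi nu omega (cont E x))
      <= Cd.1 * `|h| * nc (Phi nu omega (cont E x))].
  move=> k; have [C [d [C0 d0 H]]] := rel2_reg_integrand nu omega k adm e10.
  exists (2 * C, Num.min 1 d); split=> /=; first by rewrite mulr_ge0.
    by rewrite lt_min ltr01.
  move=> x h; rewrite le_min => /andP[h1 hd].
  have [A AC K] := H _ (strip_cont x EE).
  have [|rho -> hr] := K h%:C; first by rewrite nc_real.
  rewrite -[X in _ - X]mulr1 -mulrBr normcM mulrC ler_wpM2r ?nc_ge0//.
  rewrite (_ : rho - 1 = A * h%:C + (rho - 1 - A * h%:C)); last by ring.
  apply: le_trans (ncD _ _) _; rewrite normcM.
  move: hr; rewrite nc_real => hr.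
  have : nc A * `|h| <= C * `|h| by rewrite ler_wpM2r.
  have : C * `|h| ^+ 2 <= C * `|h| by rewrite ler_wpM2l// expr2 ler_piMl.
  lra.
apply: (@mintegrable_lipschitz _ _ D (fun k => (Cd k).1 * D) (fun k => (Cd k).2)).
- by move=> k; case: (HC k).
- by move=> x; exact: HD.
move=> x k h hd; rewrite cont_moveRe; have [C0 _ H] := HC k.
apply: le_trans (H x h hd) _; rewrite [_ * D * _]mulrAC -[leRHS]mulrA.
by rewrite ler_wpM2l ?mulr_ge0// HD.
Qed.

(** The mean value inequality, proved by cutting [u, v] into N pieces: the errors
    C (v - u)^2 / N add up to an arbitrarily small amount. *)
Lemma subdivision (phi dphi : R -> CC R) (c : CC R) (C d eta u v : R) :
  u <= v -> 0 < d -> 0 <= C ->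
  (forall t, u <= t <= v -> nc (dphi t - c) <= eta) ->
  (forall t h, u <= t -> t + h <= v -> 0 <= h <= d ->
     nc (phi (t + h) - phi t - h%:C * dphi t) <= C * h ^+ 2) ->
  nc (phi v - phi u - (v - u)%:C * c) <= eta * (v - u).
Proof.
move=> uv d0 C0 hc H; apply/ler_addgt0Pr => e e0.
pose L := v - u; have L0 : 0 <= L by rewrite subr_ge0.
(* N > x pieces have length at most d and total error at most e *)
pose x := L / d + C * L ^+ 2 / e.
have x0 : 0 <= x by rewrite addr_ge0// divr_ge0// ?mulr_ge0 ?sqr_ge0// ltW.
pose N := (Num.truncn x).+1.
have xN : x < N%:R by exact: truncnS_gt.
have N0 : 0 < N%:R :> R by rewrite ltr0n.
pose h := L / N%:R; have h0 : 0 <= h by rewrite divr_ge0// ltW.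
have Ld : 0 <= L / d by rewrite divr_ge0// ltW.
have Ce : 0 <= C * L ^+ 2 / e by rewrite divr_ge0 ?mulr_ge0 ?sqr_ge0// ltW.
have hd : h <= d.
  rewrite ler_pdivrMr// mulrC -ler_pdivrMr//.
  by apply: ltW; apply: le_lt_trans xN; rewrite lerDl.
have Nh : N%:R * h = L by rewrite mulrC divfK// gt_eqF.
have tv j : (j <= N)%N -> u + j%:R * h <= v.
  move=> jN; rewrite -lerBrDl -/L -Nh ler_wpM2r// ler_nat//.
have tu (j : nat) : u <= u + j%:R * h by rewrite lerDl mulr_ge0.
have step j : (j <= N)%N ->
    nc (phi (u + j%:R * h) - phi u - (j%:R * h)%:C * c) <=
    j%:R * (eta * h + C * h ^+ 2).
  elim: j => [|j IH] jN.
    by rewrite mulr0n !mul0r addr0 !subrr normc0.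
  have E : u + j.+1%:R * h = u + j%:R * h + h by rewrite -natr1; ring.
  have := H (u + j%:R * h) h (tu j); rewrite -E tv// h0 hd => /(_ isT isT) k1.
  have k2 : nc (h%:C * (dphi (u + j%:R * h) - c)) <= h * eta.
    by rewrite normcM nc_real ger0_norm// ler_wpM2l// hc// tu tv// ltnW.
  have k3 := IH (ltnW jN).
  have -> : phi (u + j.+1%:R * h) - phi u - (j.+1%:R * h)%:C * c =
    (phi (u + j%:R * h) - phi u - (j%:R * h)%:C * c) +
    (phi (u + j.+1%:R * h) - phi (u + j%:R * h) - h%:C * dphi (u + j%:R * h)
     + h%:C * (dphi (u + j%:R * h) - c)).
    by rewrite -natr1 mulrDl mul1r rmorphD /=; ring.
  apply: le_trans (ncD _ _) _.
  have -> : j.+1%:R * (eta * h + C * h ^+ 2) =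
    j%:R * (eta * h + C * h ^+ 2) + (eta * h + C * h ^+ 2).
    by rewrite -natr1 mulrDl mul1r.
  apply: lerD => //; apply: le_trans (ncD _ _) _; lra.
have := step N (leqnn _); rewrite Nh (_ : u + L = v); last by rewrite /L; ring.
move=> k; apply: le_trans k _.
have -> : N%:R * (eta * h + C * h ^+ 2) = eta * (v - u) + C * L ^+ 2 / N%:R.
  by rewrite /h /L; field; rewrite gt_eqF.
rewrite lerD2l ler_pdivrMr// [e * _]mulrC -ler_pdivrMr//.
by apply: ltW; apply: le_lt_trans xN; rewrite lerDr.
Qed.

End Contour.

(** * Independence of the contour *)

Section Independence.
Variables (R : realType) (hbar : CC R) (m : nat).
Variables (a b : 'I_m -> nat) (n : 'I_m -> int).
Implicit Types (p omega : 'rV[CC R]_m) (nu : 'I_m -> nat) (E : 'rV[R]_m).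

Local Notation Phi := (@reg_integrand R hbar m a b n).

(** To first order, the change under a shift of the contour by i h is i times the
    change under a real shift by h, and the integral of the latter is 0 by
    translation invariance. *)
Lemma contour_shift_step e0 e1 nu omega l : admissible hbar e0 -> 0 < e1 ->
  omega_decays hbar a b n 0 nu omega ->
  exists C d, [/\ 0 <= C, 0 < d & forall E h,
    imag_between e1 e0 E -> imag_between e1 e0 (E + h *: delta_mx 0 l) ->
    `|h| <= d ->
    nc (mintegral (fun x => Phi nu omega (cont (E + h *: delta_mx 0 l) x)) -
        mintegral (fun x => Phi nu omega (cont E x))) <= C * h ^+ 2].
Proof.
move=> adm e10 dec; have [D D0 HD] := cont_dominated adm e10 dec.
have [C [d [C0 d0 H]]] := rel2_reg_integrand a b n nu omega l adm e10.
exists (2 * C * D * mass R ^+ m), d; split => //.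
  by rewrite !mulr_ge0 ?exprn_ge0 ?mass_ge0// ltW.
move=> E h EE Eh hd.
have fi := cont_mintegrable adm e10 dec EE.
have f1i := cont_mintegrable adm e10 dec Eh.
have [f2i f2E] := mintegral_affine (h *: delta_mx 0 l) ltr01 fi.
set f := fun x => Phi nu omega (cont E x) in fi f2i f2E *.
set f1 := fun x => _ in f1i *.
pose f2 x := f (x + h *: delta_mx 0 l).
have f2e : (fun x => f (1 *: x + h *: delta_mx 0 l)) = f2.
  by apply/funext => x; rewrite /f2 scale1r.
rewrite f2e in f2i f2E; rewrite invr1 expr1n mul1r in f2E.
have [g1i g1E] := mintegralB f1i fi; have [g2i g2E] := mintegralB f2i fi.
have [g3i g3E] := mintegralZ 'i g2i; have [g4i g4E] := mintegralB g1i g3i.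
have -> : mintegral f1 - mintegral f =
    mintegral (fun x => f1 x - f x - 'i * (f2 x - f x)).
  by rewrite g4E g3E g2E g1E f2E subrr mulr0 subr0.
rewrite (_ : _ * h ^+ 2 = 2 * C * D * h ^+ 2 * mass R ^+ m); last by ring.
apply: mintegral_le => // x.
have [A AC K] := H _ (strip_cont x EE).
have [|r1 r1E k1] := K ('i * h%:C); first by rewrite normcM nc_i mul1r nc_real.
have [|r2 r2E k2] := K h%:C; first by rewrite nc_real.
rewrite /f1 cont_moveIm r1E /f2 /f cont_moveRe r2E.
set z := Phi nu omega _.
(* the linear terms cancel: A is a complex derivative *)
have -> : z * r1 - z - 'i * (z * r2 - z) =
    z * ((r1 - 1 - A * ('i * h%:C)) - 'i * (r2 - 1 - A * h%:C)) by ring.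
move: k1 k2; rewrite [nc ('i * h%:C)]normcM nc_i mul1r nc_real real_normK ?num_real// => k1 k2.
rewrite normcM mulrC.
apply: (@le_trans _ _ (2 * C * h ^+ 2 * (D * \prod_k weight (x 0 k)))); last first.
  by rewrite le_eqVlt; apply/predU1P; left; ring.
apply: ler_pM; rewrite ?nc_ge0//; last exact: HD.
apply: le_trans (ncB _ _) _; rewrite [nc ('i * (_ - _))]normcM nc_i mul1r; lra.
Qed.

Lemma contour_move_coord e0 e1 nu omega l E E' :
  admissible hbar e0 -> 0 < e1 -> omega_decays hbar a b n 0 nu omega ->
  imag_between e1 e0 E -> imag_between e1 e0 E' ->
  (forall k, k != l -> E 0 k = E' 0 k) ->
  mintegral (fun x => Phi nu omega (cont E x)) =
  mintegral (fun x => Phi nu omega (cont E' x)).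
Proof.
move=> adm e10 dec; have [C [d [C0 d0 H]]] := contour_shift_step l adm e10 dec.
have W E1 E2 : E1 0 l <= E2 0 l -> imag_between e1 e0 E1 ->
    imag_between e1 e0 E2 -> (forall k, k != l -> E1 0 k = E2 0 k) ->
    mintegral (fun x => Phi nu omega (cont E1 x)) =
    mintegral (fun x => Phi nu omega (cont E2 x)).
  move=> le12 B1 B2 E12.
  pose Et t := E1 + t *: delta_mx 0 l.
  pose phi t := mintegral (fun x => Phi nu omega (cont (Et t) x)).
  have EtE t k : Et t 0 k = E1 0 k + t * (k == l)%:R by rewrite !mxE.
  have phi0 : phi 0 = mintegral (fun x => Phi nu omega (cont E1 x)).
    by rewrite /phi /Et scale0r addr0.
  have phiL : phi (E2 0 l - E1 0 l) = mintegral (fun x => Phi nu omega (cont E2 x)).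
    rewrite /phi (_ : Et _ = E2)//; apply/rowP => k; rewrite EtE.
    have [->|kl] := eqVneq k l; first by rewrite mulr1 addrC subrK.
    by rewrite mulr0 addr0 E12.
  have Bt t : 0 <= t <= E2 0 l - E1 0 l -> imag_between e1 e0 (Et t).
    move=> /andP[t1 t2] k; rewrite EtE; have [->|kl] := eqVneq k l.
      by have /andP[] := B1 l; have /andP[] := B2 l; rewrite mulr1; lra.
    by rewrite mulr0 addr0; exact: B1.
  rewrite -phi0 -phiL; apply/eqP; rewrite eq_sym -subr_eq0; apply/eqP/eq0_normc.
  apply/eqP; rewrite eq_le nc_ge0 andbT.
  have := @subdivision R phi (fun=> 0) 0 C d 0 0 (E2 0 l - E1 0 l).
  rewrite subr0 mulr0 mul0r subr0; apply=> //; first by rewrite subr_ge0.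
    by move=> t _; rewrite ?subrr ?normc0.
  move=> t h t0 tv /andP[h0 hd]; rewrite ?mulr0 ?subr0 /phi.
  have -> : Et (t + h) = Et t + h *: delta_mx 0 l by rewrite /Et scalerDl addrA.
  apply: H; [apply: Bt; lra | | by rewrite ger0_norm].
  by rewrite (_ : _ + _ = Et (t + h)); [apply: Bt; lra | rewrite /Et scalerDl addrA].
move=> B1 B2 E12; have [h|h] := leP (E 0 l) (E' 0 l); first exact: (W _ _ h B1 B2 E12).
by apply/esym/W => //; [exact: ltW | move=> k /E12].
Qed.

Definition qplI nu (e : R) omega :=
  mintegral (fun x => Phi nu omega (cont (const_mx e) x)).

(** The coordinates of the contour are moved one after the other. *)
Lemma qplI_indep e0 nu omega e e' : admissible hbar e0 ->
  omega_decays hbar a b n 0 nu omega -> 0 < e <= e0 -> 0 < e' <= e0 ->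
  qplI nu e omega = qplI nu e' omega.
Proof.
move=> adm dec /andP[e_0 ee] /andP[e'0 e'e].
pose e1 := Num.min e e'; have e10 : 0 < e1 by rewrite lt_min e_0.
have i1 : e1 <= e <= e0 by rewrite ge_min lexx.
have i2 : e1 <= e' <= e0 by rewrite ge_min lexx orbT.
(* the first j coordinates are already on the new contour *)
pose E j : 'rV[R]_m := \row_k (if (k < j)%N then e' else e).
have BE j : imag_between e1 e0 (E j) by move=> k; rewrite mxE; case: ifP.
have -> : qplI nu e omega = mintegral (fun x => Phi nu omega (cont (E 0%N) x)).
  by rewrite /qplI (_ : const_mx e = E 0%N)//; apply/rowP => k; rewrite !mxE.
have -> : qplI nu e' omega = mintegral (fun x => Phi nu omega (cont (E m) x)).
  rewrite /qplI (_ : const_mx e' = E m)//; apply/rowP => k.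
  by rewrite !mxE ltn_ord.
suff H j : (j <= m)%N -> mintegral (fun x => Phi nu omega (cont (E 0%N) x)) =
    mintegral (fun x => Phi nu omega (cont (E j) x)) by exact: H.
elim: j => [//|j IH] jm; rewrite IH 1?ltnW//.
apply: (@contour_move_coord e0 e1 _ _ (Ordinal jm)) => // k kj; rewrite !mxE.
have kj' : nat_of_ord k != j by [].
by rewrite ltnS (leq_eqVlt k j) (negbTE kj').
Qed.

Lemma reg_integrand0 omega p :
  Phi (fun=> 0%N) omega p = qpl_integrand hbar a b n omega p.
Proof. by rewrite /reg_integrand big1 ?mulr1// => k _; rewrite expr0. Qed.

Lemma map_contE (e : R) (x : 'rV[R]_m) :
  map_mx (fun t => (t +i* e : CC R)) x = cont (const_mx e) x.
Proof. by apply/rowP => k; rewrite !mxE. Qed.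

(** The contour integral is the limit of a function of e that is constant for
    small e > 0. *)
Lemma qplE e0 omega e : admissible hbar e0 -> qpl_dom hbar a b omega ->
  0 < e <= e0 ->
  qpl hbar a b n omega =
  'i ^ (\sum_(k < m) n k - m%:Z) * qplI (fun=> 0%N) e omega.
Proof.
move=> adm dom ee; congr (_ * _); rewrite /contour_integral.
have [e00 _ _] := adm.
have dec : omega_decays hbar a b n 0 (fun=> 0%N) omega.
  by move=> k; left; exact: dom.
apply: norm_lim_near_cst; near=> t.
have -> : mintegral (fun x : 'rV_m => qpl_integrand hbar a b n omega
   (map_mx (fun s => s +i* t) x)) = qplI (fun=> 0%N) t omega.
  congr mintegral; apply/funext => x.
  by rewrite map_contE reg_integrand0.
apply: (qplI_indep adm) => //; apply/andP; split.
  by near: t; exact: nbhs_right_gt.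
by near: t; exact: nbhs_right_le.
Unshelve. all: by end_near. Qed.

End Independence.

(** * Splitting of sh at a multiple of the argument *)

Section Split.
Variable R : realType.
Implicit Types x p q : CC R.

Lemma sh0 : sh (0 : CC R) = 0.
Proof. by rewrite /sh oppr0 subrr. Qed.

(** The terms on the right telescope: sh x * exp (2 x c_i) is the difference of
    exp (x (2 j - N)) at j = i + 1 and at j = i. *)
Lemma sh_mul x N : (0 < N)%N ->
  sh (N%:R * x) = sh x * \sum_(i < N) cexp (2 * x * centered R i).
Proof.
move=> N0; rewrite mulr_sumr.
pose f (j : nat) := cexp (x * (j%:R * 2 - N%:R)).
transitivity (\sum_(0 <= i < N) (f i.+1 - f i)); last first.
  rewrite big_mkord; apply: eq_bigr => i _.
  rewrite /sh mulrBl -!cexpD /f /centered; congr (cexp _ - cexp _).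
    by rewrite -natr1; field.
  by field.
rewrite telescope_sumr// /sh /f; congr (cexp _ - cexp _).
  by ring.
by rewrite mul0r; ring.
Qed.

(** The case x = 0 holds by the convention 0^-1 = 0; it occurs for hbar = 0. *)
Lemma sh_mulV x N : (0 < N)%N -> sh (N%:R * x) != 0 \/ x = 0 ->
  (sh x)^-1 = (sh (N%:R * x))^-1 * \sum_(i < N) cexp (2 * x * centered R i).
Proof.
move=> N0 [h|->]; last by rewrite mulr0 sh0 invr0 mul0r.
move: h; rewrite (sh_mul x N0) mulf_eq0 negb_or => /andP[h1 h2].
by rewrite invfM -mulrA mulVf// mulr1.
Qed.

Lemma cexp_family m (c : 'I_m -> nat) (N : nat) (x : 'I_m -> CC R)
    (f : qpl_family c N) k :
  cexp (x k * family_sum R f k) =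
  \prod_(j < c k) cexp (x k * centered R (f (existT _ k j))).
Proof. by rewrite /family_sum mulr_sumr cexp_sum. Qed.

(** A family indexed by the pairs (k, j) is a choice in each factor of each
    power, so this is the expansion of the product of powers of sums. *)
Lemma sum_families m (c : 'I_m -> nat) (N : nat) (x : 'I_m -> CC R) :
  \sum_(f : qpl_family c N) \prod_k cexp (x k * family_sum R f k) =
  \prod_k (\sum_(i < N) cexp (x k * centered R i)) ^+ c k.
Proof.
transitivity (\sum_(f : qpl_family c N) \prod_(p : {k : 'I_m & 'I_(c k)})
    cexp (x (tag p) * centered R (f p))).
  apply: eq_bigr => f _.
  rewrite (eq_bigr _ (fun k _ => cexp_family x f k)).
  rewrite (@sig_big_dep _ _ _ 'I_m (fun k => 'I_(c k)) (fun=> true) (fun _ _ => true)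
     (fun k j => cexp (x k * centered R (f (existT _ k j)))))/=.
  by apply: eq_bigr => -[k j] _.
rewrite -(@bigA_distr_bigA _ _ _ _ _ _ _ (fun u i => cexp (x (tag u) * centered R i)))/=.
rewrite -(@sig_big_dep _ _ _ 'I_m (fun k => 'I_(c k)) (fun=> true) (fun _ _ => true)
   (fun k j => \sum_(i < N) cexp (x k * centered R i)))/=.
by apply: eq_bigr => k _; rewrite prodr_const card_ord.
Qed.

Lemma family_sum_real m (c : 'I_m -> nat) (N : nat) (f : qpl_family c N) k :
  (0 < N)%N ->
  exists t : R, family_sum R f k = t%:C /\ `|t| <= (c k)%:R * ((N%:R - 1) / 2).
Proof.
move=> N0; pose g (i : 'I_N) : R := (1 - N%:R) / 2 + i%:R.
have cE i : centered R i = (g i)%:C.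
  by rewrite /centered /g rmorphD rmorphM /= fmorphV rmorphB !rmorph_nat /= rmorph1.
exists (\sum_(j < c k) g (f (existT _ k j))); split.
  by rewrite /family_sum rmorph_sum; apply: eq_bigr.
apply: le_trans (ler_norm_sum _ _ _) _.
apply: (@le_trans _ _ (\sum_(j < c k) ((N%:R - 1) / 2))).
  apply: ler_sum => j _; rewrite ler_norml /g.
  set i := f _; have : (i : nat)%:R <= N%:R - 1 :> R.
    by rewrite lerBrDr natr1 ler_nat.
  have : 0 <= (i : nat)%:R :> R by [].
  by move: (N%:R : R) ((i : nat)%:R : R) => A B; lra.
by rewrite sumr_const card_ord mulr_natl.
Qed.

Lemma admissible_neq0 (hbar : CC R) e0 p : admissible hbar e0 ->
  0 < complex.Im p <= e0 ->
  sh (pi%:C * p) != 0 /\ (hbar != 0 -> sh (pi%:C * hbar * p) != 0).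
Proof.
move=> [_ _ H] /andP[p0 pe]; have [C C0 K] := H _ p0.
have := K p; rewrite lexx pe => /(_ isT)[h1 h2].
have N (x : CC R) : expR `|complex.Re x| <= C * nc (sh x) -> sh x != 0.
  by apply: contraTneq => ->; rewrite normc0 mulr0 -ltNge expR_gt0.
by split=> [|/h2]; exact: N.
Qed.

End Split.

(** * The distribution relation for integrals *)

Section KernelIdentities.
Variables (R : realType) (hbar : CC R).
Implicit Types q w : CC R.

Let i2 : 'i * 'i = -1 :> CC R.
Proof. by rewrite -(sqr_i R) expr2. Qed.

Lemma qpl_kernelDr a b q w u :
  qpl_kernel hbar a b q (w + u) =
  qpl_kernel hbar a b q w * cexp (- ('i * q * u)).
Proof. by rewrite /qpl_kernel mulrDr opprD cexpD mulrAC. Qed.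

Lemma exponent_zeta q c N A : (0 < N)%N ->
  - ('i * q * (2 * pi%:C * 'i * c / N%:R * A)) =
  2 * (pi%:C * c * (N%:R^-1 * q)) * A :> CC R.
Proof.
move=> N0.
have -> : - ('i * q * (2 * pi%:C * 'i * c / N%:R * A)) =
  - ('i * 'i) * (2 * (pi%:C * c * (N%:R^-1 * q)) * A) :> CC R by ring.
by rewrite i2 opprK mul1r.
Qed.

Lemma kernel_distribution e0 r s a b q w : (0 < r)%N -> (0 < s)%N ->
  admissible hbar e0 -> 0 < complex.Im q <= e0 ->
  qpl_kernel (r%:R / s%:R * hbar) a b (r%:R^-1 * q) (r%:R * w) =
  qpl_kernel hbar a b q w *
  (\sum_(i < r) cexp (2 * (pi%:C * 1 * (r%:R^-1 * q)) * centered R i)) ^+ a *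
  (\sum_(i < s) cexp (2 * (pi%:C * hbar * (s%:R^-1 * q)) * centered R i)) ^+ b.
Proof.
move=> r0 s0 adm qe; have [h1 h2] := admissible_neq0 adm qe.
have rn0 : r%:R != 0 :> CC R by rewrite pnatr_eq0 -lt0n.
have sn0 : s%:R != 0 :> CC R by rewrite pnatr_eq0 -lt0n.
rewrite /qpl_kernel; have -> : 'i * (r%:R^-1 * q) * (r%:R * w) = 'i * q * w :> CC R.
  by field.
have -> : pi%:C * (r%:R / s%:R * hbar) * (r%:R^-1 * q) =
    pi%:C * hbar * (s%:R^-1 * q) :> CC R by field; rewrite sn0.
have e1 : r%:R * (pi%:C * (r%:R^-1 * q)) = pi%:C * q :> CC R by field.
have e2 : s%:R * (pi%:C * hbar * (s%:R^-1 * q)) = pi%:C * hbar * q :> CC R by field.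
have k1 := @sh_mulV R (pi%:C * (r%:R^-1 * q)) r r0.
rewrite e1 in k1; have {}k1 := k1 (or_introl h1).
have k2 := @sh_mulV R (pi%:C * hbar * (s%:R^-1 * q)) s s0.
rewrite e2 in k2.
have {}k2 : (sh (pi%:C * hbar * (s%:R^-1 * q)))^-1 = (sh (pi%:C * hbar * q))^-1 *
    \sum_(i < s) cexp (2 * (pi%:C * hbar * (s%:R^-1 * q)) * centered R i).
  apply: k2; have [->|h0] := eqVneq hbar 0; last by left; exact: h2.
  by right; rewrite mulr0 mul0r.
rewrite mulr1; move: k1 k2 {e1 e2 h1 h2}.
move: (sh (pi%:C * (r%:R^-1 * q))) (sh (pi%:C * hbar * (s%:R^-1 * q))) => A B.
move: (sh (pi%:C * q)) (sh (pi%:C * hbar * q)) => A' B'.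
move: (\sum_(i < r) _) (\sum_(i < s) _) => F G k1 k2.
rewrite !invfM -!exprVn k1 k2 !exprMn !exprVn !mulrA.
by congr (_ * _); rewrite -!mulrA; congr (_ * (_ * _)); rewrite mulrC.
Qed.

End KernelIdentities.

Section Distribution.
Variables (R : realType) (hbar : CC R) (r s m : nat).
Hypotheses (r0 : (0 < r)%N) (s0 : (0 < s)%N).
Variables (a b : 'I_m -> nat) (n : 'I_m -> int) (nu : 'I_m -> nat).
Variable e0 : R.
Hypothesis adm : admissible hbar e0.

Local Notation hbar' := (r%:R / s%:R * hbar).

Let rn0 : r%:R != 0 :> CC R.
Proof. by rewrite pnatr_eq0 -lt0n. Qed.

Lemma prod_exprz (c : CC R) : c != 0 -> \prod_k c ^ n k = c ^ (\sum_k n k).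
Proof.
move=> c0; apply/esym/(big_morph (fun z : int => c ^ z)) => //.
by move=> x y; rewrite expfzDr.
Qed.

Lemma integrand_distribution omega (q : 'rV[CC R]_m) :
  (forall k, 0 < complex.Im (q 0 k) <= e0) ->
  reg_integrand hbar' a b n nu (r%:R *: omega) (r%:R^-1 *: q) =
  r%:R ^ (\sum_k n k) * r%:R ^+ (\sum_k nu k) *
  \sum_(alpha : qpl_family a r) \sum_(beta : qpl_family b s)
    reg_integrand hbar a b n nu (zeta hbar alpha beta omega) q.
Proof.
move=> qe.
pose Y k := qpl_kernel hbar (a k) (b k) (q 0 k) (omega 0 k) /
  (\sum_(j < m | (j <= k)%N) q 0 j) ^ n k * ('i / q 0 k) ^+ nu k.
pose xa k : CC R := 2 * (pi%:C * 1 * (r%:R^-1 * q 0 k)).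
pose xb k : CC R := 2 * (pi%:C * hbar * (s%:R^-1 * q 0 k)).
have E1 : reg_integrand hbar' a b n nu (r%:R *: omega) (r%:R^-1 *: q) =
  \prod_k (r%:R ^ n k * r%:R ^+ nu k * Y k *
    ((\sum_(i < r) cexp (xa k * centered R i)) ^+ a k *
     (\sum_(i < s) cexp (xb k * centered R i)) ^+ b k)).
  rewrite /reg_integrand /qpl_integrand -big_split; apply: eq_bigr => k _ /=.
  rewrite !mxE (kernel_distribution _ _ _ r0 s0 adm (qe k)).
  have -> : \sum_(j < m | (j <= k)%N) (r%:R^-1 *: q) 0 j =
      r%:R^-1 * \sum_(j < m | (j <= k)%N) q 0 j.
    by rewrite mulr_sumr; apply: eq_bigr => j _; rewrite mxE.
  have -> : 'i / (r%:R^-1 * q 0 k) = r%:R * ('i / q 0 k) :> CC R.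
    by rewrite invfM invrK mulrCA.
  rewrite expfzMl invfM exprMn exprz_inv invr_expz opprK /Y /xa /xb.
  ring.
have E2 (alpha : qpl_family a r) (beta : qpl_family b s) : reg_integrand hbar a b n nu (zeta hbar alpha beta omega) q =
  \prod_k Y k * ((\prod_k cexp (xa k * family_sum R alpha k)) *
                  \prod_k cexp (xb k * family_sum R beta k)).
  rewrite /reg_integrand /qpl_integrand -!big_split; apply: eq_bigr => k _ /=.
  have := exponent_zeta (q 0 k) 1 (family_sum R alpha k) r0; rewrite mulr1 => Ea.
  rewrite mxE !qpl_kernelDr. rewrite Ea exponent_zeta// /Y /xa /xb; ring.
clearbody Y xa xb.
rewrite E1 !big_split /= prod_exprz// -expr_sum -!mulrA; congr (_ * (_ * _)).
transitivity (\sum_(alpha : qpl_family a r) \sum_(beta : qpl_family b s)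
  \prod_k Y k * ((\prod_k cexp (xa k * family_sum R alpha k)) *
                  \prod_k cexp (xb k * family_sum R beta k))); last first.
  by apply: eq_bigr => alpha _; apply: eq_bigr => beta _; rewrite E2.
under [RHS]eq_bigr do rewrite -!mulr_sumr.
by rewrite -mulr_sumr -mulr_suml !sum_families.
Qed.

Lemma nat_complexE N : N%:R = (N%:R : R)%:C :> CC R.
Proof. by rewrite (rmorph_nat (real_complex R)). Qed.

Lemma Re_hbar' : complex.Re hbar' = r%:R / s%:R * complex.Re hbar.
Proof. by rewrite !nat_complexE -fmorphV -rmorphM Re_realM. Qed.

(** The imaginary part of a sum of a_k centred values times 2 pi i / r is at most
    pi a_k (r - 1) / r, and similarly for beta; the total is exactly the amount by
    which the width for hbar exceeds 1 / r times the width for (r/s) hbar. Hence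
    zeta lies in the domain as soon as r omega does, and in the closed domain
    likewise. *)
Lemma Im_zeta omega (alpha : qpl_family a r) (beta : qpl_family b s) k :
  r%:R * `|complex.Im (zeta hbar alpha beta omega 0 k)| <=
  `|complex.Im ((r%:R *: omega) 0 k)| + r%:R * qpl_width hbar a b k -
  qpl_width hbar' a b k.
Proof.
have [A [EA hA]] := family_sum_real R alpha k r0.
have [B [EB hB]] := family_sum_real R beta k s0.
have pi0 := pi_gt0 R.
have r1 : 0 < r%:R :> R by rewrite ltr0n.
have s1 : 0 < s%:R :> R by rewrite ltr0n.
have -> : complex.Im (zeta hbar alpha beta omega 0 k) = complex.Im (omega 0 k) +
    2 * pi / r%:R * A + 2 * pi / s%:R * complex.Re hbar * B.
  rewrite mxE EA EB.
  have -> : 2 * pi%:C * 'i / r%:R * A%:C = (2 * pi / r%:R * A)%:C * 'i :> CC R.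
    by rewrite !rmorphM /= fmorphV !rmorph_nat; ring.
  have -> : 2 * pi%:C * 'i * hbar / s%:R * B%:C =
     (2 * pi / s%:R * B)%:C * ('i * hbar) :> CC R.
    by rewrite !rmorphM /= fmorphV !rmorph_nat; ring.
  rewrite !(raddfD (@complex.Im R)) /= !Im_realM [complex.Im ('i * _)](_ : _ = complex.Re hbar).
    by rewrite /=; ring.
  by case: (hbar) => ? ? /=; rewrite mul0r add0r mul1r.
rewrite /qpl_width Re_hbar' mxE nat_complexE Im_realM !normrM normfV.
rewrite !(gtr0_norm r1) (gtr0_norm s1) -[X in X * _ <= _](gtr0_norm r1) -normrM.
set y := complex.Im _; set h := complex.Re hbar.
have -> : r%:R * (y + 2 * pi / r%:R * A + 2 * pi / s%:R * h * B) =
  r%:R * y + 2 * pi * A + 2 * pi * r%:R / s%:R * h * B.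
  by field; rewrite !gt_eqF.
apply: le_trans (ler_normD _ _) _.
apply: le_trans (lerD (ler_normD _ _) (lexx _)) _.
rewrite !normrM normfV !normr_nat !(gtr0_norm pi0).
have hA' : 2 * pi * `|A| <= 2 * pi * ((a k)%:R * ((r%:R - 1) / 2)).
  by rewrite ler_wpM2l// mulr_ge0// ltW.
have hB' : 2 * pi * r%:R / s%:R * `|h| * `|B| <=
    2 * pi * r%:R / s%:R * `|h| * ((b k)%:R * ((s%:R - 1) / 2)).
  rewrite ler_wpM2l// !mulr_ge0 ?invr_ge0// ltW//.
have -> : r%:R * `|y| + r%:R * (pi * ((a k)%:R + (b k)%:R * `|h|)) -
    pi * ((a k)%:R + (b k)%:R * (r%:R / s%:R * `|h|)) =
  r%:R * `|y| + 2 * pi * ((a k)%:R * ((r%:R - 1) / 2)) +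
  2 * pi * r%:R / s%:R * `|h| * ((b k)%:R * ((s%:R - 1) / 2)).
  by field; rewrite gt_eqF.
by apply: lerD => //; rewrite lerD2l.
Qed.

Lemma decays_zeta M omega (alpha : qpl_family a r) (beta : qpl_family b s) :
  omega_decays hbar' a b n M nu (r%:R *: omega) ->
  omega_decays hbar a b n M nu (zeta hbar alpha beta omega).
Proof.
have r1 : 0 < r%:R :> R by rewrite ltr0n.
move=> h k; have := Im_zeta omega alpha beta k.
case: (h k) => [hk|[hk hn]] K; [left|right; split => //].
  by rewrite -(ltr_pM2l r1); lra.
by rewrite -(ler_pM2l r1); lra.
Qed.

(** The integral over R + i e / r becomes an integral over R + i e by the
    substitution p = q / r, which contributes r^(- m). *)
Lemma qplI_distribution omega e : 0 < e <= e0 ->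
  omega_decays hbar' a b n 0 nu (r%:R *: omega) ->
  qplI hbar' a b n nu (e / r%:R) (r%:R *: omega) =
  r%:R ^ (\sum_k n k - m%:Z) * r%:R ^+ (\sum_k nu k) *
  \sum_(alpha : qpl_family a r) \sum_(beta : qpl_family b s)
    qplI hbar a b n nu e (zeta hbar alpha beta omega).
Proof.
move=> /andP[e_gt0 ee0] dec.
have r1 : 0 < r%:R :> R by rewrite ltr0n.
have Ee : imag_between e e0 (const_mx e : 'rV[R]_m).
  by move=> k; rewrite mxE lexx.
pose F (alpha : qpl_family a r) (beta : qpl_family b s) x :=
  reg_integrand hbar a b n nu (zeta hbar alpha beta omega) (cont (const_mx e) x).
have Fi alpha beta : mintegrable (F alpha beta).
  exact: (cont_mintegrable adm e_gt0 (decays_zeta alpha beta dec) Ee).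
have [Gi GE] : mintegrable (fun x => \sum_alpha \sum_beta F alpha beta x) /\
    mintegral (fun x => \sum_alpha \sum_beta F alpha beta x) =
    \sum_alpha \sum_beta mintegral (F alpha beta).
  have H alpha := @mintegral_sum R m _ (index_enum (qpl_family b s)) xpredT
    (F alpha) (fun beta _ => Fi alpha beta).
  have [Hi HE] := @mintegral_sum R m _ (index_enum (qpl_family a r)) xpredT
    (fun alpha x => \sum_beta F alpha beta x) (fun alpha _ => (H alpha).1).
  by split=> //; rewrite HE; apply: eq_bigr => alpha _; exact: (H alpha).2.
pose c : CC R := r%:R ^ (\sum_k n k) * r%:R ^+ (\sum_k nu k).
have [Ci CE] := mintegralZ c Gi.
have [_ AE] := mintegral_affine 0 r1 Ci.
have -> : qplI hbar' a b n nu (e / r%:R) (r%:R *: omega) =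
    mintegral (fun x => c * \sum_alpha \sum_beta F alpha beta (r%:R *: x + 0)).
  congr mintegral; apply/funext => x; rewrite addr0 -integrand_distribution.
    congr reg_integrand; apply/rowP => k; rewrite !mxE /= nat_complexE -fmorphV.
    have rr0 : r%:R != 0 :> R by rewrite gt_eqF.
    by apply/eqP; rewrite eq_complex /= !mul0r subr0 addr0 mulKf// mulrC !eqxx.
  by move=> k; rewrite Im_cont mxE e_gt0.
rewrite AE CE GE mulrA; congr (_ * _).
have -> : (r%:R^-1 : R)%:C = r%:R^-1 :> CC R by rewrite fmorphV rmorph_nat.
rewrite /c mulrA expfzDr//; congr (_ * _).
by rewrite mulrC exprVn -exprnN.
Qed.

End Distribution.

Lemma common_contour (R : realType) (hbar : CC R) (r s : nat) : (0 < r)%N ->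
  exists e0 e0' e : R, [/\ admissible hbar e0,
    admissible (r%:R / s%:R * hbar) e0', 0 < e <= e0 & 0 < e / r%:R <= e0'].
Proof.
move=> r0; have [e0 adm] := admissible_exists hbar.
have [e0' adm'] := admissible_exists (r%:R / s%:R * hbar).
have [e00 _ _] := adm; have [e0'0 _ _] := adm'.
have r1 : 0 < r%:R :> R by rewrite ltr0n.
pose e := Num.min e0 (r%:R * e0').
have e_gt0 : 0 < e by rewrite lt_min e00 mulr_gt0.
have ee0 : 0 < e <= e0 by rewrite e_gt0 ge_min lexx.
have ee' : 0 < e / r%:R <= e0'.
  by rewrite divr_gt0// ler_pdivrMr// mulrC ge_min lexx orbT.
by exists e0, e0', e.
Qed.

Section FirstPart.
Variables (R : realType) (hbar : CC R) (r s m : nat).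
Hypotheses (r0 : (0 < r)%N) (s0 : (0 < s)%N).
Variables (a b : 'I_m -> nat) (n : 'I_m -> int).

Lemma qpl_distribution omega :
  qpl_dom (r%:R / s%:R * hbar) a b (r%:R *: omega) ->
  qpl (r%:R / s%:R * hbar) a b n (r%:R *: omega) =
  r%:R ^ (\sum_(k < m) n k - m%:Z) *
  \sum_(alpha : qpl_family a r) \sum_(beta : qpl_family b s)
     qpl hbar a b n (zeta hbar alpha beta omega).
Proof.
move=> dom; have [e0 [e0' [e [adm adm' ee0 ee']]]] := common_contour hbar s r0.
have dec : omega_decays (r%:R / s%:R * hbar) a b n 0 (fun=> 0%N) (r%:R *: omega).
  by move=> k; left; exact: dom.
rewrite (qplE n adm' dom ee') (qplI_distribution r0 s0 adm ee0 dec).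
rewrite (_ : r%:R ^+ _ = 1); last by rewrite big1.
rewrite mulr1 [LHS]mulrCA; apply: (congr1 (fun x => _ * x)).
rewrite mulr_sumr; apply: eq_bigr => alpha _.
rewrite mulr_sumr; apply: eq_bigr => beta _.
rewrite (qplE n adm _ ee0)// => k.
by case: (decays_zeta r0 s0 alpha beta dec k) => // -[_]; rewrite addn2.
Qed.

End FirstPart.

(** * Real power series that vanish on an interval *)

Section PowerSeries.
Variable R : realType.
Implicit Types (c : nat -> R) (M s t : R).

Definition pterm c t : nat -> R := fun d => t ^+ d * c d.

(** The coefficients of the quotient of the series c by t - s. If s is a zero of
    the series, the partial sum equals minus the tail, so that these coefficients
    decay like c. *)
Definition quot c s : nat -> R := fun k => - series (pterm c s) k.+1 / s ^+ k.+1.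

Lemma seriesS (u : nat -> R) k : series u k.+1 = series u k + u k.
Proof. by rewrite !seriesEnat /= big_nat_recr. Qed.

Lemma quot_bound c M s (a : R) : 0 < s < a -> (forall k, a ^+ k * `|c k| <= M) ->
  series (pterm c s) @ \oo --> 0 ->
  forall k, a ^+ k * `|quot c s k| <= M / (a - s).
Proof.
move=> /andP[s0 sa] cM cv k; have a0 : 0 < a by exact: lt_trans sa.
have M0 : 0 <= M by apply: le_trans (cM 0%N); rewrite expr0 mul1r.
have as0 : 0 < a - s by rewrite subr_gt0.
pose q := s / a; have q0 : 0 < q by rewrite divr_gt0.
have q1 : 0 < 1 - q by rewrite subr_gt0 ltr_pdivrMr// mul1r.
have step j : `|series (pterm c s) (k.+1 + j)%N - series (pterm c s) k.+1| <=
    M * q ^+ k.+1 * (1 - q ^+ j) / (1 - q).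
  elim: j => [|j IH]; first by rewrite addn0 subrr normr0 expr0 subrr mulr0 mul0r.
  rewrite addnS seriesS addrAC (le_trans (ler_normD _ _))//.
  have tj : `|pterm c s (k.+1 + j)%N| <= M * q ^+ (k.+1 + j).
    rewrite /pterm /q expr_div_n normrM (ger0_norm (exprn_ge0 _ (ltW s0))).
    rewrite mulrCA ler_wpM2l ?exprn_ge0 ?(ltW s0)//.
    by rewrite ler_pdivlMr ?exprn_gt0// mulrC.
  apply: le_trans (lerD IH tj) _.
  rewrite le_eqVlt; apply/predU1P; left.
  by rewrite exprD [q ^+ j.+1]exprSr; field; rewrite gt_eqF.
have bd : `|series (pterm c s) k.+1| <= M * q ^+ k.+1 / (1 - q).
  apply/ler_addgt0Pr => e e0.
  have /cvgrPdist_le /(_ _ e0) [N _ HN] := cv.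
  have := HN (k.+1 + N)%N (leq_addl _ _); rewrite /= sub0r normrN => h.
  have qj : 0 <= q ^+ N by rewrite exprn_ge0// ltW.
  have := step N; have : M * q ^+ k.+1 * (1 - q ^+ N) / (1 - q) <= M * q ^+ k.+1 / (1 - q).
    rewrite ler_wpM2r ?invr_ge0 ?(ltW q1)// ler_piMr ?mulr_ge0 ?exprn_ge0 ?(ltW q0)//.
    by rewrite lerBlDr lerDl.
  have := ler_normB (series (pterm c s) (k.+1 + N)%N)
    (series (pterm c s) (k.+1 + N)%N - series (pterm c s) k.+1).
  rewrite opprB addrC subrK; lra.
rewrite /quot normrM normrN normfV (ger0_norm (exprn_ge0 _ (ltW s0))) mulrA.
rewrite ler_pdivrMr ?exprn_gt0//.
apply: le_trans (ler_wpM2l (exprn_ge0 _ (ltW a0)) bd) _.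
rewrite le_eqVlt; apply/predU1P; left.
rewrite /q expr_div_n [a ^+ k.+1]exprS.
have ak : a ^+ k != 0 by rewrite expf_neq0// gt_eqF.
field; rewrite ak /= !gt_eqF//.
Qed.

Lemma quot0 c s : s != 0 -> c 0%N = - (s * quot c s 0%N).
Proof.
move=> s0; rewrite /quot seriesS /series /= big_geq// add0r /pterm expr0 mul1r expr1.
by field.
Qed.

Lemma quot_series c s t k : s != 0 ->
  series (pterm c t) k.+1 =
  (t - s) * series (pterm (quot c s) t) k.+1 - t ^+ k.+1 * quot c s k.
Proof.
move=> s0.
elim: k => [|k IH].
  rewrite !seriesS !seriesEnat /= !big_geq// !add0r /pterm expr0 !mul1r expr1.
  by rewrite {1}(quot0 c s0); ring.
rewrite seriesS IH [in RHS]seriesS /pterm.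
have -> : c k.+1 = quot c s k - s * quot c s k.+1.
  rewrite /quot [series _ k.+2]seriesS.
  rewrite (_ : pterm c s k.+1 = s ^+ k.+1 * c k.+1)// [s ^+ k.+2]exprS.
  have sk : s ^+ k.+1 != 0 by rewrite expf_neq0.
  by field; rewrite s0 sk.
by rewrite [t ^+ k.+2]exprS; ring.
Qed.

Lemma cvg0M (K : R) (u : nat -> R) :
  u @ \oo --> 0 -> (fun k => K * u k) @ \oo --> 0.
Proof. move=> h; have := cvgM (cvg_cst K) h; rewrite mulr0; exact. Qed.

Lemma cvg0_geometric (K x : R) : `|x| < 1 ->
  (fun k => K * x ^+ k) @ \oo --> 0.
Proof. by move=> h; apply: cvg0M; exact: cvg_expr. Qed.

Lemma quot_cvg c M s t (a : R) : 0 < s < a -> (forall k, a ^+ k * `|c k| <= M) ->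
  series (pterm c s) @ \oo --> 0 -> `|t| < a -> t != s ->
  series (pterm c t) @ \oo --> 0 -> series (pterm (quot c s) t) @ \oo --> 0.
Proof.
move=> sa cM cs ta ts ct; have qb := quot_bound sa cM cs.
have /andP[s0 sa'] := sa; have a0 : 0 < a by exact: lt_trans sa'.
have tsn0 : t - s != 0 by rewrite subr_eq0.
have sn0 : s != 0 by rewrite gt_eqF.
rewrite -cvg_shiftS /=.
have E k : series (pterm (quot c s) t) k.+1 =
    (t - s)^-1 * (series (pterm c t) k.+1 + t ^+ k.+1 * quot c s k).
  by rewrite (quot_series c t k sn0) subrK mulKf.
under eq_cvg do rewrite E.
apply: cvg0M.
suff tq : t ^+ k.+1 * quot c s k @[k --> \oo] --> 0.
  have ct' : series (pterm c t) k.+1 @[k --> \oo] --> 0.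
    by rewrite (cvg_shiftS (series (pterm c t))).
  by have := cvgD ct' tq; rewrite addr0; exact.
pose K := `|t| * (M / (a - s)).
have cq : K * (`|t| / a) ^+ k @[k --> \oo] --> (0 : R).
  apply: cvg0_geometric; rewrite ger0_norm ?divr_ge0// ?(ltW a0)//.
  by rewrite ltr_pdivrMr// mul1r.
apply/cvgrPdist_le => e e0.
have /cvgrPdist_le /(_ _ e0) [N _ HN] := cq.
exists N => // k Nk; have := HN k Nk; rewrite /= !sub0r !normrN.
apply: le_trans; apply: le_trans (ler_norm _).
rewrite /K normrM normrX exprS expr_div_n.
have -> : `|t| * (M / (a - s)) * (`|t| ^+ k / a ^+ k) =
  `|t| * `|t| ^+ k * (M / (a - s) / a ^+ k) by ring.
rewrite ler_wpM2l ?mulr_ge0 ?exprn_ge0//.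
by rewrite ler_pdivlMr ?exprn_gt0// mulrC.
Qed.

(** Each division by a zero s <= 9/8 replaces the bound M by M / (3 - s) and costs
    a factor s in the constant term, for a gain of s / (3 - s) <= 5/7. The
    quotient still vanishes on a smaller interval above 1. *)
Lemma coef0_bound N c M (d : R) : 0 < d <= 4^-1 ->
  (forall k, 3 ^+ k * `|c k| <= M) ->
  (forall t, 1 < t < 1 + d -> series (pterm c t) @ \oo --> 0) ->
  `|c 0%N| <= M * (5 / 7) ^+ N.
Proof.
elim: N c M d => [|N IH] c M d /andP[d0 d4] cM H.
  by rewrite expr0 mulr1; have := cM 0%N; rewrite expr0 mul1r.
pose s := 1 + d / 2.
have s3 : 0 < s < 3 by rewrite /s; lra.
have Hs : series (pterm c s) @ \oo --> 0 by apply: H; rewrite /s; lra.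
have sn0 : s != 0 by rewrite /s gt_eqF//; lra.
have := IH (quot c s) (M / (3 - s)) (d / 2); rewrite (quot0 c sn0).
have K1 : 0 < d / 2 <= 4^-1 by lra.
have K2 := quot_bound s3 cM Hs.
have K3 t : 1 < t < 1 + d / 2 -> series (pterm (quot c s) t) @ \oo --> 0.
  move=> t1; apply: (quot_cvg s3 cM Hs).
  - by rewrite ltr_norml; lra.
  - by rewrite lt_eqF// /s; lra.
  - by apply: H; lra.
move=> /(_ K1 K2 K3) h; rewrite normrN normrM gtr0_norm; last by rewrite /s; lra.
have s4 : 0 <= s by rewrite /s; lra.
apply: le_trans (ler_wpM2l s4 h) _.
have M0 : 0 <= M by apply: le_trans (cM 0%N); rewrite expr0 mul1r.
rewrite exprS !mulrA; apply: ler_wpM2r; first by rewrite exprn_ge0// divr_ge0.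
rewrite [s * M]mulrC -!mulrA; apply: ler_wpM2l => //.
by rewrite ler_pdivrMr; rewrite /s; lra.
Qed.

Lemma coef0_eq0 c M (d : R) : 0 < d <= 4^-1 ->
  (forall k, 3 ^+ k * `|c k| <= M) ->
  (forall t, 1 < t < 1 + d -> series (pterm c t) @ \oo --> 0) ->
  c 0%N = 0.
Proof.
move=> d4 cM H; apply/eqP; rewrite -normr_le0; apply/ler_addgt0Pr => e e0.
rewrite add0r.
have : M * (5 / 7) ^+ N @[N --> \oo] --> (0 : R).
  by apply: cvg0_geometric; rewrite ger0_norm; lra.
move=> /cvgrPdist_le /(_ _ e0) [N _ HN]; have := HN N (leqnn _).
rewrite /= sub0r normrN => h; apply: le_trans h.
by apply: le_trans (ler_norm _); exact: coef0_bound H.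
Qed.

(** The interval where the series vanishes lies beyond 1, strictly inside the disc
    of radius 3 where the coefficients are controlled: the series may be known to
    vanish only far from the centre of expansion. *)
Lemma coef_eq0 c M (d : R) : 0 < d <= 4^-1 ->
  (forall k, 3 ^+ k * `|c k| <= M) ->
  (forall t, 1 < t < 1 + d -> series (pterm c t) @ \oo --> 0) ->
  forall k, c k = 0.
Proof.
move=> d4 cM H k; elim: k c M cM H => [|k IH] c M cM H.
  exact: coef0_eq0 H.
have c0 : c 0%N = 0 by exact: coef0_eq0 H.
apply: (IH (fun j => c j.+1) (M / 3)).
  by move=> j; rewrite ler_pdivlMr// mulrAC -exprSr.
move=> t t1; have := H t t1; rewrite -cvg_shiftS /=.
have tn0 : t != 0 by rewrite gt_eqF//; lra.
have E j : series (pterm (fun j => c j.+1) t) j = t^-1 * series (pterm c t) j.+1.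
  rewrite /series /= [in RHS]big_nat_recl// [pterm c t 0](_ : _ = 0); last first.
    by rewrite /pterm c0 mulr0.
  rewrite add0r mulr_sumr.
  by apply: eq_bigr => i _; rewrite /pterm exprS -mulrA mulKf.
move=> h; under eq_cvg do rewrite E.
exact: cvg0M.
Qed.

End PowerSeries.

(** * Series of homogeneous polynomials *)

Section HomAnalytic.
Variables (R : realType) (m : nat).
Implicit Types (f : 'rV[CC R]_m -> CC R) (c h : 'rV[CC R]_m).

Definition small (e : R) h := forall j, nc (h 0 j) < e.

(** A weakening of a multivariate power series, stable under all the operations
    needed: the coefficients never have to be recombined. *)
Definition hom_series (P : nat -> 'rV[CC R]_m -> CC R) :=
  (forall d h k, exists q : {poly R[i]}, forall t, P d (h + t *: k) = q.[t]) /\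
  (forall d t h, P d (t *: h) = t ^+ d * P d h).

Definition hom_analytic f c := exists P (rho : R),
  [/\ 0 < rho, hom_series P & forall h, small rho h ->
      series (fun d => P d h : CC R) @ \oo --> f (c + h)].

Lemma analytic_hom f c : analytic_at f c -> hom_analytic f c.
Proof.
move=> [A [rho [M [rho0 AM H]]]].
pose P d h : CC R := \sum_(nu : {ffun 'I_m -> 'I_d.+1} | (\sum_(k < m) nu k == d)%N)
             A (fun l => nu l) * \prod_(k < m) h 0 k ^+ nu k.
have rhoE : rho = (complex.Re rho)%:C by rewrite RRe_real// gtr0_real.
exists P, (complex.Re rho); split.
- by move: rho0; rewrite rhoE ltcR.
- split=> [d h k|d t h].
    exists (\sum_(nu : {ffun 'I_m -> 'I_d.+1} | (\sum_(k < m) nu k == d)%N)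
       (A (fun l => nu l))%:P *
       \prod_(j < m) ((h 0 j)%:P + (k 0 j) *: 'X) ^+ nu j) => t.
    rewrite horner_sum; apply: eq_bigr => nu _.
    rewrite hornerM hornerC horner_prod; congr (_ * _); apply: eq_bigr => j _.
    by rewrite horner_exp hornerD hornerC hornerZ hornerX !mxE mulrC.
  rewrite mulr_sumr; apply: eq_bigr => nu /eqP nud.
  have -> : t ^+ d = \prod_j t ^+ nu j by rewrite -expr_sum nud.
  rewrite mulrCA -big_split; congr (_ * _).
  by apply: eq_bigr => j _; rewrite mxE exprMn.
move=> h hs; apply: H => k; rewrite rhoE normE ltcR; exact: hs.
Qed.

Lemma hom_analytic0 c : hom_analytic (fun=> 0) c.
Proof.
exists (fun _ _ => 0), 1; split; first exact: ltr01.
  split=> [d h k|d t h]; last by rewrite mulr0.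
  by exists 0 => t; rewrite horner0.
move=> h _; rewrite (_ : series _ = fun=> 0); first exact: cvg_cst.
by apply/funext => N; rewrite /series /= big1.
Qed.

Lemma hom_analyticD f g c : hom_analytic f c -> hom_analytic g c ->
  hom_analytic (fun z => f z + g z) c.
Proof.
move=> [P [r [r0 [Pp Ph] Pc]]] [Q [s [s0 [Qp Qh] Qc]]].
exists (fun d h => P d h + Q d h), (Num.min r s); split.
- by rewrite lt_min r0.
- split=> [d h k|d t h]; last by rewrite Ph Qh mulrDr.
  have [p pE] := Pp d h k; have [q qE] := Qp d h k.
  by exists (p + q) => t; rewrite hornerD pE qE.
move=> h hs; rewrite (_ : series _ = series (fun d => P d h : CC R) \+
    series (fun d => Q d h : CC R)); last first.
  by apply/funext => N; rewrite /series /= big_split.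
apply: cvgD; [apply: Pc => j|apply: Qc => j];
  by have := hs j; rewrite lt_min => /andP[].
Qed.

Lemma hom_analyticZ (a : CC R) f c : hom_analytic f c ->
  hom_analytic (fun z => a * f z) c.
Proof.
move=> [P [r [r0 [Pp Ph] Pc]]].
exists (fun d h => a * P d h), r; split; first exact: r0.
  split=> [d h k|d t h]; last by rewrite Ph mulrCA.
  by have [p pE] := Pp d h k; exists (a *: p) => t; rewrite hornerZ pE.
move=> h hs; rewrite (_ : series _ = (fun=> a) \* series (fun d => P d h : CC R)).
  by apply: cvgM; [exact: cvg_cst | exact: Pc].
by apply/funext => N; rewrite /series /= mulr_sumr.
Qed.

Lemma hom_analytic_sum (I : Type) (r : seq I) (Q : pred I)
    (F : I -> 'rV[CC R]_m -> CC R) c :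
  (forall i, Q i -> hom_analytic (F i) c) ->
  hom_analytic (fun z => \sum_(i <- r | Q i) F i z) c.
Proof.
move=> H; elim: r => [|i r IH].
  by under eq_fun do rewrite big_nil; exact: hom_analytic0.
under eq_fun do rewrite big_cons.
case: (boolP (Q i)) => Qi; last exact: IH.
exact: (@hom_analyticD (F i) (fun z => \sum_(j <- r | Q j) F j z) c (H i Qi) IH).
Qed.

Lemma hom_analytic_affine (a : CC R) v f c : a != 0 ->
  hom_analytic f (a *: c + v) -> hom_analytic (fun z => f (a *: z + v)) c.
Proof.
move=> a0 [P [r [r0 [Pp Ph] Pc]]].
have na0 : 0 < nc a.
  by rewrite lt_neqAle nc_ge0 andbT eq_sym; apply: contra_neq a0; exact: eq0_normc.
exists (fun d h => P d (a *: h)), (r / nc a); split.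
- exact: divr_gt0.
- split=> [d h k|d t h].
    have [p pE] := Pp d (a *: h) (a *: k); exists p => t.
    by rewrite -pE scalerDr !scalerA [a * t]mulrC.
  by rewrite scalerA mulrC -scalerA Ph.
move=> h hs; have -> : a *: (c + h) + v = a *: c + v + a *: h.
  by rewrite scalerDr addrAC.
by apply: Pc => j; rewrite mxE normcM mulrC -ltr_pdivlMr//; exact: hs.
Qed.

Lemma cvg_Re (u : nat -> CC R) : u @ \oo --> (0 : CC R) ->
  (fun k => complex.Re (u k)) @ \oo --> (0 : R) /\
  (fun k => complex.Im (u k)) @ \oo --> (0 : R).
Proof.
move=> /cvgrPdist_le H; split; apply/cvgrPdist_le => e e0;
  (have e0' : 0 < e%:C :> CC R by rewrite ltcR);
  have [N _ HN] := H _ e0'; exists N => // k Nk; have := HN k Nk;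
  rewrite /= !sub0r !normrN normE lecR => h; apply: le_trans h.
- exact: Re_le_nc.
- exact: Im_le_nc.
Qed.

(** Along the ray t h the terms form a power series in t, which converges at
    t = 3; its real and imaginary parts vanish for t slightly larger than 1, so
    [coef_eq0] applies. *)
Lemma line_coef_eq0 P h (e : R) : hom_series P -> 0 < e ->
  (exists l : CC R, series (fun d => P d (3 *: h) : CC R) @ \oo --> l) ->
  (forall t : R, 1 < t < 1 + e ->
     series (fun d => P d (t%:C *: h) : CC R) @ \oo --> (0 : CC R)) ->
  forall d, P d h = 0.
Proof.
move=> [_ Ph] e0 [l cl] H.
pose e' := Num.min e 4^-1.
have e'0 : 0 < e' <= 4^-1 by rewrite lt_min e0 invr_gt0 ltr0n ge_min lexx orbT.
have [M HM] : exists M : R, forall d, 3 ^+ d * nc (P d h) <= M.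
  have cP : cvgn (series (fun d => P d (3 *: h) : CC R)) by apply/cvg_ex; exists l.
  have /cvgrPdist_le /(_ 1 ltr01) [N _ HN] := cvg_series_cvg_0 cP.
  exists (1 + \sum_(d < N) 3 ^+ d * nc (P d h)) => d.
  have S0 : 0 <= \sum_(d < N) 3 ^+ d * nc (P d h).
    by apply: sumr_ge0 => i _; rewrite mulr_ge0 ?exprn_ge0 ?nc_ge0.
  have [Nd|dN] := leqP N d.
    have := HN d Nd; rewrite /= sub0r normrN normE Ph normcM ncX.
    rewrite (_ : (1 : R[i]) = 1%:C)// lecR (_ : nc (3 : CC R) = 3); first by lra.
    by rewrite (_ : (3 : CC R) = 3%:C) ?nc_real ?normr_nat// rmorph_nat.
  rewrite (bigD1 (Ordinal dN))//= addrCA lerDl addr_ge0// sumr_ge0// => i _.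
  by rewrite mulr_ge0 ?exprn_ge0 ?nc_ge0.
have ReP d (t : R) : complex.Re (P d (t%:C *: h)) = t ^+ d * complex.Re (P d h) /\
    complex.Im (P d (t%:C *: h)) = t ^+ d * complex.Im (P d h).
  rewrite Ph -rmorphXn; case: (P d h) => x y /=.
  by rewrite !mul0r subr0 addr0.
have key (phi : CC R -> R) : (forall x y, phi (x + y) = phi x + phi y) ->
    phi 0 = 0 -> (forall x, `|phi x| <= nc x) ->
    (forall d (t : R), phi (P d (t%:C *: h)) = t ^+ d * phi (P d h)) ->
    (forall u : nat -> CC R, u @ \oo --> (0 : CC R) -> phi (u k) @[k --> \oo] --> (0 : R)) ->
    forall d, phi (P d h) = 0.
  move=> phiD phi0 phile phiP phic; apply: (@coef_eq0 R _ M e') => //.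
    by move=> k; apply: le_trans (HM k); rewrite ler_wpM2l ?exprn_ge0.
  move=> t /andP[t1 te]; have {}H : series (fun d => P d (t%:C *: h) : CC R) @ \oo --> (0 : CC R).
    by apply: H; rewrite t1 (lt_le_trans te)// lerD2l ge_min lexx.
  have := phic _ H.
  rewrite (_ : (fun k => phi (series _ k)) = series (pterm (fun d => phi (P d h)) t)).
    exact.
  apply/funext => k; rewrite /series /= (big_morph phi phiD phi0).
  by apply: eq_bigr => d _; rewrite phiP.
move=> d; have hr : complex.Re (P d h) = 0.
  apply: (key (@complex.Re R)) => //; [exact: raddfD | exact: Re_le_nc | by move=> j t; exact: (ReP j t).1 | ].
  by move=> u /cvg_Re[].
have hi : complex.Im (P d h) = 0.
  apply: (key (@complex.Im R)) => //; [exact: raddfD | exact: Im_le_nc | by move=> j t; exact: (ReP j t).2 | ].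
  by move=> u /cvg_Re[].
by rewrite [LHS]complexE hr hi mulr0 addr0.
Qed.

Lemma poly_zero_seq (q : {poly R[i]}) (e : R) : 0 < e ->
  (forall t : R, 0 < t < e -> q.[t%:C] = 0) -> q = 0.
Proof.
move=> e0 H; apply/eqP; apply: contraT => q0.
pose x (j : nat) : R[i] := (e / (j.+2)%:R)%:C.
have xi : injective x.
  move=> i j /complexI /(mulfI (lt0r_neq0 e0)) /invr_inj /eqP.
  by rewrite eqr_nat => /eqP[].
have := max_poly_roots q0 (rs := map x (iota 0 (size q))).
rewrite size_map size_iota ltnn => -> //.
  apply/allP => _ /mapP[j _ ->]; apply/rootP/H.
  rewrite divr_gt0//= ltr_pdivrMr// ltr_pMr// ltr1n//.
by rewrite map_inj_uniq// iota_uniq.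
Qed.

(** A polynomial in t that vanishes for small t > 0 is 0: apply this on the line
    from c to k. *)
Lemma hom_part_eq0 P d (k : 'rV[CC R]_m) : hom_series P ->
  (exists c e, 0 < e /\ forall h, small e h -> P d (c + h) = 0) -> P d k = 0.
Proof.
move=> [Pp Ph] [c [e [e0 H]]]; have [q qE] := Pp d c (k - c).
have -> : k = c + 1 *: (k - c) by rewrite scale1r addrC subrK.
pose S := \sum_j nc ((k - c) 0 j).
have S0 : 0 <= S by apply: sumr_ge0 => j _; exact: nc_ge0.
rewrite qE (@poly_zero_seq q (e / (S + 1))) ?horner0 ?divr_gt0//; first lra.
move=> t /andP[t0 te]; rewrite -qE; apply: H => j.
rewrite mxE normcM nc_real gtr0_norm//.
rewrite ltr_pdivlMr in te; last by lra.
apply: le_lt_trans te; rewrite ler_pM2l//.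
by rewrite /S (bigD1 j)//= -addrA lerDl addr_ge0// sumr_ge0// => *; exact: nc_ge0.
Qed.

Definition real_vec h := forall j, complex.Im (h 0 j) = 0.

(** By homogeneity P d vanishes at all real vectors. Then it vanishes on the
    complex line x + t y through the real vectors x and y, in particular at
    t = i. *)
Lemma hom_part_real_eq0 P d (k : 'rV[CC R]_m) : hom_series P ->
  (exists e, 0 < e /\ forall h, real_vec h -> small e h -> P d h = 0) ->
  P d k = 0.
Proof.
move=> [Pp Ph] [e [e0 H]].
have Hr h : real_vec h -> P d h = 0.
  move=> hr; pose S := \sum_j nc (h 0 j).
  have S0 : 0 <= S by apply: sumr_ge0 => j _; exact: nc_ge0.
  pose t := e / (S + 1); have t0 : 0 < t by rewrite divr_gt0//; lra.
  have tn0 : t%:C != 0 :> CC R by rewrite eq_complex /= gt_eqF.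
  have := H (t%:C *: h); rewrite Ph => K.
  have /eqP : t%:C ^+ d * P d h = 0.
    apply: K => j; first by rewrite mxE Im_realM hr mulr0.
    rewrite mxE normcM nc_real gtr0_norm// /t mulrAC ltr_pdivrMr; last by lra.
    rewrite ltr_pM2l// /S (bigD1 j)//= -addrA ltrDl ltr_wpDl//.
    by apply: sumr_ge0 => *; exact: nc_ge0.
  by rewrite mulf_eq0 expf_eq0 (negbTE tn0) andbF => /eqP.
pose x : 'rV[CC R]_m := \row_j (complex.Re (k 0 j))%:C.
pose y : 'rV[CC R]_m := \row_j (complex.Im (k 0 j))%:C.
have [q qE] := Pp d x y.
have -> : k = x + 'i *: y.
  by apply/rowP => j; rewrite !mxE -complexE.
rewrite qE (@poly_zero_seq q 1) ?horner0// => t _; rewrite -qE; apply: Hr => j.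
by rewrite !mxE raddfD /= mulr0 mul0r !addr0.
Qed.

End HomAnalytic.

(** * The identity theorem and vanishing along a path *)

Section Identity.
Variables (R : realType) (m : nat).
Implicit Types (f : 'rV[CC R]_m -> CC R) (c h : 'rV[CC R]_m).

Definition zero_near f c := exists2 e : R, 0 < e & forall h, small e h -> f (c + h) = 0.

Lemma small_le (e e' : R) h : e <= e' -> small e h -> small e' h.
Proof. by move=> ee hs j; exact: lt_le_trans (hs j) ee. Qed.

Lemma smallD (e e' : R) h (k : 'rV[CC R]_m) :
  small e h -> small e' k -> small (e + e') (h + k).
Proof.
by move=> hs ks j; rewrite mxE; apply: le_lt_trans (ncD _ _) _; exact: ltrD.
Qed.

Lemma smallZ (e : R) (t : CC R) h (K : R) : nc t <= K -> 0 < K ->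
  small e h -> small (K * e) (t *: h).
Proof.
move=> tK K0 hs j; rewrite mxE normcM.
apply: le_lt_trans (ler_wpM2r (nc_ge0 _) tK) _.
by rewrite ltr_pM2l.
Qed.

Lemma cvg_series0 (P : nat -> 'rV[CC R]_m -> CC R) h (l : CC R) :
  (forall d, P d h = 0) -> series (fun d => P d h : CC R) @ \oo --> l -> l = 0.
Proof.
move=> P0; have -> : series (fun d => P d h : CC R) = fun=> 0.
  by apply/funext => N; rewrite /series /= big1.
move=> h1; apply: (cvg_unique (@norm_hausdorff _ (CC R)) h1).
exact: cvg_cst.
Qed.

(** All zeros considered lie in a ball of radius r / 12 around c, where the
    expansion at c has radius r, so that three times the sum of two such vectors
    is still in the domain of convergence. Vanishing near c + h1 gives the
    vanishing of every homogeneous term near h1, hence everywhere. *)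
Lemma identity_near f c : hom_analytic f c -> exists2 rho : R, 0 < rho &
  forall h1, small rho h1 -> zero_near f (c + h1) ->
  forall h, small rho h -> f (c + h) = 0.
Proof.
move=> [P [r [r0 HP Pc]]].
exists (r / 12); first by rewrite divr_gt0.
move=> h1 s1 [e e0 He] h hs.
suff P0 d k : P d k = 0.
  apply: (cvg_series0 (h := h) (fun d => P0 d h)); apply: Pc.
  by apply: small_le hs; lra.
apply: (hom_part_eq0 k HP); exists h1, (Num.min (e / 2) (r / 12)); split.
  by rewrite lt_min !divr_gt0.
move=> h2 s2; have s2e : small (e / 2) h2 by apply: small_le s2; rewrite ge_min lexx.
have s2r : small (r / 12) h2 by apply: small_le s2; rewrite ge_min lexx orbT.
have s12 : small (r / 6) (h1 + h2).
  by apply: small_le (smallD s1 s2r); lra.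
pose e' := Num.min 1 (e / (2 * r)).
have e'0 : 0 < e' by rewrite lt_min ltr01 divr_gt0// mulr_gt0.
apply: (line_coef_eq0 HP e'0) => [|t /andP[t1 te]].
  exists (f (c + 3 *: (h1 + h2))); apply: Pc.
  have h3 : nc (3 : CC R) <= 3.
    by rewrite (_ : (3 : CC R) = (3 : R)%:C) ?nc_real ?normr_nat// rmorph_nat.
  by apply: small_le (smallZ h3 _ s12); lra.
have tt : t - 1 <= e' by lra.
have e'1 : e' <= 1 by rewrite ge_min lexx.
have t2 : t <= 2 by lra.
have <- : f (c + t%:C *: (h1 + h2)) = 0.
  have -> : c + t%:C *: (h1 + h2) = c + h1 + (h2 + (t - 1)%:C *: (h1 + h2)).
    rewrite -addrA; congr (_ + _).
    by rewrite rmorphB /= scalerBl scale1r addrA addrC subrK.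
  apply: He; have te' : (e / (2 * r)) * (r / 6) <= e / 2.
    rewrite (_ : e / (2 * r) * (r / 6) = e / 12); first by lra.
    by field; rewrite gt_eqF.
  have nt : nc (t - 1)%:C <= e / (2 * r).
    rewrite nc_real ger0_norm; last lra.
    by apply: le_trans tt _; rewrite ge_min lexx orbT.
  have k0 : 0 < e / (2 * r) by rewrite divr_gt0// mulr_gt0.
  by apply: small_le (smallD s2e (smallZ nt k0 s12)); lra.
apply: Pc; have nt : nc t%:C <= 2 by rewrite nc_real ger0_norm; lra.
by apply: small_le (smallZ nt _ s12); lra.
Qed.

Lemma identity_real f c : hom_analytic f c ->
  (exists2 e : R, 0 < e & forall h, real_vec h -> small e h -> f (c + h) = 0) ->
  zero_near f c.
Proof.
move=> [P [r [r0 HP Pc]]] [e e0 He].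
exists r => // h hs.
suff P0 d k : P d k = 0.
  by apply: (cvg_series0 (h := h) (fun d => P0 d h)); apply: Pc.
apply: (hom_part_real_eq0 k HP); exists (Num.min (e / 2) (r / 4)); split.
  by rewrite lt_min !divr_gt0.
move=> h2 hr s2.
have s2e : small (e / 2) h2 by apply: small_le s2; rewrite ge_min lexx.
have s2r : small (r / 4) h2 by apply: small_le s2; rewrite ge_min lexx orbT.
apply: (line_coef_eq0 HP ltr01) => [|t /andP[t1 te]].
  exists (f (c + 3 *: h2)); apply: Pc.
  have h3 : nc (3 : CC R) <= 3.
    by rewrite (_ : (3 : CC R) = (3 : R)%:C) ?nc_real ?normr_nat// rmorph_nat.
  by apply: small_le (smallZ h3 _ s2r); lra.
have nt : nc t%:C <= 2 by rewrite nc_real ger0_norm; lra.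
have <- : f (c + t%:C *: h2) = 0.
  apply: He => [j|]; first by rewrite mxE Im_realM hr mulr0.
  by apply: small_le (smallZ nt _ s2e); lra.
by apply: Pc; apply: small_le (smallZ nt _ s2r); lra.
Qed.

Lemma zero_near_shift f c h (e : R) : small e h ->
  (forall k, small e k -> f (c + k) = 0) -> zero_near f (c + h).
Proof.
move=> hs H; have [d d0 Hd] : exists2 d : R, 0 < d & forall j, nc (h 0 j) + d <= e.
  pose M := \big[Num.max/0]_j nc (h 0 j).
  have [m0|m0] := posnP m.
    by exists 1 => // j; have := ltn_ord j; rewrite [X in (_ < X)%N]m0.
  have e0 : 0 < e by apply: le_lt_trans (hs (Ordinal m0)); exact: nc_ge0.
  have Me : M < e by apply/bigmax_ltP; split.
  exists (e - M) => [|j]; first by rewrite subr_gt0.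
  have : nc (h 0 j) <= M by exact: le_bigmax.
  lra.
exists d => // k ks; rewrite -addrA; apply: H => j; rewrite mxE.
by apply: le_lt_trans (ncD _ _) _; apply: lt_le_trans (Hd j); rewrite ltrD2l.
Qed.

Definition path_continuous (g : R -> 'rV[CC R]_m) := forall t (e : R),
  0 <= t <= 1 -> 0 < e -> exists2 d : R, 0 < d & forall u, 0 <= u <= 1 ->
  `|u - t| < d -> small e (g u - g t).

Lemma zero_near_eq f f' c : zero_near (fun z => f z - f' z) c ->
  zero_near f c -> zero_near f' c.
Proof.
move=> [e e0 H] [e' e'0 H']; exists (Num.min e e'); first by rewrite lt_min e0.
move=> h hs; have /eqP : f (c + h) - f' (c + h) = 0.
  by apply: H; apply: small_le hs; rewrite ge_min lexx.
rewrite subr_eq0 => /eqP <-.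
by apply: H'; apply: small_le hs; rewrite ge_min lexx orbT.
Qed.

(** For u near t, the germ vanishes at u if and only if it vanishes at t. The
    supremum of the times up to which it vanishes is therefore attained and equal
    to 1. *)
Lemma germ_vanish (F : R -> 'rV[CC R]_m -> CC R) (g : R -> 'rV[CC R]_m) :
  path_continuous g ->
  (forall t, 0 <= t <= 1 -> hom_analytic (F t) (g t)) ->
  (forall t, 0 <= t <= 1 -> exists2 d : R, 0 < d & forall u, 0 <= u <= 1 ->
     `|u - t| < d -> zero_near (fun z => F u z - F t z) (g u)) ->
  zero_near (F 0) (g 0) -> zero_near (F 1) (g 1).
Proof.
move=> gc Fa Fl F0.
pose Z t := zero_near (F t) (g t).
have loc t : 0 <= t <= 1 -> exists2 d : R, 0 < d & forall u, 0 <= u <= 1 ->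
    `|u - t| < d -> (Z u <-> Z t).
  move=> t01; have [rho rho0 Hrho] := identity_near (Fa t t01).
  have [d d0 Hd] := Fl t t01; have [d' d'0 Hd'] := gc t rho t01 rho0.
  exists (Num.min d d'); first by rewrite lt_min d0.
  move=> u u01; rewrite lt_min => /andP[ud ud'].
  have su := Hd' u u01 ud'.
  have gE : g u = g t + (g u - g t) by rewrite addrC subrK.
  have L := Hd u u01 ud; split=> Zu.
    have Zt : zero_near (F t) (g t + (g u - g t)).
      by rewrite -gE; exact: zero_near_eq L Zu.
    by exists rho => // h hs; exact: (Hrho _ su Zt).
  apply: (@zero_near_eq (F t)).
    have [e e0 He] := L; exists e => // h /He.
    by move=> /eqP; rewrite subr_eq0 => /eqP ->; rewrite subrr.
  rewrite gE; apply: (zero_near_shift su).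
  apply: (Hrho 0); rewrite ?addr0// => j.
  by rewrite mxE normc0.
pose A := [set t : R | 0 <= t <= 1 /\ forall u, 0 <= u <= t -> Z u].
have A0 : A 0.
  split=> [|u /andP[u0 u1]]; first by rewrite lexx ler01.
  by have -> : u = 0 by apply/eqP; rewrite eq_le u0 u1.
have Aub : has_sup A.
  by split; [exists 0 | exists 1 => t [/andP[_]]].
pose S := sup A.
have S0 : 0 <= S by exact: (sup_upper_bound Aub).
have S1 : S <= 1 by apply: sup_le_ub; [exists 0 | move=> t [/andP[_]]].
have S01 : 0 <= S <= 1 by rewrite S0.
have [d d0 Hd] := loc S S01.
have [t [t01 tZ] tS] := sup_adherent d0 Aub.
have tS' : t <= S by exact: (sup_upper_bound Aub).
have /andP[t0 t1] := t01.
have ZS : Z S.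
  apply/(Hd t t01); last by apply: tZ; rewrite t0 lexx.
  by rewrite ltr_norml; rewrite -/S in tS; lra.
have AM : A (Num.min 1 (S + d / 2)).
  split=> [|u /andP[u0]]; first by rewrite le_min ler01 ge_min lexx /=; lra.
  rewrite le_min => /andP[u1 uS].
  have [ut|tu] := leP u t; first by apply: tZ; rewrite u0.
  apply/(Hd u) => //; first by rewrite u0.
  by rewrite ltr_norml; rewrite -/S in tS; lra.
have := sup_upper_bound Aub AM; rewrite -/S ge_min.
have -> : (S + d / 2 <= S) = false by apply/negbTE; rewrite -ltNge; lra.
rewrite orbF => S1'; have {}S1 : S = 1 by apply/eqP; rewrite eq_le S1.
by rewrite S1 in ZS.
Qed.

End Identity.

(** * The difference relation and regularity of the integrals *)

Section Difference.
Variables (R : realType) (hbar : CC R) (m : nat).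
Variables (a b : 'I_m -> nat) (n : 'I_m -> int) (nu : 'I_m -> nat) (S : {set 'I_m}).

Definition raise (k : 'I_m) : nat := (a k + (k \in S))%N.

Definition corner (E : {set 'I_m}) : 'rV[CC R]_m :=
  \row_k (if k \in S then (-1) ^+ (k \in E) * (pi%:C * 'i) else 0).

Let i2 : 'i * 'i = -1 :> CC R.
Proof. by rewrite -(sqr_i R) expr2. Qed.

(** The shifts by i pi and - i pi multiply the kernel by exp (pi q) and
    exp (- pi q), whose difference is sh (pi q). *)
Lemma kernel_difference a0 b0 (q w : CC R) : sh (pi%:C * q) != 0 ->
  qpl_kernel hbar a0.+1 b0 q (w + pi%:C * 'i) -
  qpl_kernel hbar a0.+1 b0 q (w + - (pi%:C * 'i)) = qpl_kernel hbar a0 b0 q w.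
Proof.
move=> h; rewrite !qpl_kernelDr.
have -> : - ('i * q * (pi%:C * 'i)) = pi%:C * q :> CC R.
  have -> : - ('i * q * (pi%:C * 'i)) = - ('i * 'i) * (pi%:C * q) :> CC R by ring.
  by rewrite i2 opprK mul1r.
have -> : - ('i * q * - (pi%:C * 'i)) = - (pi%:C * q) :> CC R.
  have -> : - ('i * q * - (pi%:C * 'i)) = ('i * 'i) * (pi%:C * q) :> CC R by ring.
  by rewrite i2 mulN1r.
rewrite -mulrBr -/(sh _) /qpl_kernel exprS -(mulrA (sh _)) (invfM (sh _)).
set y := (_ ^+ a0 * _)^-1; set u := sh (pi%:C * q); set z := cexp _.
by rewrite -mulrA [u^-1 * y]mulrC divfK.
Qed.

(** Expanding the product over k in S of the differences of the values at
    omega_k + i pi and omega_k - i pi gives the sum over subsets E. *)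
Lemma integrand_difference omega (q : 'rV[CC R]_m) :
  (forall k, sh (pi%:C * q 0 k) != 0) ->
  \sum_(E : {set 'I_m} | E \subset S) (-1) ^+ #|E| *
    reg_integrand hbar raise b n nu (omega + corner E) q =
  reg_integrand hbar a b n nu omega q.
Proof.
move=> hq.
pose rest (k : 'I_m) : CC R := ((\sum_(j < m | (j <= k)%N) q 0 j) ^ n k)^-1 * ('i / q 0 k) ^+ nu k.
pose K k u := qpl_kernel hbar (raise k) (b k) (q 0 k) (omega 0 k + u) * rest k.
have regE a' w : reg_integrand hbar a' b n nu w q =
    \prod_k (qpl_kernel hbar (a' k) (b k) (q 0 k) (w 0 k) * rest k).
  rewrite /reg_integrand /qpl_integrand -big_split; apply: eq_bigr => k _ /=.
  by rewrite -mulrA.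
(* F is chosen at the k in E, and it is 0 outside S: only E inside S remain *)
pose F k := if k \in S then - K k (- (pi%:C * 'i)) else 0.
pose G k := if k \in S then K k (pi%:C * 'i) else K k 0.
have -> : reg_integrand hbar a b n nu omega q = \prod_k (F k + G k).
  rewrite regE; apply: eq_bigr => k _; rewrite /F /G /K /raise.
  case: (k \in S); last by rewrite add0r addn0 addr0.
  by rewrite addn1 [RHS]addrC -mulrBl kernel_difference.
rewrite bigA_distr /= [RHS](bigID (fun E : {set 'I_m} => E \subset S))/=.
rewrite [X in _ = _ + X]big1 ?addr0 => [|E /subsetPn[k kE kS]]; last first.
  by rewrite (bigD1 k)//= kE /F (negbTE kS) mul0r.
apply: eq_bigr => E ES; rewrite regE.
have -> : (-1) ^+ #|E| = \prod_k (if k \in E then -1 else 1) :> CC R.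
  by rewrite -prodr_const [LHS]big_mkcond.
rewrite -big_split; apply: eq_bigr => k _ /=; rewrite !mxE /F /G /K.
case: (boolP (k \in E)) => kE; first by rewrite (fintype.subsetP ES _ kE) expr1 !mulN1r.
by case: (k \in S); rewrite ?expr0 !mul1r.
Qed.

Lemma qplI_difference e0 e omega : admissible hbar e0 -> 0 < e <= e0 ->
  (forall E : {set 'I_m}, E \subset S ->
     omega_decays hbar raise b n 0 nu (omega + corner E)) ->
  \sum_(E : {set 'I_m} | E \subset S) (-1) ^+ #|E| *
    qplI hbar raise b n nu e (omega + corner E) =
  qplI hbar a b n nu e omega.
Proof.
move=> adm /andP[e_gt0 ee0] dec.
have Ee : imag_between e e0 (const_mx e : 'rV[R]_m).
  by move=> k; rewrite mxE lexx.
pose Fi (E : {set 'I_m}) x := reg_integrand hbar raise b n nu (omega + corner E)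
  (cont (const_mx e) x).
have FI (E : {set 'I_m}) : E \subset S -> mintegrable (Fi E).
  by move=> /dec h; exact: (cont_mintegrable adm e_gt0 h Ee).
have H (E : {set 'I_m}) (ES : E \subset S) := mintegralZ ((-1) ^+ #|E|) (FI E ES).
have [_ HE] := @mintegral_sum R m _ (index_enum {set 'I_m}) (fun E => E \subset S)
  (fun E x => (-1) ^+ #|E| * Fi E x) (fun E ES => (H E ES).1).
transitivity (\sum_(E : {set 'I_m} | E \subset S)
  mintegral (fun x => (-1) ^+ #|E| * Fi E x)).
  by apply: eq_bigr => E ES; rewrite (H E ES).2.
rewrite -HE; congr mintegral; apply/funext => x; rewrite /Fi.
apply: integrand_difference => k.
have ke : 0 < complex.Im (cont (const_mx e) x 0 k) <= e0.
  by rewrite Im_cont mxE e_gt0.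
exact: (admissible_neq0 adm ke).1.
Qed.

End Difference.

Section Regularity.
Variables (R : realType) (hbar : CC R) (m : nat).
Variables (a b : 'I_m -> nat) (n : 'I_m -> int).
Variables (e0 e X : R) (Y : 'I_m -> R).
Hypotheses (adm : admissible hbar e0) (e_gt0 : 0 < e) (ee0 : e <= e0) (X0 : 0 <= X).
Implicit Types (omega : 'rV[CC R]_m) (nu : 'I_m -> nat).

Local Notation Phi := (@reg_integrand R hbar m a b n).
Local Notation decay := (@decays R hbar m a b n).
Local Notation I := (@qplI R hbar m a b n).

(** The estimates below are uniform on such a set. *)
Definition in_box omega := forall k,
  `|complex.Re (omega 0 k)| <= X /\ `|complex.Im (omega 0 k)| <= Y k.

Let Ee : imag_between e e0 (const_mx e : 'rV[R]_m).
Proof. by move=> k; rewrite mxE lexx. Qed.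

Lemma box_decays M nu omega : decay M nu Y -> in_box omega ->
  omega_decays hbar a b n 0 nu omega.
Proof.
move=> dec ob; apply: (decaysW (M := M)) => k; have [_ oY] := ob k.
case: (dec k) => [h|[h1 h2]]; first by left; exact: le_lt_trans h.
by right; split => //; exact: le_trans h1.
Qed.

Lemma box_mintegrable M nu omega : decay M nu Y -> in_box omega ->
  mintegrable (fun x => Phi nu omega (cont (const_mx e) x)).
Proof.
by move=> dec ob; exact: (cont_mintegrable adm e_gt0 (box_decays dec ob) Ee).
Qed.

Lemma box_dominated M nu : decay M nu Y -> exists2 C, 0 < C & forall omega x,
  in_box omega ->
  nc (Phi nu omega (cont (const_mx e) x)) * \prod_k onep (x 0 k) ^+ M <=
  C * \prod_k weight (x 0 k).
Proof.
move=> dec; have [C C0 H] := reg_integrand_dominated adm e_gt0 X0 dec.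
exists C => // omega x ob.
have := H omega (cont (const_mx e) x) (fun k => (ob k).1) (fun k => (ob k).2)
  (strip_cont x Ee).
under eq_bigr do rewrite Re_cont.
by under [X in _ <= _ * X]eq_bigr do rewrite Re_cont.
Qed.

Lemma nc_cont_le (x : 'rV[R]_m) k : nc (cont (const_mx e) x 0 k) <= onep (x 0 k).
Proof.
have [_ e01 _] := adm.
apply: le_trans (nc_le _) _; rewrite Re_cont Im_cont mxE addrC lerD2r gtr0_norm//.
exact: le_trans e01.
Qed.

Lemma onep_le_prod M (x : 'rV[R]_m) k : onep (x 0 k) ^+ M <= \prod_j onep (x 0 j) ^+ M.
Proof.
rewrite (bigD1 k)//= -[leLHS]mulr1 ler_wpM2l ?exprn_ge0 ?onep_ge0//.
elim/big_rec: _ => // j y _ y1; rewrite -[1]mulr1; apply: ler_pM => //.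
by rewrite exprn_ege1// onep_ge1.
Qed.

Definition succ_at (nu : 'I_m -> nat) (k : 'I_m) (j : 'I_m) : nat := (nu j + (j == k))%N.

Lemma integrand_succ_at nu k omega (q : 'rV[CC R]_m) : q 0 k != 0 ->
  Phi nu omega q = - ('i * q 0 k) * Phi (succ_at nu k) omega q.
Proof.
move=> q0; rewrite /reg_integrand mulrCA; congr (_ * _).
rewrite (bigD1 k)//= [in RHS](bigD1 k)//= /succ_at eqxx addn1 exprS !mulrA.
have i2 : 'i * 'i = -1 :> CC R by rewrite -(sqr_i R) expr2.
have -> : - ('i * q 0 k) * 'i / q 0 k = - ('i * 'i) * (q 0 k / q 0 k) :> CC R by ring.
rewrite i2 opprK divff// mulr1 mul1r; congr (_ * _).
by apply: eq_bigr => j /negbTE ->; rewrite addn0.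
Qed.

Lemma integrand_add nu omega (v q : 'rV[CC R]_m) :
  Phi nu (omega + v) q = cexp (\sum_k - ('i * q 0 k * v 0 k)) * Phi nu omega q.
Proof.
rewrite cexp_sum /reg_integrand [RHS]mulrA; congr (_ * _).
rewrite /qpl_integrand -big_split /=; apply: eq_bigr => k _.
by rewrite mxE qpl_kernelDr [LHS]mulrAC mulrC.
Qed.

(** The second-order error of exp (- i p_k h) costs a factor |p_k|^2; the two
    spare orders in the hypothesis pay for it, so the bound reaches the boundary
    of the domain. *)
Lemma qplI_derivative nu k : decay 2 nu Y -> exists2 C, 0 < C &
  forall omega h, in_box omega -> in_box (omega + h%:C *: delta_mx 0 k) ->
  `|h| <= 2^-1 ->
  nc (I (succ_at nu k) e (omega + h%:C *: delta_mx 0 k) - I (succ_at nu k) e omega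
      - h%:C * I nu e omega) <= C * h ^+ 2.
Proof.
move=> dec.
have dec' : decay 2 (succ_at nu k) Y.
  move=> j; case: (dec j) => [|[h1 h2]]; [by left|right; split => //].
  by apply: leq_trans h2 _; exact: leq_addr.
have [C C0 H] := box_dominated dec'; have [_ e01 _] := adm.
exists (6 * C * mass R ^+ m + 1).
  by rewrite ltr_wpDl// !mulr_ge0 ?exprn_ge0 ?mass_ge0// ltW.
move=> omega h ob ob' h2.
have f1 := box_mintegrable dec' ob'; have f2 := box_mintegrable dec' ob.
have f3 := box_mintegrable dec ob.
have [g1 E1] := mintegralB f1 f2; have [g2 E2] := mintegralZ h%:C f3.
have [g3 E3] := mintegralB g1 g2.
rewrite /qplI -E1 -E2 -E3.
apply: (@le_trans _ _ (6 * C * h ^+ 2 * mass R ^+ m)); last first.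
  by rewrite [leLHS]mulrAC [leRHS]mulrDl mul1r lerDl sqr_ge0.
apply: mintegral_le g3 _ => x.
set q := cont (const_mx e) x.
have q0 : q 0 k != 0.
  by apply: contraTneq (e_gt0) => /(congr1 (@complex.Im R)); rewrite Im_cont mxE => ->; rewrite ltxx.
have -> : Phi (succ_at nu k) (omega + h%:C *: delta_mx 0 k) q =
    cexp (- ('i * q 0 k * h%:C)) * Phi (succ_at nu k) omega q.
  rewrite integrand_add; congr (cexp _ * _).
  rewrite (bigD1 k)//= !mxE !eqxx mulr1 big1 ?addr0// => j jk.
  by rewrite !mxE (negbTE jk) !mulr0 oppr0.
rewrite (integrand_succ_at nu omega q0); set z := Phi _ _ _.
set v := - ('i * q 0 k * h%:C).
have -> : cexp v * z - z - h%:C * (- ('i * q 0 k) * z) = z * (cexp v - 1 - v).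
  by rewrite /v; ring.
have vb : nc v <= `|h| * onep (x 0 k).
  by rewrite /v ncN !normcM nc_i mul1r nc_real mulrC ler_wpM2l// nc_cont_le.
have vr : `|complex.Re v| <= 2^-1.
  have -> : complex.Re v = h * e.
    by rewrite /v /q mxE mxE /=; ring.
  rewrite normrM (gtr0_norm e_gt0); apply: le_trans h2.
  by rewrite ler_piMr// (le_trans ee0).
rewrite normcM; apply: le_trans (ler_wpM2l (nc_ge0 _) (nc_cexpB1B vr)) _.
have v2 : nc v ^+ 2 <= h ^+ 2 * \prod_j onep (x 0 j) ^+ 2.
  apply: (@le_trans _ _ ((`|h| * onep (x 0 k)) ^+ 2)).
    by rewrite lerXn2r ?nnegrE ?nc_ge0// mulr_ge0// onep_ge0.
  rewrite exprMn real_normK ?num_real// ler_wpM2l ?sqr_ge0//.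
  exact: onep_le_prod.
apply: (@le_trans _ _ (6 * h ^+ 2 * (nc z * \prod_j onep (x 0 j) ^+ 2))).
  rewrite (_ : 6 * h ^+ 2 * (nc z * _) =
    nc z * (6 * (h ^+ 2 * \prod_j onep (x 0 j) ^+ 2))); last by ring.
  by rewrite ler_wpM2l ?nc_ge0// ler_pM2l.
rewrite (_ : 6 * C * h ^+ 2 * _ = 6 * h ^+ 2 * (C * \prod_j weight (x 0 j))); last by ring.
apply: ler_wpM2l; first by rewrite mulr_ge0 ?sqr_ge0.
exact: (H omega x ob).
Qed.

Lemma qplI_continuous nu : decay 1 nu Y -> exists2 C, 0 < C &
  forall omega omega', in_box omega -> in_box omega' ->
  nc (I nu e omega - I nu e omega') <=
  C * \sum_k nc ((omega - omega') 0 k).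
Proof.
move=> dec; have [C C0 H] := box_dominated dec.
exists (6 * C * mass R ^+ m + 1).
  by rewrite ltr_wpDl// !mulr_ge0 ?exprn_ge0 ?mass_ge0// ltW.
move=> omega omega' ob ob'; set D := \sum_k _.
have D0 : 0 <= D by apply: sumr_ge0 => k _; exact: nc_ge0.
have [g E] := mintegralB (box_mintegrable dec ob) (box_mintegrable dec ob').
rewrite /qplI -E.
apply: (@le_trans _ _ (6 * C * D * mass R ^+ m)); last first.
  by rewrite [leLHS]mulrAC [leRHS]mulrDl mul1r lerDl.
apply: mintegral_le g _ => x; set q := cont _ _.
have PE w : Phi nu w q = cexp (\sum_k - ('i * q 0 k * w 0 k)) * Phi nu 0 q.
  by rewrite -integrand_add add0r.
set A := Phi nu 0 q in PE; rewrite !PE -mulrBl normcM.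
set u := \sum_k _; set u' := \sum_k _.
have uu : nc (u - u') <= D * \prod_j onep (x 0 j) ^+ 1.
  rewrite /u /u' -sumrB; apply: le_trans (nc_sum _ _ _) _.
  rewrite /D mulr_suml; apply: ler_sum => k _.
  rewrite (_ : _ - _ = - ('i * (q 0 k * (omega - omega') 0 k))); last first.
    by rewrite !mxE; ring.
  rewrite ncN !normcM nc_i mul1r mulrC ler_wpM2l ?nc_ge0//.
  by apply: le_trans (nc_cont_le _ _) _; have := onep_le_prod 1 x k; rewrite expr1.
apply: le_trans (ler_wpM2r (nc_ge0 _) (nc_cexpB _ _)) _.
have h1 := H omega x ob; have h2 := H omega' x ob'.
rewrite -/q PE -/u (normcM (cexp u)) in h1; rewrite -/q PE -/u' (normcM (cexp u')) in h2.
apply: (@le_trans _ _ (3 * D * (nc (cexp u) * nc A * \prod_k onep (x 0 k) ^+ 1 +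
   nc (cexp u') * nc A * \prod_k onep (x 0 k) ^+ 1))).
  set P := \prod_k _ in uu *.
  rewrite (_ : 3 * D * _ = 3 * (D * P) * ((nc (cexp u) + nc (cexp u')) * nc A));
    last by ring.
  rewrite -[leLHS]mulrA; apply: ler_wpM2r.
    by rewrite mulr_ge0 ?addr_ge0 ?nc_ge0.
  by rewrite ler_pM2l.
rewrite (_ : 6 * C * D * _ = 3 * D * (C * \prod_j weight (x 0 j) + C * \prod_j weight (x 0 j))); last by ring.
apply: ler_wpM2l; first by rewrite mulr_ge0.
exact: (lerD h1 h2).
Qed.

End Regularity.

(** * Finite differences and boundary values *)

Section FiniteDifference.
Variables (R : realType) (m : nat).
Implicit Types (f g : 'rV[CC R]_m -> CC R) (z v : 'rV[CC R]_m) (ks : seq 'I_m).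

Definition step (t : R) (k : 'I_m) : 'rV[CC R]_m := t%:C *: delta_mx 0 k.

Fixpoint fdiff (h : R) ks f z : CC R :=
  if ks is k :: ks' then fdiff h ks' f (z + step h k) - fdiff h ks' f z else f z.

(** Real displacements only: a finite difference stays on the same level of
    imaginary parts, in particular on the boundary of the domain. *)
Definition forward (D : R) z z' := exists t : 'rV[R]_m,
  (forall j, 0 <= t 0 j <= D) /\ z' = z + map_mx (real_complex R) t.

Lemma forward_refl D z : 0 <= D -> forward D z z.
Proof.
move=> D0; exists 0; split; first by move=> j; rewrite mxE lexx.
by rewrite map_mx0 addr0.
Qed.

Lemma forward_step D z t k : 0 <= t <= D -> forward D z (z + step t k).
Proof.
move=> /andP[t0 tD]; exists (t *: delta_mx 0 k); split.
  move=> j; rewrite !mxE /=; case: (j == k); rewrite ?mulr1 ?mulr0 ?t0//.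
  by rewrite lexx (le_trans t0).
congr (_ + _); apply/rowP => j; rewrite !mxE rmorphM /=; congr (_ * _).
by rewrite rmorph_nat.
Qed.

Lemma forward_trans D D' z y x : forward D z y -> forward D' y x ->
  forward (D + D') z x.
Proof.
move=> [t [ht ->]] [u [hu ->]]; exists (t + u); split; last by rewrite map_mxD addrA.
by move=> j; rewrite mxE; have := ht j; have := hu j; lra.
Qed.

Lemma forward_le D D' z y : D <= D' -> forward D z y -> forward D' z y.
Proof.
move=> DD [t [ht ->]]; exists t; split => // j.
by have /andP[-> h] := ht j; exact: le_trans h DD.
Qed.

Lemma forward_addr D z y v : forward D z y -> forward D (z + v) (y + v).
Proof. by move=> [t [ht ->]]; exists t; split => //; rewrite addrAC. Qed.

Lemma forward_Im D z y k : forward D z y -> complex.Im (y 0 k) = complex.Im (z 0 k).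
Proof. by move=> [t [_ ->]]; rewrite !mxE raddfD /= addr0. Qed.

Lemma forward_cons h ks k z t y : 0 <= t <= h ->
  forward ((size ks)%:R * h) (z + step t k) y ->
  forward ((size (k :: ks))%:R * h) z y.
Proof.
move=> th F; rewrite /= -natr1 mulrDl mul1r addrC.
exact: forward_trans (forward_step z k th) F.
Qed.

Lemma fdiff_ext h ks f g z : 0 <= h ->
  (forall y, forward ((size ks)%:R * h) z y -> f y = g y) ->
  fdiff h ks f z = fdiff h ks g z.
Proof.
move=> h0; elim: ks z => [|k ks IH] z H /=.
  by apply: H; apply: forward_refl; rewrite mul0r.
have hh : 0 <= h <= h by rewrite h0 lexx.
rewrite IH => [|y Hy]; last by apply: H; exact: forward_cons hh Hy.
rewrite IH // => y Hy; apply: H; apply: forward_le Hy.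
by rewrite /= ler_wpM2r// ler_nat.
Qed.

Lemma fdiff_bound h ks f z (B : R) : 0 <= h ->
  (forall y, forward ((size ks)%:R * h) z y -> nc (f y) <= B) ->
  nc (fdiff h ks f z) <= 2 ^+ size ks * B.
Proof.
move=> h0; elim: ks z => [|k ks IH] z H /=.
  by rewrite mul1r; apply: H; apply: forward_refl; rewrite mul0r.
have hh : 0 <= h <= h by rewrite h0 lexx.
apply: le_trans (ncB _ _) _.
have h1 : nc (fdiff h ks f (z + step h k)) <= 2 ^+ size ks * B.
  by apply: IH => y Hy; apply: H; exact: forward_cons hh Hy.
have h2 : nc (fdiff h ks f z) <= 2 ^+ size ks * B.
  apply: IH => y Hy; apply: H; apply: forward_le Hy.
  by rewrite /= ler_wpM2r// ler_nat.
by rewrite exprS; lra.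
Qed.

Lemma fdiffD h ks f g z :
  fdiff h ks (fun y => f y + g y) z = fdiff h ks f z + fdiff h ks g z.
Proof. by elim: ks z => [//|k ks IH] z /=; rewrite !IH opprD addrACA. Qed.

Lemma fdiffZ h ks (c : CC R) f z :
  fdiff h ks (fun y => c * f y) z = c * fdiff h ks f z.
Proof. by elim: ks z => [//|k ks IH] z /=; rewrite !IH mulrBr. Qed.

Lemma fdiffB h ks f g z :
  fdiff h ks (fun y => f y - g y) z = fdiff h ks f z - fdiff h ks g z.
Proof.
under [fun y => _]eq_fun do rewrite -[- g _]mulN1r.
by rewrite fdiffD fdiffZ mulN1r.
Qed.

Lemma fdiff_sum h ks (J : Type) (r : seq J) (P : pred J)
    (F : J -> 'rV[CC R]_m -> CC R) z :
  fdiff h ks (fun y => \sum_(i <- r | P i) F i y) z =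
  \sum_(i <- r | P i) fdiff h ks (F i) z.
Proof.
elim: ks z => [//|k ks IH] z /=.
by rewrite !IH -sumrB.
Qed.

Lemma fdiff_affine h ks (r : R) f v z :
  fdiff (r * h) ks f (r%:C *: z + v) = fdiff h ks (fun y => f (r%:C *: y + v)) z.
Proof.
elim: ks z => [//|k ks IH] z /=; rewrite -!IH; congr (fdiff _ _ _ _ - _).
by rewrite scalerDr /step scalerA -rmorphM addrAC.
Qed.

Lemma fdiff_addr h ks f v z :
  fdiff h ks f (z + v) = fdiff h ks (fun y => f (y + v)) z.
Proof.
by elim: ks z => [//|k ks IH] z /=; rewrite -!IH addrAC.
Qed.

End FiniteDifference.

Section BoundaryValue.
Variables (R : realType) (hbar : CC R) (m : nat).
Variables (a b : 'I_m -> nat) (n : 'I_m -> int).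
Variables (e0 e : R).
Hypotheses (adm : admissible hbar e0) (e_gt0 : 0 < e) (ee0 : e <= e0).
Implicit Types (z : 'rV[CC R]_m) (nu : 'I_m -> nat) (ks : seq 'I_m).

Local Notation I := (@qplI R hbar m a b n).
Local Notation W := (qpl_width hbar a b).

Definition multiplicity ks : 'I_m -> nat := foldr (fun k nu => succ_at nu k) (fun=> 0%N) ks.

(** By induction each difference is compared with h times the derivative, that is,
    the integral with one regularising factor less ([subdivision]). The bound
    involves only the variation eta of the integral without any regularising
    factor, at interior points. *)
Lemma fdiff_mean (X : R) (Y : 'I_m -> R) (c : CC R) (h eta : R) ks z :
  0 <= X -> (forall k, Y k < W k) -> 0 <= h ->
  (forall y, forward ((size ks)%:R * h) z y ->
     in_box X Y y /\ nc (I (fun=> 0%N) e y - c) <= eta) ->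
  nc (fdiff h ks (I (multiplicity ks) e) z - (h ^+ size ks)%:C * c) <= eta * h ^+ size ks.
Proof.
move=> X0 YW h0; elim: ks z => [|k ks IH] z H /=.
  have Fz : forward ((size ([::] : seq 'I_m))%:R * h) z z.
    by apply: forward_refl; rewrite mul0r.
  by rewrite mulr1 mul1r; exact: (H z Fz).2.
set nu := multiplicity ks in IH *.
have dec : decays hbar a b n 2 nu Y by move=> j; left.
have [C C0 HC] := qplI_derivative adm e_gt0 ee0 X0 k dec.
pose phi t := fdiff h ks (I (succ_at nu k) e) (z + step t k).
pose dphi t := fdiff h ks (I nu e) (z + step t k).
have p0 : fdiff h ks (I (succ_at nu k) e) z = phi 0.
  by rewrite /phi /step scale0r addr0.
rewrite p0 -/(phi h).
have := @subdivision R phi dphi ((h ^+ size ks)%:C * c) (2 ^+ size ks * C)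
  2^-1 (eta * h ^+ size ks) 0 h h0.
rewrite subr0 mulrA -rmorphM -exprS -mulrA -exprSr; apply.
- by rewrite invr_gt0.
- by rewrite mulr_ge0 ?exprn_ge0// ltW.
- by move=> t th; apply: IH => y Hy; apply: H; exact: forward_cons th Hy.
move=> t s t0 ts /andP[s0 s2]; rewrite /phi /dphi.
have st : z + step (t + s) k = z + step t k + step s k.
  by rewrite /step rmorphD scalerDl addrA.
rewrite st fdiff_addr -fdiffZ -fdiffB -fdiffB -mulrA.
apply: fdiff_bound => // y Hy.
have [by1 _] : in_box X Y y /\ nc (I (fun=> 0%N) e y - c) <= eta.
  by apply: H; apply: forward_cons Hy; lra.
have [by2 _] : in_box X Y (y + step s k) /\
    nc (I (fun=> 0%N) e (y + step s k) - c) <= eta.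
  apply: H; apply: (@forward_cons _ _ h ks k z (t + s)); first by lra.
  by rewrite st; exact: forward_addr.
by apply: HC => //; rewrite ger0_norm.
Qed.

Definition imag_dir (d : 'rV[R]_m) (t : R) : 'rV[CC R]_m :=
  \row_k ('i * (t * d 0 k)%:C).

(** The point z is approached from the interior along i t d. At z + i t d the
    finite difference is within eta h^|ks| of h^|ks| g z by [fdiff_mean]. For fixed
    h it depends continuously on t up to t = 0, since the regularised integral is
    continuous on the closed domain; so the bound persists as t tends to 0. *)
Lemma boundary_value ks z (d : 'rV[R]_m) (g : 'rV[CC R]_m -> CC R) (t0 : R) :
  0 < t0 ->
  (forall t k, 0 < t < t0 -> `|complex.Im ((z + imag_dir d t) 0 k)| < W k) ->
  (forall k, (`|complex.Im (z 0 k)| < W k /\ d 0 k = 0) \/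
             (`|complex.Im (z 0 k)| <= W k /\ (growth n + 3 <= multiplicity ks k)%N)) ->
  (forall eta : R, 0 < eta -> exists2 rho : R, 0 < rho & forall v, small rho v ->
     nc (g (z + v) - g z) <= eta) ->
  (exists2 rho : R, 0 < rho & forall v, small rho v ->
     (forall k, `|complex.Im ((z + v) 0 k)| < W k) ->
     g (z + v) = I (fun=> 0%N) e (z + v)) ->
  forall eta : R, 0 < eta -> exists2 h0 : R, 0 < h0 & forall h, 0 < h < h0 ->
  nc (fdiff h ks (I (multiplicity ks) e) z - (h ^+ size ks)%:C * g z) <= eta * h ^+ size ks.
Proof.
move=> t00 Hin Hclosed gcont [rho1 rho10 agree] eta eta0.
have [rho2 rho20 gc] := gcont eta eta0.
pose rho := Num.min 1 (Num.min rho1 rho2).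
have rho0 : 0 < rho by rewrite !lt_min ltr01 rho10.
set L := size ks; pose D : R := L%:R + 1.
have D0 : 0 < D by rewrite ltr_wpDl.
exists (rho / (2 * D)); first by rewrite divr_gt0// mulr_gt0.
move=> h /andP[h_gt0 hD].
have LD : L%:R * h <= rho / 2.
  have : D * h <= rho / 2.
    rewrite mulrC -ler_pdivlMr// (_ : rho / 2 / D = rho / (2 * D)) ?(ltW hD)//.
    by field; rewrite gt_eqF.
  by rewrite /D mulrDl; lra.
(* a common box for the boundary point and the inner points *)
pose X := (\sum_k `|complex.Re (z 0 k)|) + 1.
have S0 : 0 <= \sum_k `|complex.Re (z 0 k)| by exact: sumr_ge0.
have X0 : 0 <= X by rewrite addr_ge0.
(* bounds on imaginary parts that hold at z and on the approach to it *)
pose Y (k : 'I_m) := if (growth n + 3 <= multiplicity ks k)%N then W k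
  else `|complex.Im (z 0 k)|.
have decY : decays hbar a b n 1 (multiplicity ks) Y.
  move=> k; rewrite /Y; case: ifPn => [h3|h3]; last first.
    by left; case: (Hclosed k) => [[]//|[_]]; rewrite (negbTE h3).
  by right; split=> //; rewrite addn1 addSnnS.
have [C C0 HC] := qplI_continuous adm e_gt0 ee0 X0 decY.
have Rez k : `|complex.Re (z 0 k)| + 1 <= X.
  by rewrite lerD2r (bigD1 k)//= lerDl sumr_ge0.
have ReB y k : forward (L%:R * h) z y -> `|complex.Re (y 0 k)| <= X.
  move=> [w [hw ->]]; apply: le_trans (Rez k).
  rewrite !mxE raddfD /=; apply: le_trans (ler_normD _ _) _; rewrite lerD2l.
  have /andP[w0 wL] := hw k; rewrite ger0_norm//.
  have : rho <= 1 by rewrite ge_min lexx.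
  by lra.
have boxz y : forward (L%:R * h) z y -> in_box X Y y.
  move=> F k; split; first exact: ReB.
  rewrite (forward_Im k F) /Y; case: ifPn => // _.
  by case: (Hclosed k) => [[/ltW]|[]].
have Redir t y k : complex.Re ((y + imag_dir d t) 0 k) = complex.Re (y 0 k).
  by rewrite !mxE raddfD /= mul0r mulr0 subr0 addr0.
have boxzt t y : 0 < t < t0 -> forward (L%:R * h) z y ->
    in_box X (fun k => `|complex.Im ((z + imag_dir d t) 0 k)|) (y + imag_dir d t).
  move=> tt F k; rewrite Redir; split; first exact: ReB.
  by rewrite (forward_Im k (forward_addr (imag_dir d t) F)).
have boxzY t y : 0 < t < t0 -> forward (L%:R * h) z y -> in_box X Y (y + imag_dir d t).
  move=> tt F k; have [r1 r2] := boxzt t y tt F k; split => //.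
  apply: le_trans r2 _; rewrite /Y; case: ifPn => [_|h3]; first exact/ltW/Hin.
  case: (Hclosed k) => [[_ dk]|[_]]; last by rewrite (negbTE h3).
  by rewrite !mxE dk mulr0 mulr0 addr0.
pose M := \sum_k `|d 0 k|; have M0 : 0 <= M by exact: sumr_ge0.
apply/ler_addgt0Pr => e' e'0.
pose K := 2 ^+ L * (C * M) + 1.
have K0 : 0 < K by rewrite ltr_wpDl// !mulr_ge0 ?exprn_ge0// ltW.
(* the inner point is near z, and moving to it costs at most e' *)
pose t := Num.min (t0 / 2) (Num.min (rho / 2 / (M + 1)) (e' / K)).
have t_gt0 : 0 < t by rewrite !lt_min !divr_gt0//; lra.
have tt0 : 0 < t < t0.
  rewrite t_gt0 /=; have : t <= t0 / 2 by rewrite ge_min lexx.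
  lra.
have tM : t * M <= rho / 2 * (M / (M + 1)).
  have : t <= rho / 2 / (M + 1) by rewrite !ge_min lexx orbT.
  move=> /(ler_wpM2r M0) h1; apply: le_trans h1 _.
  by rewrite le_eqVlt; apply/predU1P; left; field; rewrite gt_eqF//; lra.
have dirsmall : forall k, nc (imag_dir d t 0 k) <= t * `|d 0 k|.
  by move=> k; rewrite mxE normcM nc_i mul1r nc_real normrM gtr0_norm.
have M1 : M / (M + 1) < 1 by rewrite ltr_pdivrMr; lra.
have near_z y : forward (L%:R * h) z y -> small rho (y + imag_dir d t - z).
  move=> [w [hw ->]] k.
  have -> : (z + map_mx (real_complex R) w + imag_dir d t - z) 0 k =
      (w 0 k)%:C + imag_dir d t 0 k by rewrite !mxE; ring.
  apply: le_lt_trans (ncD _ _) _; rewrite nc_real.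
  have /andP[w0 wL] := hw k; rewrite ger0_norm//.
  have dk : t * `|d 0 k| <= t * M.
    by rewrite ler_pM2l// /M (bigD1 k)//= lerDl sumr_ge0.
  have := dirsmall k; have : rho / 2 * (M / (M + 1)) < rho / 2.
    by rewrite gtr_pMr// divr_gt0.
  by lra.
have mean : nc (fdiff h ks (I (multiplicity ks) e) (z + imag_dir d t) -
    (h ^+ size ks)%:C * g z) <= eta * h ^+ size ks.
  apply: (@fdiff_mean X (fun k => `|complex.Im ((z + imag_dir d t) 0 k)|)) => //.
  - by move=> k; exact: Hin.
  - exact: ltW.
  move=> y F; pose y0 := y - imag_dir d t.
  have F0 : forward (L%:R * h) z y0.
    by have := forward_addr (- imag_dir d t) F; rewrite addrK.
  have yE : y = y0 + imag_dir d t by rewrite subrK.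
  split; first by rewrite yE; exact: boxzt.
  have sm := near_z y0 F0; rewrite -yE in sm.
  have yz : y = z + (y - z) by rewrite addrC subrK.
  rewrite yz -agree.
  - by apply: gc; apply: small_le sm; rewrite !ge_min lexx !orbT.
  - by apply: small_le sm; rewrite !ge_min lexx !orbT.
  - by move=> k; rewrite -yz (forward_Im k F); exact: Hin.
have cont : nc (fdiff h ks (I (multiplicity ks) e) z -
    fdiff h ks (I (multiplicity ks) e) (z + imag_dir d t)) <= 2 ^+ L * (C * (t * M)).
  rewrite fdiff_addr -fdiffB; apply: fdiff_bound; first exact: ltW.
  move=> y F; apply: le_trans (HC _ _ (boxz y F) (boxzY t y tt0 F)) _.
  rewrite ler_pM2l// /M mulr_sumr; apply: ler_sum => k _.
  rewrite (_ : (y - (y + imag_dir d t)) 0 k = - imag_dir d t 0 k).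
    by rewrite ncN.
  by rewrite !mxE opprD addrA subrr add0r.
have tK : 2 ^+ L * (C * (t * M)) <= e'.
  have : t <= e' / K by rewrite !ge_min lexx !orbT.
  rewrite ler_pdivlMr// /K => tk.
  have -> : 2 ^+ L * (C * (t * M)) = t * (2 ^+ L * (C * M)) by ring.
  by apply: le_trans tk; rewrite ler_pM2l// lerDl.
have -> : fdiff h ks (I (multiplicity ks) e) z - (h ^+ size ks)%:C * g z =
  (fdiff h ks (I (multiplicity ks) e) (z + imag_dir d t) - (h ^+ size ks)%:C * g z) +
  (fdiff h ks (I (multiplicity ks) e) z - fdiff h ks (I (multiplicity ks) e) (z + imag_dir d t)).
  by ring.
apply: le_trans (ncD _ _) _; apply: lerD => //.
exact: le_trans cont tK.
Qed.

End BoundaryValue.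

(** * Continuity of analytic germs *)

Section AnalyticLipschitz.
Variables (R : realType) (m : nat).
Implicit Types (f : 'rV[CC R]_m -> CC R) (c h : 'rV[CC R]_m).

Lemma nc_pow_le (y : CC R) (e : R) n : nc y <= e -> nc y ^+ n <= e ^+ n.
Proof.
by move=> ye; apply: lerXn2r; rewrite ?nnegrE ?nc_ge0//; exact: le_trans (nc_ge0 _) ye.
Qed.

Lemma nc_powB (x y : CC R) (e d : R) n : 0 < e -> nc x <= e -> nc y <= e ->
  nc (x - y) <= d -> nc (x ^+ n - y ^+ n) <= n%:R * e ^+ n * (d / e).
Proof.
move=> e0 xe ye xyd; elim: n => [|n IH].
  by rewrite !expr0 subrr normc0 !mul0r.
have d0 : 0 <= d by exact: le_trans (nc_ge0 _) xyd.
have -> : x ^+ n.+1 - y ^+ n.+1 = x * (x ^+ n - y ^+ n) + (x - y) * y ^+ n.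
  by rewrite !exprS; ring.
apply: le_trans (ncD _ _) _; rewrite !normcM ncX.
have h1 : nc x * nc (x ^+ n - y ^+ n) <= e * (n%:R * e ^+ n * (d / e)).
  by apply: ler_pM; rewrite ?nc_ge0.
have h2 : nc (x - y) * nc y ^+ n <= d * e ^+ n.
  apply: ler_pM => //; [exact: nc_ge0|by rewrite exprn_ge0 ?nc_ge0|exact: nc_pow_le].
apply: le_trans (lerD h1 h2) _.
by rewrite le_eqVlt; apply/predU1P; left; rewrite -natr1 exprS; field; rewrite gt_eqF.
Qed.

Lemma nc_monomialB (s : seq 'I_m) (nu : 'I_m -> nat) h (k : 'rV[CC R]_m) (e d : R) :
  0 < e -> small e h -> small e k -> (forall j, nc ((h - k) 0 j) <= d) -> 0 <= d ->
  nc (\prod_(j <- s) h 0 j ^+ nu j - \prod_(j <- s) k 0 j ^+ nu j) <=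
  (\sum_(j <- s) nu j)%:R * e ^+ (\sum_(j <- s) nu j) * (d / e).
Proof.
move=> e0 hs ks hkd d0; elim: s => [|j s IH].
  by rewrite !big_nil subrr normc0 !mul0r.
rewrite !big_cons; set p := \prod_(i <- s) h 0 i ^+ _; set q := \prod_(i <- s) _.
rewrite -/p -/q in IH; set N := (\sum_(i <- s) nu i)%N in IH *.
have -> : h 0 j ^+ nu j * p - k 0 j ^+ nu j * q =
   h 0 j ^+ nu j * (p - q) + (h 0 j ^+ nu j - k 0 j ^+ nu j) * q by ring.
have h1 : nc (h 0 j ^+ nu j) <= e ^+ nu j.
  by rewrite ncX; apply: nc_pow_le; exact: ltW (hs j).
have h2 : nc q <= e ^+ N.
  rewrite /q /N; elim: (s) => [|i s' IH']; first by rewrite !big_nil normc1.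
  rewrite !big_cons normcM exprD; apply: ler_pM; rewrite ?nc_ge0//.
  by rewrite ncX; apply: nc_pow_le; exact: ltW (ks i).
have h3 : nc (h 0 j ^+ nu j - k 0 j ^+ nu j) <= (nu j)%:R * e ^+ nu j * (d / e).
  apply: nc_powB => //; [exact: ltW (hs j)|exact: ltW (ks j)|].
  by have := hkd j; rewrite !mxE.
apply: le_trans (ncD _ _) _; rewrite !normcM.
apply: le_trans (lerD (ler_pM (nc_ge0 _) (nc_ge0 _) h1 IH)
  (ler_pM (nc_ge0 _) (nc_ge0 _) h3 h2)) _.
by rewrite le_eqVlt; apply/predU1P; left; rewrite natrD exprD; ring.
Qed.

(** Summation of the Lipschitz bounds for the monomials. The radius is divided by
    2^(m+2). In degree N this gains 2^(m N), which pays for the (N+1)^m exponents,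
    2^N, which pays for the factor N, and a last 2^N, which makes the sum
    converge. *)
Lemma analytic_lipschitz f c : analytic_at f c -> exists (rho K : R),
  [/\ 0 < rho, 0 <= K & forall h k (d : R), small rho h -> small rho k ->
     (forall j, nc ((h - k) 0 j) <= d) -> 0 <= d ->
     nc (f (c + h) - f (c + k)) <= K * d].
Proof.
move=> [A [rho [M [rho0 AM H]]]].
have rhoE : rho = (complex.Re rho)%:C by rewrite RRe_real// gtr0_real.
set r := complex.Re rho in rhoE.
have r0 : 0 < r by move: rho0; rewrite rhoE ltcR.
pose M' := complex.Re M.
have AM' nu : nc (A nu) * r ^+ (\sum_(k < m) nu k) <= M'.
  have := AM nu; rewrite rhoE normE -rmorphXn -rmorphM lecE => /andP[_].
  exact.
have M0 : 0 <= M'.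
  apply: le_trans (AM' (fun=> 0%N)); apply: mulr_ge0; [exact: nc_ge0|exact: exprn_ge0 (ltW r0)].
pose e := r / 2 ^+ (m + 2).
have e0 : 0 < e by rewrite divr_gt0// exprn_gt0.
have er : e <= r by rewrite ler_pdivrMr ?exprn_gt0// ler_peMr ?(ltW r0)// exprn_ege1// ler1n.
exists e, (2 * M' / e); split => //; first by rewrite divr_ge0 ?mulr_ge0// ltW.
move=> h k d hs ks hkd d0.
pose P N h := (\sum_(nu : {ffun 'I_m -> 'I_N.+1} | (\sum_(k < m) nu k == N)%N)
             A (fun l => nu l) * \prod_(k < m) h 0 k ^+ nu k) : CC R.
have conv v : small e v -> series (fun N => P N v : CC R) @ \oo --> f (c + v).
  move=> vs; apply: H => j; rewrite rhoE normE ltcR.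
  exact: lt_le_trans (vs j) er.
have term N : nc (P N h - P N k) <= M' / e * d * 2^-1 ^+ N.
  rewrite /P -sumrB; apply: le_trans (nc_sum _ _ _) _.
  apply: (@le_trans _ _ (\sum_(nu : {ffun 'I_m -> 'I_N.+1})
     (M' / r ^+ N * (N%:R * e ^+ N * (d / e))))).
    rewrite [leRHS](bigID (fun nu : {ffun 'I_m -> 'I_N.+1} => (\sum_(k < m) nu k == N)%N))/=.
    rewrite -[leLHS]addr0; apply: lerD; last first.
      apply: sumr_ge0 => nu _; rewrite !mulr_ge0 ?invr_ge0 ?exprn_ge0 ?(ltW r0) ?(ltW e0)//.
    apply: ler_sum => nu /eqP nuN; rewrite -mulrBr normcM.
    apply: ler_pM; rewrite ?nc_ge0//.
      by rewrite ler_pdivlMr ?exprn_gt0//; have := AM' (fun l => nu l); rewrite nuN; exact.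
    have := @nc_monomialB (index_enum 'I_m) (fun j => nu j) h k e d e0 hs ks hkd d0.
    by rewrite nuN.
  rewrite sumr_const card_ffun !card_ord -[leLHS]mulr_natl natrX.
  have N2 : (N.+1)%:R <= 2 ^+ N :> R.
    by rewrite -natrX ler_nat; exact: ltn_expl.
  have N1 : N%:R <= 2 ^+ N :> R by apply: le_trans N2; rewrite ler_nat.
  have b1 : N.+1%:R ^+ m * N%:R <= 2 ^+ N ^+ m * 2 ^+ N :> R.
    by apply: ler_pM; rewrite ?exprn_ge0// lerXn2r ?nnegrE ?exprn_ge0.
  have -> : N.+1%:R ^+ m * (M' / r ^+ N * (N%:R * e ^+ N * (d / e))) =
    M' / e * d * ((N.+1%:R ^+ m * N%:R) * (e ^+ N / r ^+ N)) by ring.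
  apply: ler_wpM2l; first by rewrite mulr_ge0// divr_ge0// ltW.
  apply: le_trans (ler_wpM2r _ b1) _.
    by rewrite divr_ge0 ?exprn_ge0// ltW.
  rewrite -expr_div_n.
  have -> : e / r = (2 ^+ (m + 2))^-1 by rewrite /e; field; rewrite !gt_eqF ?exprn_gt0.
  rewrite !exprVn ler_pdivrMr ?exprn_gt0// ler_pdivlMl ?exprn_gt0//.
  rewrite -!exprM -!exprD ler_weXn2l ?ler1n//.
  by nia.
have part N : nc (series (fun N => P N h : CC R) N - series (fun N => P N k : CC R) N)
    <= 2 * M' / e * d.
  rewrite /series /= -sumrB; apply: le_trans (nc_sum _ _ _) _.
  apply: le_trans (ler_sum _ (fun i _ => term i)) _.
  rewrite -mulr_sumr.
  have -> : 2 * M' / e * d = M' / e * d * 2 by ring.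
  apply: ler_wpM2l; first by rewrite mulr_ge0// divr_ge0// ltW.
  suff : \sum_(0 <= i < N) 2^-1 ^+ i <= 2 - 2 * 2^-1 ^+ N :> R.
    by move=> hN; apply: le_trans hN _; rewrite gerBl mulr_ge0// exprn_ge0// invr_ge0.
  elim: N => [|N IH]; first by rewrite big_geq// expr0; lra.
  by rewrite big_nat_recr//= exprS; lra.
apply/ler_addgt0Pr => e' e'0.
have e2 : 0 < (e' / 2)%:C :> CC R by rewrite ltcR divr_gt0.
have /cvgrPdist_le /(_ _ e2) [N1 _ HN1] := conv h hs.
have /cvgrPdist_le /(_ _ e2) [N2 _ HN2] := conv k ks.
have := HN1 (N1 + N2)%N (leq_addr _ _); have := HN2 (N1 + N2)%N (leq_addl _ _).
rewrite /= !normE !lecR => a2 a1.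
have := part (N1 + N2)%N; move: a1 a2.
set u := series _ _; set v := series _ _ => a1 a2 a3.
have -> : f (c + h) - f (c + k) = (f (c + h) - u) + (u - v) - (f (c + k) - v) by ring.
apply: le_trans (ncB _ _) _; have := ncD (f (c + h) - u) (u - v); lra.
Qed.

Lemma finite_radius (I : finType) (Q : I -> R -> Prop) :
  (forall i (e e' : R), Q i e -> 0 < e' -> e' <= e -> Q i e') ->
  (forall i, exists2 e, 0 < e & Q i e) ->
  exists2 e, 0 < e & forall i, Q i e.
Proof.
move=> mon H; have /choice[ee He] : forall i, exists e : R, 0 < e /\ Q i e.
  by move=> i; have [e e0 q] := H i; exists e.
pose E := \big[Num.min/1]_i ee i; have E0 : 0 < E.
  by apply/bigmin_gtP; split => // i _; case: (He i).
exists E => // i; have [_ q] := He i; apply: mon q _ _ => //.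
exact: bigmin_le_cond.
Qed.

End AnalyticLipschitz.

(** * Families of germs along a path *)

Section Germs.
Variables (R : realType) (m : nat).
Implicit Types (c h : 'rV[CC R]_m) (Q : 'rV[CC R]_m -> Prop).
Implicit Types (g : R -> 'rV[CC R]_m) (F : R -> 'rV[CC R]_m -> CC R).

Lemma near_small c Q : (\forall z \near c, Q z) ->
  exists2 rho : R, 0 < rho & forall h, small rho h -> Q (c + h).
Proof.
move=> /nbhs_ballP[e /= e0 H].
have eE : e = (complex.Re e)%:C by rewrite RRe_real// gtr0_real.
exists (complex.Re e); first by move: e0; rewrite eE ltcR.
move=> h hs; apply: H; split => // i j.
by rewrite ord1 /ball /= mxE opprD addNKr normrN normE eE ltcR.
Qed.

Lemma near_real (t : R) (Q : R -> Prop) : (\forall u \near t, Q u) ->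
  exists2 d : R, 0 < d & forall u, `|u - t| < d -> Q u.
Proof.
move=> /nbhs_ballP[e /= e0 H]; exists e => // u ut; apply: H.
by rewrite /ball /= distrC.
Qed.

Lemma within_path_continuous g : {within `[0, 1], continuous g} -> path_continuous g.
Proof.
move=> /subspace_continuousP gc t e t01 e0.
have tI : `[0, 1]%classic t by rewrite /= in_itv.
have nb : nbhs (g t) (fun z => small e (z - g t)).
  apply/nbhs_ballP; exists e%:C => /=; first by rewrite ltcR.
  move=> z [_ zb] j; have := zb 0 j.
  by rewrite /ball /= distrC normE ltcR !mxE.
have [d d0 Hd] := near_real (gc t tI _ nb).
by exists d => // u u01 ut; apply: Hd ut _; rewrite /= in_itv.
Qed.

Lemma path_continuous_affine (a : CC R) v g : a != 0 ->
  path_continuous (fun t => a *: g t + v) -> path_continuous g.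
Proof.
move=> a0 H t e t01 e0.
have na : 0 < nc a by rewrite lt_def nc_ge0 andbT; apply: contra_neq a0; exact: eq0_normc.
have [d d0 Hd] := H t (nc a * e) t01 (mulr_gt0 na e0).
exists d => // u u01 ut j; rewrite -(ltr_pM2l na) -normcM.
have := Hd u u01 ut j; rewrite !mxE.
by have -> : a * g u 0 j + v 0 j - (a * g t 0 j + v 0 j) = a * (g u 0 j - g t 0 j) by ring.
Qed.

(** The hypotheses of [germ_vanish], as a property of F that is stable under
    linear combinations and affine substitutions. *)
Definition germ_family g F :=
  (forall t, 0 <= t <= 1 -> hom_analytic (F t) (g t)) /\
  (forall t, 0 <= t <= 1 -> exists2 d : R, 0 < d & forall u, 0 <= u <= 1 ->
     `|u - t| < d -> zero_near (fun z => F u z - F t z) (g u)).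

Lemma germ_family_continuation g F :
  (forall t : R, 0 <= t <= 1 -> analytic_at (F t) (g t)) ->
  (forall t : R, 0 <= t <= 1 -> \forall u \near t, 0 <= u <= 1 ->
     \forall z \near g u, F u z = F t z) -> germ_family g F.
Proof.
move=> an loc; split=> t t01; first exact: analytic_hom (an t t01).
have [d d0 Hd] := near_real (loc t t01).
exists d => // u u01 ut; have [rho rho0 Hr] := near_small (Hd u ut u01).
by exists rho => // h hs; rewrite Hr// subrr.
Qed.

Lemma germ_family_affine (a : CC R) v g F : a != 0 ->
  germ_family (fun t => a *: g t + v) F ->
  germ_family g (fun t z => F t (a *: z + v)).
Proof.
move=> a0 [an loc]; split=> t t01; first exact: hom_analytic_affine (an t t01).
have na : 0 < nc a by rewrite lt_def nc_ge0 andbT; apply: contra_neq a0; exact: eq0_normc.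
have [d d0 Hd] := loc t t01; exists d => // u u01 ut.
have [rho rho0 Hr] := Hd u u01 ut.
exists (rho / nc a); first exact: divr_gt0.
move=> h hs; rewrite scalerDr addrAC; apply: Hr.
have -> : rho = nc a * (rho / nc a) by field; rewrite gt_eqF.
exact: smallZ hs.
Qed.

Lemma germ_family_sum (I : Type) (r : seq I) (P : pred I)
    (G : I -> R -> 'rV[CC R]_m -> CC R) (k : I -> CC R) g :
  (forall i, P i -> germ_family g (G i)) ->
  germ_family g (fun t z => \sum_(i <- r | P i) k i * G i t z).
Proof.
move=> H; split=> t t01.
  by apply: hom_analytic_sum => i Pi; apply: hom_analyticZ; case: (H i Pi) => + _; apply.
elim: r => [|i r [d d0 Hd]].
  by exists 1 => // u _ _; exists 1 => // h _; rewrite !big_nil subrr.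
have [Pi|Pi] := boolP (P i); last first.
  by exists d => // u u01 ut; have [rho rho0 Hr] := Hd u u01 ut;
    exists rho => // h hs; rewrite !big_cons (negbTE Pi); exact: Hr.
have [_ /(_ t t01)[d' d'0 Hd']] := H i Pi.
exists (Num.min d d'); first by rewrite lt_min d0.
move=> u u01; rewrite lt_min => /andP[/(Hd u u01)[rho rho0 Hr] /(Hd' u u01)[rho' rho'0 Hr']].
exists (Num.min rho rho'); first by rewrite lt_min rho0.
move=> h hs; rewrite !big_cons Pi.
have := Hr _ (small_le _ hs); have := Hr' _ (small_le _ hs).
rewrite !ge_min !lexx orbT => /(_ isT) h1 /(_ isT) h2.
by rewrite opprD addrACA h2 -mulrBr h1 mulr0 addr0.
Qed.

Lemma germ_family_vanish g F : path_continuous g -> germ_family g F ->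
  zero_near (F 0) (g 0) -> F 1 (g 1) = 0.
Proof.
move=> gc [an loc] F0; have [e e0 H] := germ_vanish gc an loc F0.
by rewrite -[g 1]addr0; apply: H => j; rewrite mxE normc0.
Qed.

(** The errors allowed are linear in p; dividing the relation by p leaves an error
    of order eta. *)
Lemma approximate_relation (J : Type) (r : seq J) (P : pred J) (k x : J -> CC R) :
  (forall eta : R, 0 < eta -> exists (p : R) (y : J -> CC R), [/\ 0 < p,
     (forall j, P j -> nc (y j - p%:C * x j) <= eta * p) &
     \sum_(j <- r | P j) k j * y j = 0]) ->
  \sum_(j <- r | P j) k j * x j = 0.
Proof.
move=> H; pose K := \sum_(j <- r | P j) nc (k j).
have K0 : 0 <= K by apply: sumr_ge0 => j _; exact: nc_ge0.
apply: nc_eps_eq0 => e e0.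
have [|p [y [p0 yx y0]]] := H (e / (K + 1)).
  by rewrite divr_gt0// ltr_wpDl.
rewrite -(ler_pM2l p0) -[X in X * nc _](gtr0_norm p0) -nc_real -normcM mulr_sumr.
have -> : \sum_(j <- r | P j) p%:C * (k j * x j) =
  - \sum_(j <- r | P j) k j * (y j - p%:C * x j).
  by rewrite -[RHS]add0r -[X in X - _]y0 -sumrB; apply: eq_bigr => j _; ring.
rewrite ncN; apply: le_trans (nc_sum _ _ _) _.
apply: (@le_trans _ _ (\sum_(j <- r | P j) nc (k j) * (e / (K + 1) * p))).
  by apply: ler_sum => j Pj; rewrite normcM ler_wpM2l ?nc_ge0// yx.
rewrite -mulr_suml -/K.
have -> : K * (e / (K + 1) * p) = (K / (K + 1)) * (p * e) by ring.
rewrite ger_pMl ?mulr_gt0// ler_pdivrMr ?mul1r ?lerDl//.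
by rewrite ltr_wpDl.
Qed.

End Germs.

(** * Boundary values of branches *)

Section Branches.
Variables (R : realType) (m : nat).
Variables (a b : 'I_m -> nat) (n : 'I_m -> int).
Implicit Types (hbar : CC R) (c h z : 'rV[CC R]_m) (E : {set 'I_m}).

Lemma Im_qpl_shift hbar E k : complex.Im (qpl_shift hbar a b E 0 k) =
  if k \in qpl_degenerate hbar a b then (-1) ^+ (k \in E) * pi else 0.
Proof.
rewrite mxE; case: ifP => // _.
have -> : (-1) ^+ (k \in E) = ((-1) ^+ (k \in E))%:C :> CC R.
  by rewrite rmorphXn rmorphN rmorph1.
by rewrite mulrA -rmorphM Im_realM /= mulr1.
Qed.

Lemma qpl_width_raised hbar k : qpl_width hbar (qpl_raised hbar a b) b k =
  qpl_width hbar a b k + (k \in qpl_degenerate hbar a b)%:R * pi.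
Proof. by rewrite /qpl_width /qpl_raised natrD; ring. Qed.

(** The points omega_k + i pi and omega_k - i pi lie on the boundary of the raised
    domain at the degenerate k. The interior is reached by decreasing the
    absolute value of these imaginary parts. *)
Lemma branch_boundary hbar e0 e c E (g : 'rV[CC R]_m -> CC R) (ks : seq 'I_m) :
  admissible hbar e0 -> 0 < e <= e0 -> qpl_base hbar a b c ->
  (forall k, k \in qpl_degenerate hbar a b -> (growth n + 3 <= multiplicity ks k)%N) ->
  analytic_at g (c + qpl_shift hbar a b E) ->
  (\forall z \near c + qpl_shift hbar a b E, qpl_dom hbar (qpl_raised hbar a b) b z ->
     g z = qpl hbar (qpl_raised hbar a b) b n z) ->
  exists2 rho : R, 0 < rho & forall h, real_vec h -> small rho h ->
  forall eta : R, 0 < eta -> exists2 d0 : R, 0 < d0 & forall d, 0 < d < d0 ->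
  nc (fdiff d ks (qplI hbar (qpl_raised hbar a b) b n (multiplicity ks) e)
        (c + qpl_shift hbar a b E + h) -
      (d ^+ size ks)%:C * (('i ^ (\sum_(k < m) n k - m%:Z))^-1 *
        g (c + qpl_shift hbar a b E + h))) <= eta * d ^+ size ks.
Proof.
move=> adm /andP[e_gt0 ee0] base hks an /near_small[rho1 rho10 agree].
have [rho2 [K [rho20 K0 lip]]] := analytic_lipschitz an.
set S := qpl_degenerate hbar a b in hks *.
set W := qpl_width hbar (qpl_raised hbar a b) b.
set s := qpl_shift hbar a b E in an agree lip *.
set u := 'i ^ _; have u0 : u != 0 by rewrite expfz_neq0 ?neq0Ci.
pose rho := Num.min rho1 rho2 / 2.
have rho0 : 0 < rho by rewrite divr_gt0// lt_min rho10.
have rho_1 : rho + rho <= rho1.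
  by rewrite /rho -splitr ge_min lexx.
have rho_2 : rho + rho <= rho2.
  by rewrite /rho -splitr ge_min lexx orbT.
exists rho => // h hr hs.
pose d := \row_k (if k \in S then - (-1) ^+ (k \in E) else 0) : 'rV[R]_m.
have ImE k t : complex.Im ((c + s + h + imag_dir d t) 0 k) =
    complex.Im (c 0 k) + (if k \in S then (-1) ^+ (k \in E) * (pi - t) else 0).
  have := Im_qpl_shift hbar E k; rewrite -/S -/s.
  rewrite !mxE !raddfD /= hr => ->.
  by case: ifP => _; rewrite /=; ring.
have ImE0 k : complex.Im ((c + s + h) 0 k) =
    complex.Im (c 0 k) + (if k \in S then (-1) ^+ (k \in E) * pi else 0).
  have := ImE k 0; rewrite subr0 => <-; congr (complex.Im _).
  by rewrite !mxE mul0r mulr0 addr0.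
have baseS k : k \in S -> complex.Im (c 0 k) = 0 /\ W k = pi.
  move=> kS; have := base k; rewrite -/S kS => ->; split => //.
  by rewrite /W qpl_width_raised -/S kS mul1r; move: kS; rewrite inE => /eqP->; rewrite add0r.
have baseN k : k \notin S -> `|complex.Im (c 0 k)| < W k.
  move=> kS; have := base k; rewrite -/S (negbTE kS) => h1.
  by rewrite /W qpl_width_raised -/S (negbTE kS) mul0r addr0.
apply: (@boundary_value _ _ _ _ _ _ e0 e adm e_gt0 ee0 ks (c + s + h) d
   (fun z => u^-1 * g z) pi (pi_gt0 R)).
- move=> t k /andP[t0 tpi]; rewrite ImE -/(W k); have [kS|kS] := boolP (k \in S).
    have [-> ->] := baseS k kS; rewrite add0r normrM normrX normrN1 expr1n mul1r.
    by rewrite gtr0_norm; lra.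
  by rewrite addr0; exact: baseN.
- move=> k; have [kS|kS] := boolP (k \in S); [right|left]; split.
  + rewrite ImE0 kS -/(W k); have [-> ->] := baseS k kS.
    by rewrite add0r normrM normrX normrN1 expr1n mul1r gtr0_norm// pi_gt0.
  + exact: hks.
  + by rewrite ImE0 (negbTE kS) addr0; exact: baseN.
  + by rewrite mxE (negbTE kS).
- move=> eta eta0; pose q := eta / (nc u^-1 * K + 1).
  have D0 : 0 < nc u^-1 * K + 1 by rewrite ltr_wpDl// mulr_ge0 ?nc_ge0.
  have q0 : 0 < q by rewrite divr_gt0.
  exists (Num.min rho q); first by rewrite lt_min rho0.
  move=> v vs; rewrite -mulrBr normcM -addrA.
  have vr : small rho v by apply: small_le vs; rewrite ge_min lexx.
  have vq : small q v by apply: small_le vs; rewrite ge_min lexx orbT.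
  have L : nc (g (c + s + (h + v)) - g (c + s + h)) <= K * q.
    apply: lip.
    + exact: small_le rho_2 (smallD hs vr).
    + by apply: small_le hs; apply: le_trans rho_2; rewrite lerDl ltW.
    + by move=> j; rewrite addrAC subrr add0r; exact: ltW (vq j).
    + exact: ltW.
  apply: le_trans (ler_wpM2l (nc_ge0 _) L) _.
  have -> : nc u^-1 * (K * q) = eta * (nc u^-1 * K / (nc u^-1 * K + 1)).
    by rewrite /q; ring.
  rewrite ger_pMr// ler_pdivrMr// mul1r lerDl//.
- exists rho => // v vs dom; rewrite -addrA agree.
  + by rewrite addrA (qplE n adm dom (e := e)) ?e_gt0// mulrA mulVf ?mul1r.
  + exact: small_le rho_1 (smallD hs vs).
  + by rewrite addrA.
Qed.

End Branches.

(** * Relations between branches *)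

Section Branches.
Variables (R : realType) (m : nat).
Variables (a b : 'I_m -> nat) (n : 'I_m -> int).
Implicit Types (hbar : CC R) (c h z : 'rV[CC R]_m) (E : {set 'I_m}).

(** At a degenerate k the width is 0 and the imaginary part is 0, so the point is
    on the boundary and the regularisation is needed. *)
Lemma base_decays hbar c nu : qpl_base hbar a b c ->
  (forall k, k \in qpl_degenerate hbar a b -> (growth n + 2 <= nu k)%N) ->
  omega_decays hbar a b n 0 nu c.
Proof.
move=> base hnu k; have := base k; case: ifPn => [kS ->|_ h1]; [right|by left].
split; last by rewrite addn0; exact: hnu.
by move: kS; rewrite inE normr0 => /eqP->.
Qed.

Lemma shifted_base_decays hbar c E nu : qpl_base hbar a b c ->
  (forall k, k \in qpl_degenerate hbar a b -> (growth n + 2 <= nu k)%N) ->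
  omega_decays hbar (qpl_raised hbar a b) b n 0 nu (c + qpl_shift hbar a b E).
Proof.
move=> base hnu k; rewrite mxE raddfD /= Im_qpl_shift qpl_width_raised.
have := base k; case: ifPn => [kS ->|_ h1]; [right|left]; last first.
  by rewrite mul0r !addr0.
split; last by rewrite addn0; exact: hnu.
rewrite add0r mul1r normrM normrX normrN1 expr1n mul1r gtr0_norm ?pi_gt0//.
by move: kS; rewrite inE => /eqP->; rewrite add0r.
Qed.

Lemma base_forward hbar c c' : qpl_base hbar a b c ->
  (forall k, complex.Im (c' 0 k) = complex.Im (c 0 k)) -> qpl_base hbar a b c'.
Proof. by move=> base ImE k; rewrite ImE; exact: base. Qed.

(** Three orders beyond the growth: two for absolute convergence on the closed
    domain and one for continuity there. *)
Definition multisteps (S : {set 'I_m}) : seq 'I_m :=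
  flatten (nseq (growth n + 3) (enum S)).

Lemma multiplicityE (ks : seq 'I_m) (k : 'I_m) : multiplicity ks k = count_mem k ks.
Proof. by elim: ks => [//|j ks IH]; rewrite /= /succ_at IH addnC eq_sym. Qed.

Lemma multiplicity_multisteps (S : {set 'I_m}) (k : 'I_m) : k \in S -> (growth n + 3 <= multiplicity (multisteps S) k)%N.
Proof.
move=> kS; rewrite multiplicityE /multisteps; elim: (growth n + 3)%N => [//|N IH].
rewrite /= count_cat count_uniq_mem ?enum_uniq// mem_enum kS add1n ltnS.
exact: IH.
Qed.

Lemma sum_multiplicity (ks : seq 'I_m) : (\sum_k multiplicity ks k = size ks)%N.
Proof.
elim: ks => [|j ks IH]; first by rewrite big1.
rewrite /= big_split /= IH (bigD1 j)//= eqxx big1 ?addn0 ?addn1//.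
by move=> i /negbTE->.
Qed.

Section Relation.
Variables (J : finType) (j0 : J).
Variables (hbar : J -> CC R) (lam e0 e : J -> R) (v : J -> 'rV[CC R]_m).
Variables (kap : J -> CC R) (S : {set 'I_m}).
Hypotheses (adm : forall j, admissible (hbar j) (e0 j)).
Hypotheses (ee0 : forall j, 0 < e j <= e0 j) (lam_gt0 : forall j, 0 < lam j).
Hypothesis degenerateE : forall j, qpl_degenerate (hbar j) a b = S.
Local Notation phi j := (fun z : 'rV[CC R]_m => (lam j)%:C *: z + v j).
Local Notation raised_qplI j ks :=
  (qplI (hbar j) (qpl_raised (hbar j) a b) b n (multiplicity ks) (e j)).
Hypothesis regular_relation : forall nu omega,
  (forall j, omega_decays (hbar j) a b n 0 nu (phi j omega)) ->
  \sum_j kap j * ((lam j)^-1 ^+ (\sum_k nu k))%:C *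
     qplI (hbar j) a b n nu (e j) (phi j omega) = 0.

(** The finite difference of the hypothesis [regular_relation], with each
    regularised integral written as an alternating sum of raised ones. The steps
    lam * d compensate the dilations, so that one step d is taken in omega for all
    members of the relation. *)
Lemma regular_corner_relation d omega : 0 < d ->
  (forall j, qpl_base (hbar j) a b (phi j omega)) ->
  let ks := multisteps S in
  \sum_(p : J * {set 'I_m} | p.2 \subset S) (kap p.1 * (-1) ^+ #|p.2|) *
    (((lam p.1)^-1 ^+ size ks)%:C *
     fdiff (lam p.1 * d) ks (raised_qplI p.1 ks)
       (phi p.1 omega + qpl_shift (hbar p.1) a b p.2)) = 0.
Proof.
move=> d0 base ks; pose L := size ks.
have baseF omega' j D : forward D omega omega' -> qpl_base (hbar j) a b (phi j omega').
  move=> F; apply: base_forward (base j) _ => k.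
  by rewrite !mxE !raddfD /= !Im_realM (forward_Im k F).
have large j k : k \in qpl_degenerate (hbar j) a b -> (growth n + 2 <= multiplicity ks k)%N.
  rewrite degenerateE => kS; apply: leq_trans (multiplicity_multisteps kS).
  by rewrite leq_add2l.
rewrite -(pair_big_dep xpredT (fun _ E => E \subset S) (fun j E => (kap j * (-1) ^+ #|E|) *
    (((lam j)^-1 ^+ L)%:C *
     fdiff (lam j * d) ks (raised_qplI j ks)
       (phi j omega + qpl_shift (hbar j) a b E))))/=.
transitivity (fdiff d ks (fun z => \sum_j kap j * ((lam j)^-1 ^+ L)%:C *
     qplI (hbar j) a b n (multiplicity ks) (e j) (phi j z)) omega).
  rewrite fdiff_sum; apply: eq_bigr => j _.
  rewrite fdiffZ.
  transitivity (kap j * ((lam j)^-1 ^+ L)%:C * fdiff d ks (fun z =>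
    \sum_(E : {set 'I_m} | E \subset S) (-1) ^+ #|E| *
    raised_qplI j ks
      (phi j z + qpl_shift (hbar j) a b E)) omega); last first.
    congr (_ * _); apply: fdiff_ext => [|z F]; first exact: ltW.
    rewrite -(degenerateE j); apply: (qplI_difference (adm j) (ee0 j)) => E _.
    exact: shifted_base_decays (baseF _ _ _ F) (large j).
  rewrite fdiff_sum mulr_sumr; apply: eq_bigr => E _.
  rewrite fdiffZ; set G := qplI _ _ _ _ _ _.
  have -> : fdiff (lam j * d) ks G (phi j omega + qpl_shift (hbar j) a b E) =
     fdiff d ks (fun z => G (phi j z + qpl_shift (hbar j) a b E)) omega.
    rewrite -addrA fdiff_affine; apply: fdiff_ext => [|z _]; first exact: ltW.
    by rewrite addrA.
  by ring.
transitivity (fdiff d ks (fun=> 0) omega).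
  apply: fdiff_ext => [|z F]; first exact: ltW.
  rewrite -[RHS](regular_relation (nu := multiplicity ks) (omega := z)).
    by rewrite sum_multiplicity.
  by move=> j; apply: base_decays (large j); exact: baseF F.
by elim: (ks) (omega) => [//|k ks' IH] z /=; rewrite !IH subrr.
Qed.


(** The branches inherit every finite linear relation of the regularised
    integrals. The power of lam in the hypothesis is the one by which the
    regularising factors scale; for the empty regularisation it disappears. *)
Lemma branch_relation (gamma : R -> 'rV[CC R]_m) (val : J -> CC R) :
  (forall j, qpl_branch (hbar j) a b n (fun t => phi j (gamma t)) (val j)) ->
  \sum_j kap j * val j = 0.
Proof.
move=> br; pose P (p : J * {set 'I_m}) := p.2 \subset S.
have base j : qpl_base (hbar j) a b (phi j (gamma 0)) by have [] := br j.
have lam0 j : (lam j)%:C != 0 :> CC R by rewrite fmorph_eq0 gt_eqF.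
(* one germ for each member j of the relation and each corner E *)
have [w Hw] : exists w : J * {set 'I_m} -> CC R,
    (forall p, P p -> continues_to (qpl_dom (hbar p.1) (qpl_raised (hbar p.1) a b) b)
       (qpl (hbar p.1) (qpl_raised (hbar p.1) a b) b n)
       (fun t => phi p.1 (gamma t) + qpl_shift (hbar p.1) a b p.2) (w p)) /\
    \sum_j kap j * val j = \sum_(p | P p) (kap p.1 * (-1) ^+ #|p.2|) * w p.
  have /choice[w Hw] : forall j, exists w : {set 'I_m} -> CC R,
    (forall E : {set 'I_m}, E \subset S ->
      continues_to (qpl_dom (hbar j) (qpl_raised (hbar j) a b) b)
       (qpl (hbar j) (qpl_raised (hbar j) a b) b n)
       (fun t => phi j (gamma t) + qpl_shift (hbar j) a b E) (w E)) /\
    val j = \sum_(E : {set 'I_m} | E \subset S) (-1) ^+ #|E| * w E.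
    by move=> j; have [_ _ [w]] := br j; rewrite degenerateE; exists w.
  exists (fun p => w p.1 p.2); split; first by move=> p Pp; case: (Hw p.1) => + _; apply.
  rewrite -(pair_big_dep xpredT (fun _ E => E \subset S)
     (fun j E => (kap j * (-1) ^+ #|E|) * w j E))/=.
  apply: eq_bigr => j _; have [_ ->] := Hw j.
  by rewrite mulr_sumr; apply: eq_bigr => E _; rewrite mulrA.
have [cont ->] := Hw.
pose delta p t : 'rV[CC R]_m := phi p.1 (gamma t) + qpl_shift (hbar p.1) a b p.2.
have /choice[g Hg] : forall p, exists g : R -> 'rV[CC R]_m -> CC R, P p ->
   [/\ forall t : R, 0 <= t <= 1 -> analytic_at (g t) (delta p t),
        forall t : R, 0 <= t <= 1 -> \forall u \near t, 0 <= u <= 1 ->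
          \forall z \near delta p u, g u z = g t z,
        \forall z \near delta p 0, qpl_dom (hbar p.1) (qpl_raised (hbar p.1) a b) b z ->
          g 0 z = qpl (hbar p.1) (qpl_raised (hbar p.1) a b) b n z
      & w p = g 1 (delta p 1)].
  move=> p; have [Pp|nPp] := boolP (P p); last by exists (fun _ _ => 0) => Pp; case/negP: nPp.
  by have [g gP] := cont p Pp; exists g.
pose psi (p : J * {set 'I_m}) z : 'rV[CC R]_m := (lam p.1)%:C *: z + (v p.1 + qpl_shift (hbar p.1) a b p.2).
have deltaE p t : delta p t = psi p (gamma t) by rewrite /delta /psi addrA.
pose k (p : J * {set 'I_m}) : CC R := kap p.1 * (-1) ^+ #|p.2|.
have gam : path_continuous gamma.
  apply: (path_continuous_affine (lam0 j0) (v := v j0)).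
  by apply: within_path_continuous; have [] := br j0.
have gf : germ_family gamma (fun t z => \sum_(p | P p) k p * g p t (psi p z)).
  apply: (@germ_family_sum R m _ _ P (fun p t z => g p t (psi p z)) k) => p Pp.
  apply: germ_family_affine; first exact: lam0.
  have [an loc _ _] := Hg p Pp.
  apply: germ_family_continuation => t t01.
    by have := an t t01; rewrite deltaE; exact.
  apply: filterS (loc t t01) => u Hu u01; have := Hu u01; rewrite deltaE; exact.
rewrite (eq_bigr (fun p => k p * g p 1 (psi p (gamma 1)))); last first.
  by move=> p Pp; have [_ _ _ ->] := Hg p Pp; rewrite deltaE.
apply: (germ_family_vanish gam gf); case: (gf) => an0 _.
have I01 : 0 <= (0 : R) <= 1 by rewrite lexx ler01.
apply: (identity_real (an0 0 I01)) => {an0}.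
set ks := multisteps S; set u := 'i ^ (\sum_(k < m) n k - m%:Z) : CC R.
have u0 : u != 0 by rewrite expfz_neq0 ?neq0Ci.
(* a radius around the base points that serves all germs *)
have [rho rho0 bd] : exists2 rho : R, 0 < rho & forall p, P p ->
    forall h, real_vec h -> small rho h ->
    forall eta : R, 0 < eta -> exists2 d0 : R, 0 < d0 & forall d, 0 < d < d0 ->
    nc (fdiff d ks (raised_qplI p.1 ks)
          (delta p 0 + h) -
        (d ^+ size ks)%:C * (u^-1 * g p 0 (delta p 0 + h))) <= eta * d ^+ size ks.
  apply: finite_radius => [p r r' H _ le Pp h hr hs|p].
    exact: H Pp h hr (small_le le hs).
  have [Pp|nPp] := boolP (P p); last by exists 1 => // Pp; case/negP: nPp.
  have [an _ agree _] := Hg p Pp.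
  have large i : i \in qpl_degenerate (hbar p.1) a b -> (growth n + 3 <= multiplicity ks i)%N.
    by rewrite degenerateE; exact: multiplicity_multisteps.
  have [rho rho0 H] := branch_boundary (adm p.1) (ee0 p.1) (base p.1) large (an 0 I01) agree.
  by exists rho.
have [rho' rho'0 Hrho'] : exists2 r : R, 0 < r & forall j (h : 'rV[CC R]_m),
    small r h -> small rho ((lam j)%:C *: h).
  apply: finite_radius => [j r r' H _ le h hs|j].
    exact: H (small_le le hs).
  exists (rho / lam j); first exact: divr_gt0.
  move=> h hs; have -> : rho = lam j * (rho / lam j) by field; rewrite gt_eqF.
  by apply: smallZ hs => //; rewrite nc_real gtr0_norm.
exists rho' => // h hr hs.
have psih p : psi p (gamma 0 + h) = delta p 0 + (lam p.1)%:C *: h.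
  by rewrite deltaE /psi scalerDr addrAC.
have hrl j : real_vec ((lam j)%:C *: h) by move=> i; rewrite mxE Im_realM hr mulr0.
suff : u^-1 * \sum_(p | P p) k p * g p 0 (psi p (gamma 0 + h)) = 0.
  by move/eqP; rewrite mulf_eq0 invr_eq0 (negbTE u0) => /eqP.
rewrite mulr_sumr (eq_bigr (fun p => k p * (u^-1 * g p 0 (psi p (gamma 0 + h))))); last first.
  by move=> p _; ring.
apply: approximate_relation => eta eta0.
(* a step that serves all germs, for the given point and precision *)
have [d1 d10 Hd1] : exists2 r : R, 0 < r & forall p, P p -> forall d, 0 < d < r ->
   nc (fdiff (lam p.1 * d) ks (raised_qplI p.1 ks)
        (psi p (gamma 0 + h)) -
      ((lam p.1 * d) ^+ size ks)%:C * (u^-1 * g p 0 (psi p (gamma 0 + h))))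
      <= eta * (lam p.1 * d) ^+ size ks.
  apply: finite_radius => [p r r' H _ le Pp d /andP[d0 dr]|p].
    by apply: H => //; rewrite d0 (lt_le_trans dr le).
  have [Pp|nPp] := boolP (P p); last by exists 1 => // Pp; case/negP: nPp.
  have [d0 d00 H] := bd p Pp _ (hrl p.1) (Hrho' p.1 h hs) eta eta0.
  exists (d0 / lam p.1); first exact: divr_gt0.
  move=> _ d /andP[d_gt0 dl]; rewrite psih; apply: H.
  by rewrite mulr_gt0//= mulrC -ltr_pdivlMr.
pose d := d1 / 2; have d0 : 0 < d by rewrite divr_gt0.
have dd1 : 0 < d < d1 by rewrite d0 /d; lra.
exists (d ^+ size ks), (fun p => ((lam p.1)^-1 ^+ size ks)%:C *
  fdiff (lam p.1 * d) ks (raised_qplI p.1 ks)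
       (psi p (gamma 0 + h))); split; first exact: exprn_gt0.
- move=> p Pp; set x := _ * g _ _ _.
  have lamd : (lam p.1)^-1 ^+ size ks * (lam p.1 * d) ^+ size ks = d ^+ size ks.
    by rewrite -exprMn mulKf// gt_eqF.
  rewrite -lamd rmorphM /= -mulrA -mulrBr normcM nc_real ger0_norm; last first.
    by rewrite exprn_ge0// invr_ge0 ltW.
  rewrite [leRHS]mulrCA; apply: ler_wpM2l; last exact: Hd1.
  by rewrite exprn_ge0// invr_ge0 ltW.
- rewrite -[RHS](@regular_corner_relation d (gamma 0 + h) d0).
    by apply: eq_bigr => p _; rewrite /psi addrA.
  move=> j; apply: base_forward (base j) _ => i.
  by rewrite !mxE !raddfD /= !Im_realM raddfD /= hr addr0.
Qed.

End Relation.
End Branches.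

(** * The distribution relation for branches *)

Lemma big_option (V : nmodType) (T : finType) (F : option T -> V) :
  \sum_x F x = F None + \sum_y F (Some y).
Proof.
rewrite (bigD1 None)//=; congr (_ + _).
rewrite (reindex_omap Some id)/=; last by case.
by apply: eq_bigl => y; rewrite eqxx.
Qed.

Section SecondPart.
Variables (R : realType) (hbar : CC R) (r s : nat) (m : nat).
Variables (a b : 'I_m -> nat) (n : 'I_m -> int).
Hypotheses (r_gt0 : (0 < r)%N) (s_gt0 : (0 < s)%N).

(** The width is 0 if and only if a_k = 0 and b_k Re hbar = 0, and this is
    insensitive to positive factors of hbar. *)
Lemma degenerate_distribution :
  qpl_degenerate (r%:R / s%:R * hbar) a b = qpl_degenerate hbar a b.
Proof.
have : 0 < r%:R / s%:R :> R by rewrite divr_gt0 ?ltr0n.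
move=> rs0; apply/setP => k; rewrite !inE /qpl_width Re_hbar'; move: rs0; move: (r%:R / s%:R) => q q0.
have h t : 0 <= t -> 0 <= (b k)%:R * t :> R by exact: mulr_ge0.
rewrite normrM (gtr0_norm q0); move: (pi_gt0 R) (pi) => _ P.
rewrite !(mulf_eq0 P) !paddr_eq0 ?h ?(mulr_ge0 (ltW q0))//.
by rewrite !mulf_eq0 (gt_eqF q0).
Qed.

Lemma zeta_affine (alpha : qpl_family a r) (beta : qpl_family b s) z :
  zeta hbar alpha beta z = (1 : R)%:C *: z + zeta hbar alpha beta 0.
Proof. by apply/rowP => k; rewrite !mxE; ring. Qed.

(** [branch_relation] for the family that consists of the left-hand side, indexed
    by None, and of the terms of the right-hand side. *)
Lemma qpl_branch_distribution (gamma : R -> 'rV[CC R]_m) (v : CC R)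
    (w : qpl_family a r -> qpl_family b s -> CC R) :
  qpl_branch (r%:R / s%:R * hbar) a b n (fun t => r%:R *: gamma t) v ->
  (forall alpha beta,
     qpl_branch hbar a b n (fun t => zeta hbar alpha beta (gamma t)) (w alpha beta)) ->
  v = r%:R ^ (\sum_(k < m) n k - m%:Z) *
      \sum_(alpha : qpl_family a r) \sum_(beta : qpl_family b s) w alpha beta.
Proof.
move=> bv bw; have [e0 [e0' [e [adm adm' ee0 ee']]]] := common_contour hbar s r_gt0.
set c := r%:R ^ _.
pose J := option (qpl_family a r * qpl_family b s).
pose hb (j : J) := if j is Some _ then hbar else r%:R / s%:R * hbar.
pose lam (j : J) : R := if j is Some _ then 1 else r%:R.
pose ad (j : J) := if j is Some _ then e0 else e0'.
pose ee (j : J) := if j is Some _ then e else e / r%:R.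
pose tr (j : J) : 'rV[CC R]_m := if j is Some p then zeta hbar p.1 p.2 0 else 0.
pose kap (j : J) : CC R := if j is Some _ then - c else 1.
pose val (j : J) : CC R := if j is Some p then w p.1 p.2 else v.
have := @branch_relation R m a b n J None hb lam ad ee tr kap
  (qpl_degenerate hbar a b) _ _ _ _ _ gamma val.
rewrite big_option /= mul1r -mulr_sumr -(pair_bigA _ w) mulNr /=.
move=> H; apply/eqP; rewrite -subr_eq0; apply/eqP; apply: H.
- by case.
- by case.
- by case=> //=; rewrite ltr0n.
- by case=> [p//|]; exact: degenerate_distribution.
- move=> nu omega dec; rewrite big_option /= mul1r addr0.
  have dec' := dec None; rewrite /= addr0 -nat_complexE in dec'.
  rewrite -nat_complexE (qplI_distribution r_gt0 s_gt0 adm ee0 dec') -/c.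
  rewrite rmorphXn fmorphV rmorph_nat.
  have r0 : r%:R != 0 :> CC R by rewrite pnatr_eq0 -lt0n.
  have -> (x : CC R) : r%:R^-1 ^+ (\sum_k nu k) * (c * r%:R ^+ (\sum_k nu k) * x) = c * x.
    by rewrite exprVn; field; exact: expf_neq0.
  rewrite pair_bigA /= mulr_sumr -big_split /= big1// => p _.
  rewrite invr1 expr1n mulr1 -zeta_affine; ring.
- case=> [p|] /=.
    by rewrite (_ : (fun t => _) = (fun t => zeta hbar p.1 p.2 (gamma t)))//;
      apply/funext => t; rewrite -zeta_affine.
  by rewrite (_ : (fun t => _) = (fun t => r%:R *: gamma t))//;
    apply/funext => t; rewrite -nat_complexE addr0.
Qed.

End SecondPart.

Theorem theorem1p6 (R : realType) (hbar : CC R) (r s : nat)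
    (r_gt0 : (0 < r)%N) (s_gt0 : (0 < s)%N) (coprime_rs : coprime r s)
    (m : nat) (m_gt0 : (1 <= m)%N)
    (a b : 'I_m -> nat) (n : 'I_m -> int) :
  (forall omega : 'rV[CC R]_m,
     qpl_dom (r%:R / s%:R * hbar) a b (r%:R *: omega) ->
     qpl (r%:R / s%:R * hbar) a b n (r%:R *: omega) =
     r%:R ^ (\sum_(k < m) n k - m%:Z) *
     \sum_(alpha : qpl_family a r) \sum_(beta : qpl_family b s)
        qpl hbar a b n (zeta hbar alpha beta omega)) /\
  (forall (gamma : R -> 'rV[CC R]_m) (v : CC R)
          (w : qpl_family a r -> qpl_family b s -> CC R),
     qpl_branch (r%:R / s%:R * hbar) a b n (fun t => r%:R *: gamma t) v ->
     (forall alpha beta,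
        qpl_branch hbar a b n (fun t => zeta hbar alpha beta (gamma t))
                   (w alpha beta)) ->
     v = r%:R ^ (\sum_(k < m) n k - m%:Z) *
         \sum_(alpha : qpl_family a r) \sum_(beta : qpl_family b s) w alpha beta).
Proof.
split=> [omega|gamma v w]; first exact: qpl_distribution.
exact: qpl_branch_distribution.
Qed.
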